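(* Let $\lambda>1$ and $\mu>0$. There exists $\nu_0>\mu\varrho(\lambda)$ such that for every $\nu\ge\nu_0$ the following holds. Let $\{\omega_n\}_{n\ge1}$ be a sequence of functions on $\Pi$ with $\omega_n\ge0$, $\omega_n\in L^1(\Pi)\cap L^2(\Pi)$, $\int_\Pi\omega_n\,dx\le\nu$ and $\|\omega_n\|_2\le C$ for all $n$ (for some constant $C$), such that $\mu_n:=\int_\Pi x_2\omega_n\,dx\to\mu$ and $\mathcal E_\lambda(\omega_n)\to S_{\mu,\nu,\lambda}$ as $n\to\infty$. Then there exist $\omega\in\Sigma_{\mu,\nu,\lambda}$, a subsequence $\{\omega_{n_k}\}$ and real numbers $\{c_k\}$ such that, as $k\to\infty$, $$\omega_{n_k}(\cdot+c_k\mathrm e_1)\to\omega\ \text{in }L^2(\Pi)\qquad\text{and}\qquad x_2\,\omega_{n_k}(\cdot+c_k\mathrm e_1)\to x_2\,\omega\ \text{in }L^1(\Pi).$$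
   Context: Let $\Pi=\{x=(x_1,x_2)\in\mathbb R^2: x_2>0\}$, $\mathrm e_1=(1,0)$, and for $x=(x_1,x_2)$ write $\bar x=(x_1,-x_2)$. Let $G(x,y)=\frac{1}{2\pi}K_0(|x-y|)$ be the fundamental solution of $-\Delta+\mathrm{Id}$ on $\mathbb R^2$ ($K_0$ the modified Bessel function of the second kind of order zero). Set $G_\Pi(x,y)=G(x,y)-G(\bar x,y)$ for $x,y\in\Pi$, $\mathcal G\omega(x)=\int_\Pi G_\Pi(x,y)\omega(y)\,dy$, $E(\omega)=\frac12\int_\Pi\omega\,\mathcal G\omega\,dx$ and $I(\omega)=\int_\Pi x_2\omega\,dx$. $\|\cdot\|_p$ denotes the $L^p(\Pi)$ norm. Variational problem: for $\lambda>1,\mu>0,\nu>0$ let $\mathcal A_{\mu,\nu}=\{\omega\in L^2(\Pi):\omega\ge0,\ \int_\Pi x_2\omega\,dx=\mu,\ \int_\Pi\omega\,dx\le\nu\}$, $\mathcal E_\lambda(\omega)=E(\omega)-\frac1{2\lambda}\int_\Pi\omega^2\,dx$, $S_{\mu,\nu,\lambda}=\sup_{\omega\in\mathcal A_{\mu,\nu}}\mathcal E_\lambda(\omega)$, and $\Sigma_{\mu,\nu,\lambda}=\{\omega\in\mathcal A_{\mu,\nu}:\mathcal E_\lambda(\omega)=S_{\mu,\nu,\lambda}\}$. Lamb dipole: for $\lambda>1$ let $a=a(\lambda)$ be the smallest positive solution of $$a\Big(\frac{K_1'(a)}{K_1(a)}+\frac{1}{(\lambda-1)^{1/2}}\cdot\frac{J_1'((\lambda-1)^{1/2}a)}{J_1((\lambda-1)^{1/2}a)}\Big)=\frac{\lambda}{\lambda-1},$$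 where $J_1$ is the Bessel function of the first kind of order one and $K_1$ the modified Bessel function of the second kind of order one (such a smallest positive solution exists). For $W>0$, in polar coordinates $x=(r\cos\theta,r\sin\theta)$, define $$\Psi_L^{\lambda,W}(x)=\begin{cases}\big(A_LJ_1((\lambda-1)^{1/2}r)+\frac{W\lambda}{\lambda-1}r\big)\sin\theta,& r\le a,\\ \frac{Wa}{K_1(a)}K_1(r)\sin\theta,& r>a,\end{cases}\qquad A_L=-\frac{Wa}{(\lambda-1)J_1((\lambda-1)^{1/2}a)},$$ and $\omega_L^{\lambda,W}=\lambda(\Psi_L^{\lambda,W}-Wx_2)_+$ on $\Pi$. Finally $\varrho(\lambda)=\frac{1}{I(\omega_L^{\lambda,1})}\int_\Pi\omega_L^{\lambda,1}\,dx$. *)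

(* Defs.v *)
From HB Require Import structures.
From mathcomp Require Import all_boot all_order all_algebra.
From mathcomp Require Import all_classical all_reals all_analysis.
Set Implicit Arguments. Unset Strict Implicit. Unset Printing Implicit Defensive.
Import Order.TTheory GRing.Theory Num.Theory.
Import numFieldNormedType.Exports.
Local Open Scope classical_set_scope.
Local Open Scope ring_scope.

Section Defs.
Variable R : realType.

Definition leb2 := ((@lebesgue_measure R) \x (@lebesgue_measure R))%E.

Definition Pi : set (R * R) := [set x | 0 < x.2].

Definition intPi (f : R * R -> \bar R) : \bar R := (\int[leb2]_(x in Pi) f x)%E.

Definition enorm (x : R * R) : R := Num.sqrt (x.1 ^+ 2 + x.2 ^+ 2).
Definition refl (x : R * R) : R * R := (x.1, - x.2).

Definition cosh (t : R) : R := (expR t + expR (- t)) / 2.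

(* Modified Bessel functions of the second kind, integral representation
   K_nu(r) = int_0^oo exp(-r cosh t) cosh(nu t) dt  (r > 0) *)
Definition K0 (r : R) : R :=
  fine (\int[@lebesgue_measure R]_(t in [set t : R | (0 <= t)%R]) (expR (- (r * cosh t))%R)%:E)%E.
Definition K1 (r : R) : R :=
  fine (\int[@lebesgue_measure R]_(t in [set t : R | (0 <= t)%R])
          (expR (- (r * cosh t)) * cosh t)%R%:E)%E.

(* Bessel function of the first kind of order one (power series) *)
Definition J1 (x : R) : R :=
  limn (series (fun k : nat =>
    (-1) ^+ k * (x / 2) ^+ (2 * k + 1) / ((k`!)%:R * ((k.+1)`!)%:R))).

(* fundamental solution of -Delta + Id and Green function of the half-plane *)
Definition G (x y : R * R) : R := (2 * pi)^-1 * K0 (enorm (x - y)).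
Definition GPi (x y : R * R) : R := G x y - G (refl x) y.

Definition mass (w : R * R -> R) : \bar R := intPi (fun x => (w x)%:E).
Definition impulse (w : R * R -> R) : \bar R := intPi (fun x => (x.2 * w x)%:E).
Definition sqL2 (w : R * R -> R) : \bar R := intPi (fun x => (w x ^+ 2)%:E).
Definition Gop (w : R * R -> R) (x : R * R) : \bar R :=
  intPi (fun y => (GPi x y * w y)%:E).
Definition energy (w : R * R -> R) : \bar R :=
  ((2^-1)%:E * intPi (fun x => (w x)%:E * Gop w x))%E.
Definition Elam (lam : R) (w : R * R -> R) : \bar R :=
  (energy w - ((2 * lam)^-1)%:E * sqL2 w)%E.

Definition inL1 (w : R * R -> R) : Prop :=
  measurable_fun Pi w /\ (intPi (fun x => (`|w x|)%:E) < +oo)%E.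
Definition inL2 (w : R * R -> R) : Prop :=
  measurable_fun Pi w /\ (sqL2 w < +oo)%E.
Definition nonneg_on_Pi (w : R * R -> R) : Prop := forall x, Pi x -> 0 <= w x.

Definition Aclass (mu nu : R) : set (R * R -> R) :=
  [set w | inL2 w /\ nonneg_on_Pi w /\ impulse w = mu%:E /\ (mass w <= nu%:E)%E].

Definition Sval (mu nu lam : R) : \bar R := ereal_sup [set Elam lam w | w in Aclass mu nu].
Definition Sigma (mu nu lam : R) : set (R * R -> R) :=
  [set w | Aclass mu nu w /\ Elam lam w = Sval mu nu lam].

Definition lamb_eq (lam a : R) : Prop :=
  J1 (Num.sqrt (lam - 1) * a) != 0 /\
  a * (derive1 K1 a / K1 a
       + (Num.sqrt (lam - 1))^-1 * (derive1 J1 (Num.sqrt (lam - 1) * a) / J1 (Num.sqrt (lam - 1) * a)))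
  = lam / (lam - 1).
(* a(lambda): the smallest positive solution (= infimum of the positive solutions,
   since the smallest one exists) *)
Definition lamb_a (lam : R) : R := inf [set a | 0 < a /\ lamb_eq lam a].

Definition PsiL (lam W : R) (x : R * R) : R :=
  let a := lamb_a lam in
  let r := enorm x in
  let sinth := x.2 / r in
  let AL := - (W * a) / ((lam - 1) * J1 (Num.sqrt (lam - 1) * a)) in
  if r <= a then (AL * J1 (Num.sqrt (lam - 1) * r) + W * lam / (lam - 1) * r) * sinth
  else W * a / K1 a * K1 r * sinth.

Definition omegaL (lam W : R) (x : R * R) : R := lam * Num.max (PsiL lam W x - W * x.2) 0.

Definition rho (lam : R) : R := fine (mass (omegaL lam 1)) / fine (impulse (omegaL lam 1)).

Definition shift1 (w : R * R -> R) (c : R) (x : R * R) : R := w (x.1 + c, x.2).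

End Defs.

(* Main.v *)
(* E_lambda is quadratic and the impulse is linear, so without the mass constraint the supremum at
   impulse a is S a^2, where S > 0 because lambda > 1: on indicators of large squares E is nearly
   half the squared L^2 norm. Deleting from a competitor the region where its potential is small
   compared with x_2 costs little energy and frees impulse, which is worth more when it is restored
   by scaling; as G_Pi(x,y) <= x_2 b(x - y) with b integrable, what remains has mass at most M mu.
   Hence for nu >= M mu the mass constraint is inactive and the supremum is S mu^2.
   Split the kernel into a singular part of small L^1 norm and a part at most C x_2 y_2, which is
   negligible for distant points. This shows that the impulse of a maximizing sequence does not
   vanish, so after translations along e_1 a subsequence has a weak L^2 limit v of impulse m > 0.
   Cut the functions along a large square: the interaction energy of the inner part converges and
   the outer part contributes at most S (mu - m)^2. Therefore
   S mu^2 <= E_lambda(v) + S (mu - m)^2 <= S m^2 + S (mu - m)^2, which forces m = mu. Then no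
   impulse escapes, and convergence of the energies gives convergence of the L^2 norms. *)
Require Import Defs.
From HB Require Import structures.
From mathcomp Require Import all_boot all_order all_algebra.
From mathcomp Require Import all_classical all_reals all_analysis.
From mathcomp Require Import measurable_realfun ring lra.
Set Implicit Arguments. Unset Strict Implicit. Unset Printing Implicit Defensive.
Import Order.TTheory GRing.Theory Num.Theory.
Import numFieldNormedType.Exports.
Local Open Scope classical_set_scope.
Local Open Scope ring_scope.

(** * Weak compactness in semi-inner product spaces *)

(** All kernel estimates come from one formula. With s = e^u, K_0(|z|)/(2 pi) is an integral over u
    of Gaussians in z; since |x' - y|^2 = |x - y|^2 + 4 x_2 y_2 for the reflection x' of x, the
    integrand of G_Pi is the Gaussian in x - y times 1 - exp(-x_2 y_2 / s). Positivity, the bound by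
    x_2 b(x - y) and the splitting at a time s = e^a become pointwise inequalities in u. Only
    translations along e_1 are available, so escape in the vertical direction has to be excluded
    separately: the tail of the kernel must be small relative to x_2 y_2 also when one of the two
    points is high. The mass bound is removed before the compactness argument because it is not
    homogeneous: only without it is the maximal energy exactly quadratic in the impulse, and then
    m^2 + (mu - m)^2 < mu^2 for 0 < m < mu. The functional analysis is done for an abstract
    symmetric kernel [H], weight [h] and sigma-finite measure. Functions are not identified almost
    everywhere, so L^2 is a subspace of all functions with a semi-inner product, and forms of
    nonnegative functions take extended real values until they are shown finite. *)

Lemma lexx_eq d (T : porderType d) (x y : T) : x = y -> (x <= y)%O.
Proof. by move=> ->. Qed.

(** Evaluate at the minimizer [t = - b / n]. For [n = 0] the polynomial is affine, and a slope
    [b != 0] would make it take the value -1. *)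
Lemma quadratic_ge0_discr (R : realFieldType) (d b n : R) : 0 <= n ->
  (forall t, 0 <= d + 2 * t * b + t ^+ 2 * n) -> b ^+ 2 <= n * d.
Proof.
rewrite le_eqVlt => /predU1P[<- h|n0 h].
  have [->|b0] := eqVneq b 0; first by rewrite mul0r expr0n.
  have := h (- (d + 1) / (2 * b)).
  suff -> : d + 2 * (- (d + 1) / (2 * b)) * b + (- (d + 1) / (2 * b)) ^+ 2 * 0 = -1.
    by rewrite lerNr oppr0 ler10.
  by field.
have := h (- b / n).
have -> : d + 2 * (- b / n) * b + (- b / n) ^+ 2 * n = (n * d - b ^+ 2) / n.
  by field; rewrite gt_eqF.
by rewrite pmulr_lge0 ?invr_gt0// subr_ge0.
Qed.

Lemma small_invS (R : realType) (e : R) : 0 < e -> \forall k \near \oo, k.+1%:R^-1 < e.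
Proof. by move=> e0; exact: (near_infty_natSinv_lt (PosNum e0)). Qed.

(** Along an ultrafilter finer than [\oo] all columns converge at once, by compactness of
    [[- C m, C m]]. Each set of the ultrafilter is nonempty, so [nk k] can be chosen beyond the
    previous index with the columns up to [k] within [1 / k.+1] of their limits. *)
Lemma diagonal_extraction (R : realType) (a : nat -> nat -> R) (C : nat -> R) :
  (forall n m, `|a n m| <= C m) ->
  exists (nk : nat -> nat) (p : nat -> R), (forall k, (nk k < nk k.+1)%N) /\
    forall m, (fun k => a (nk k) m) @ \oo --> p m.
Proof.
move=> aC.
have [U [UU sU]] := ultraFilterLemma (eventually_filter : ProperFilter (\oo : set_system nat)).
have hp m : exists p : R, a ^~ m @ U --> p.
  have := @segment_compact R (- C m) (C m).
  rewrite compact_ultra => /(_ (a ^~ m @ U)) [||p [_ Up]]; last by exists p.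
    split; first exact: fmap_proper_filter.
    move=> G GF sG; rewrite predeqE => A; split; last exact: sG.
    move=> GA; have [//|h] := in_ultra_setVsetC (a ^~ m @^-1` A) UU.
    have : G (A `&` ~` A) by apply: filterI => //; exact: sG.
    by rewrite setICr => /filter_not_empty.
  by apply: (@filterE _ U) => n /=; rewrite in_itv /= -ler_norml; exact: aC.
pose p m := sval (cid (hp m)).
have pP m : a ^~ m @ U --> p m by rewrite /p; case: cid.
have near_p m e : 0 < e -> U [set n | `|p m - a n m| < e].
  by move/cvgrPdist_lt : (pP m) => h e0; exact: h.
have ex (N k : nat) : exists n, (N < n)%N /\
    forall m, (m <= k)%N -> `|p m - a n m| < k.+1%:R^-1.
  have: U ([set n | (N < n)%N] `&`
           [set n | forall m : nat, (m <= k)%N -> `|p m - a n m| < k.+1%:R^-1]).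
    apply: filterI; first by apply: sU; exists N.+1.
    have: 0 < k.+1%:R^-1 :> R by [].
    move: {N} (k.+1%:R^-1 : R) => e e0; elim: k => [|k IH].
      by apply: filterS (near_p 0%N e e0) => n /= h m; rewrite leqn0 => /eqP ->.
    apply: filterS (filterI IH (near_p k.+1 e e0)) => n [/= h1 h2] m.
    by rewrite leq_eqVlt => /predU1P[->//|]; exact: h1.
  by move=> /filter_ex [n [h1 h2]]; exists n.
pose nx N k := sval (cid (ex N k)).
have nxP N k : (N < nx N k)%N /\
    forall m, (m <= k)%N -> `|p m - a (nx N k) m| < k.+1%:R^-1.
  by rewrite /nx; case: cid.
pose nk := fix nk k := if k is k'.+1 then nx (nk k') k else nx 0%N 0%N.
exists nk, p; split.
  by move=> k; exact: (nxP _ _).1.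
have nkP k m : (m <= k)%N -> `|p m - a (nk k) m| < k.+1%:R^-1.
  by case: k => [|k]; exact: (nxP _ _).2.
move=> m; apply/cvgrPdist_lt => e e0.
near=> k.
apply: lt_trans (nkP k m _) _.
  by near: k; exists m.
by near: k; exact: small_invS.
Unshelve. all: by end_near. Qed.

Section SemiInnerProduct.
Variables (R : realType) (V : lmodType R) (D : set V) (ip : V -> V -> R).
Hypothesis D0 : D 0.
Hypothesis Dlin : forall a u v, D u -> D v -> D (a *: u + v).
Hypothesis ipC : forall u v, ip u v = ip v u.
Hypothesis ipl : forall a u v w, D u -> D v -> D w ->
  ip (a *: u + v) w = a * ip u w + ip v w.
Hypothesis ip_ge0 : forall u, D u -> 0 <= ip u u.

Local Notation nrm2 u := (ip u u).

Hypothesis ip_complete : forall u : nat -> V, (forall n, D (u n)) ->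
  (forall e, 0 < e -> exists N, forall m n, (N <= m)%N -> (N <= n)%N ->
     nrm2 (u m - u n) <= e) ->
  exists v, D v /\ forall e, 0 < e -> exists N, forall n, (N <= n)%N ->
     nrm2 (v - u n) <= e.

Let DB u v : D u -> D v -> D (u - v).
Proof. by move=> Du Dv; rewrite addrC -scaleN1r; apply: Dlin. Qed.

Let ipr a u v w : D u -> D v -> D w -> ip w (a *: u + v) = a * ip w u + ip w v.
Proof. by move=> *; rewrite ipC ipl// !(ipC w). Qed.

Let ipB u v w : D u -> D v -> D w -> ip (u - v) w = ip u w - ip v w.
Proof. by move=> Du Dv Dw; rewrite addrC -scaleN1r ipl// mulN1r addrC. Qed.

Lemma ip_cauchy_schwarz u v : D u -> D v -> ip u v ^+ 2 <= nrm2 u * nrm2 v.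
Proof.
move=> Du Dv; rewrite [leRHS]mulrC; apply: quadratic_ge0_discr; first exact: ip_ge0.
move=> t; have := ip_ge0 (Dlin t Dv Du).
rewrite ipl ?ipr//; last exact: Dlin.
by rewrite (ipC v u); congr (_ <= _); ring.
Qed.

(** The functional [J s = nrm2 s - 2 * l s] is bounded below by [- C], and its minimizing sequences
    are Cauchy. The subspace [S] need not be closed: the representing vector lies in its closure,
    which is what the last clause records. *)
Lemma riesz_subspace (S : set V) (l : V -> R) (C : R) : 0 <= C ->
  S `<=` D -> S 0 -> (forall a u v, S u -> S v -> S (a *: u + v)) ->
  (forall a u v, S u -> S v -> l (a *: u + v) = a * l u + l v) ->
  (forall u, S u -> l u ^+ 2 <= C * nrm2 u) ->
  exists v, [/\ D v, forall s, S s -> ip v s = l s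
    & forall e, 0 < e -> exists s, S s /\ nrm2 (v - s) <= e].
Proof.
move=> C0 SD S0 Slin llin lC.
pose J s := nrm2 s - 2 * l s.
have Jlb s : S s -> - C <= J s.
  move=> Ss; have := lC s Ss; have := ip_ge0 (SD _ Ss); rewrite /J.
  set n := ip s s; set x := l s => n0 h.
  suff : 2 * x <= C + n by lra.
  have Cn : 0 <= C + n by lra.
  rewrite -(ger0_norm Cn); apply: le_trans (ler_norm _) _.
  by rewrite -ler_sqr ?nnegrE// !real_normK ?num_real//; have := sqr_ge0 (C - n); nra.
have hinf : has_inf (J @` S).
  by split; [exists (J 0), 0|exists (- C) => _ [s Ss <-]; exact: Jlb].
pose I := inf (J @` S).
have IJ s : S s -> I <= J s by move=> Ss; apply: inf_lbound; [exact: hinf.2|exists s].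
have hs k : exists s, S s /\ J s < I + k.+1%:R^-1.
  have k0 : 0 < k.+1%:R^-1 :> R by [].
  by have [_ [s Ss <-] h] := inf_adherent k0 hinf; exists s.
pose s k := sval (cid (hs k)).
have Ss k : S (s k) by rewrite /s; case: cid => ? [].
have sI k : J (s k) < I + k.+1%:R^-1 by rewrite /s; case: cid => ? [].
(* Parallelogram identity, with [I <= J] applied at the midpoint [2^-1 *: d + s k]. *)
have par j k : nrm2 (s j - s k) <= 2 * j.+1%:R^-1 + 2 * k.+1%:R^-1.
  set d := s j - s k.
  have Sd : S d by rewrite /d addrC -scaleN1r; apply: Slin.
  have sjE : s j = 1 *: d + s k by rewrite scale1r subrK.
  have := IJ _ (Slin 2^-1 _ _ Sd (Ss k)); have := sI j; have := sI k.
  have Dd := SD _ Sd; have Dk := SD _ (Ss k).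
  rewrite [J (s j)]/J sjE /J !llin// !ipl ?ipr//; try exact: Dlin.
  rewrite (ipC (s k) d).
  set N := ip d d; set b := ip d (s k); set n := ip (s k) (s k).
  set x := l d; set y := l (s k); rewrite -/d.
  set e1 := j.+1%:R^-1; set e2 := k.+1%:R^-1; lra.
have [v [Dv vs]] : exists v, D v /\ forall e, 0 < e -> exists N, forall n, (N <= n)%N ->
     nrm2 (v - s n) <= e.
  apply: ip_complete => [n|e e0]; first exact: SD.
  have e4 : 0 < e / 4 by lra.
  have [N _ hN] := small_invS e4.
  exists N => m n /hN /= hm /hN /= hn; apply: le_trans (par m n) _.
  move: (m.+1%:R^-1 : R) (n.+1%:R^-1 : R) hm hn => x y; lra.
exists v; split => //; last first.
  by move=> e /vs [N hN]; exists (s N); split => //; exact: hN.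
move=> t St; have Dt := SD _ St; apply/eqP; rewrite -subr_eq0 -sqrf_eq0.
rewrite eq_le sqr_ge0 andbT; apply/ler_addgt0Pr => e e0; rewrite add0r.
set n := nrm2 t; have n0 : 0 <= n by exact: ip_ge0.
pose e' := e / (4 * (n + 1)).
have e'0 : 0 < e' by rewrite divr_gt0//; lra.
have [N1 _ hN1] := small_invS e'0.
have [N2 hN2] := vs _ e'0.
pose k := maxn N1 N2; have h1 := hN1 k (leq_maxl _ _); have h2 := hN2 k (leq_maxr _ _).
have Dk := SD _ (Ss k).
(* Approximate Euler equation: the quadratic polynomial [J (x *: t + s k) - I] in [x] is
   nonnegative, so its discriminant bounds the linear coefficient. *)
have q1 : (ip (s k) t - l t) ^+ 2 <= n * (J (s k) - I).
  apply: quadratic_ge0_discr => // x.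
  have := IJ _ (Slin x _ _ St (Ss k)).
  rewrite /J llin// ipl ?ipr//; last exact: Dlin.
  by rewrite (ipC t (s k)) -/n; set A := ip _ _; set B := ip _ _; set E := l _; lra.
have q2 := ip_cauchy_schwarz (DB Dv Dk) Dt.
rewrite ipB// -/n in q2.
have := sI k; move: q1 q2 h2 h1 => /=.
set a := ip v t; set b := ip (s k) t; set c := l t.
set x := J _; set y := ip _ _; set z := _^-1 => q1 q2 h2 h1 h3.
have en : e' * (4 * (n + 1)) = e by rewrite divfK// gt_eqF//; lra.
have : (a - c) ^+ 2 <= 2 * (a - b) ^+ 2 + 2 * (b - c) ^+ 2.
  by have := sqr_ge0 (a - b - (b - c)); nra.
have : n * (x - I) <= n * e' by apply: ler_wpM2l => //; lra.
have : y * n <= e' * n by apply: ler_wpM2r.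
nra.
Qed.

(** The members of the sequence serve as test vectors for the diagonal extraction. The limit
    functional [l] lives on the subspace [cv] of vectors against which the extracted sequence
    converges, and Riesz gives [v]. A general [phi] is replaced by its projection [q] onto the
    closure of [cv]: all [u m] lie in [cv] and [v] in its closure, so neither sees the
    difference. *)
Lemma weak_sequential_compactness (u : nat -> V) (C : R) :
  (forall n, D (u n)) -> (forall n, nrm2 (u n) <= C) ->
  exists (nk : nat -> nat) (v : V),
    [/\ forall k, (nk k < nk k.+1)%N, D v &
        forall phi, D phi -> (fun k => ip (u (nk k)) phi) @ \oo --> ip v phi].
Proof.
move=> Du uC.
have C0 : 0 <= C by apply: le_trans (uC 0%N); exact: ip_ge0.
have bnd n w : D w -> ip (u n) w ^+ 2 <= C * nrm2 w.
  move=> Dw; apply: le_trans (ip_cauchy_schwarz (Du n) Dw) _.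
  by apply: ler_wpM2r (uC n); exact: ip_ge0.
have [|nk [p [nkP hp]]] := @diagonal_extraction R (fun n m => ip (u n) (u m)) (fun=> C).
  move=> n m; rewrite -ler_sqr ?nnegrE// real_normK ?num_real//.
  apply: le_trans (bnd _ _ (Du m)) _; rewrite expr2; exact: ler_wpM2l.
pose l w := limn (fun k => ip (u (nk k)) w).
pose cv w := D w /\ cvgn (fun k => ip (u (nk k)) w).
have lP w : cv w -> (fun k => ip (u (nk k)) w) @ \oo --> l w by case.
have ip0 w : D w -> ip w 0 = 0.
  by move=> Dw; have := ipr 1 D0 D0 Dw; rewrite scale1r addr0 mul1r; lra.
have linE a w1 w2 : D w1 -> D w2 -> (fun k => ip (u (nk k)) (a *: w1 + w2)) =
    (fun k => a * ip (u (nk k)) w1 + ip (u (nk k)) w2).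
  by move=> ? ?; apply/funext => k; rewrite ipr.
have cvl a w1 w2 : cv w1 -> cv w2 ->
    (fun k => ip (u (nk k)) (a *: w1 + w2)) @ \oo --> a * l w1 + l w2.
  move=> c1 c2; rewrite linE; [|exact: c1.1|exact: c2.1].
  by apply: cvgD; [apply: cvgM; [exact: cvg_cst|exact: lP]|exact: lP].
have cvlin a w1 w2 : cv w1 -> cv w2 -> cv (a *: w1 + w2).
  move=> c1 c2; split; first by apply: Dlin; [exact: c1.1|exact: c2.1].
  by apply/cvg_ex; exists (a * l w1 + l w2); exact: cvl.
have cv0 : cv 0.
  split => //; rewrite (_ : (fun k => _) = fun=> 0); first exact: is_cvg_cst.
  by apply/funext => k; rewrite ip0.
have llin a w1 w2 : cv w1 -> cv w2 -> l (a *: w1 + w2) = a * l w1 + l w2.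
  by move=> c1 c2; apply/cvg_lim => //; exact: cvl.
have [v [Dv vl vap]] : exists v, [/\ D v, forall s, cv s -> ip v s = l s
    & forall e, 0 < e -> exists s, cv s /\ nrm2 (v - s) <= e].
  apply: (riesz_subspace C0) => // [w []//|w c].
  have : (fun k => ip (u (nk k)) w ^+ 2) @ \oo --> l w ^+ 2.
    by rewrite expr2; apply: cvgM; exact: lP.
  move=> /cvgr_to_le; apply; apply: nearW => k; apply: bnd; exact: c.1.
exists nk, v; split => // phi Dphi.
have [q [Dq qphi qap]] : exists q, [/\ D q, forall s, cv s -> ip q s = ip phi s
    & forall e, 0 < e -> exists s, cv s /\ nrm2 (q - s) <= e].
  apply: (@riesz_subspace cv (fun s => ip phi s) (nrm2 phi)) => //.
  - exact: ip_ge0.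
  - by move=> w [].
  - by move=> a w1 w2 [? _] [? _]; rewrite ipr.
  - by move=> w [? _]; exact: ip_cauchy_schwarz.
have cvu m : cv (u m) by split => //; apply/cvg_ex; exists (p m); exact: hp.
have uphi k : ip (u (nk k)) phi = ip (u (nk k)) q.
  by rewrite ipC -qphi// ipC.
(* The vector [phi - q] is orthogonal to [cv], and [v] is a limit of elements of [cv]. *)
have vphi : ip v phi = ip v q.
  apply/eqP; rewrite -subr_eq0 -sqrf_eq0 eq_le sqr_ge0 andbT.
  apply/ler_addgt0Pr => e e0; rewrite add0r.
  have DQ := DB Dphi Dq; set n := nrm2 (phi - q).
  have n0 : 0 <= n by exact: ip_ge0.
  have [|s [cs hs]] := vap (e / (n + 1)); first by rewrite divr_gt0//; lra.
  have := ip_cauchy_schwarz (DB Dv cs.1) DQ; rewrite -/n.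
  rewrite ipB//; last exact: cs.1.
  have -> : ip s (phi - q) = 0 by rewrite ipC ipB ?qphi ?subrr//; exact: cs.1.
  rewrite subr0 (ipC v) ipB// !(ipC _ v) => h; apply: le_trans h _.
  apply: le_trans (ler_wpM2r n0 hs) _.
  by rewrite -mulrA ler_piMr ?(ltW e0)// mulrC ler_pdivrMr ?mul1r; lra.
rewrite vphi (_ : (fun k => _) = fun k => ip (u (nk k)) q); last exact/funext.
have h2 x (n e : R) : 0 <= n -> 0 < e -> x ^+ 2 <= (e / 4) ^+ 2 -> `|x| < e / 2.
  move=> n0 e0 h; apply: (@le_lt_trans _ _ (e / 4)); last lra.
  by rewrite -ler_sqr ?nnegrE ?normr_ge0 ?real_normK ?num_real//; lra.
apply/cvgrPdist_lt => e e0.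
set M := C + nrm2 v + 1.
have nv0 : 0 <= nrm2 v by exact: ip_ge0.
have M0 : 0 < M by rewrite /M; lra.
have e40 : 0 < (e / 8) ^+ 2 by rewrite exprn_gt0//; lra.
have [|s [cs hs]] := qap ((e / 8) ^+ 2 / M); first by rewrite divr_gt0.
have bd w : D w -> nrm2 w <= M -> `|ip w (q - s)| <= e / 8.
  move=> Dw hw; rewrite -ler_sqr ?nnegrE ?normr_ge0 ?real_normK ?num_real//; last lra.
  apply: le_trans (ip_cauchy_schwarz Dw (DB Dq cs.1)) _.
  have := ip_ge0 (DB Dq cs.1); have := ip_ge0 Dw => a0 b0.
  apply: le_trans (ler_wpM2r b0 hw) _; apply: le_trans (ler_wpM2l (ltW M0) hs) _.
  by rewrite mulrC divfK// gt_eqF.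
have ls := vl _ cs; move/cvgrPdist_lt : (lP _ cs) => /(_ (e / 2)).
rewrite -ls => /(_ _)[]; first lra.
move=> N _ hN; exists N => // k /hN /= hk.
have e1 : ip v q = ip v (q - s) + ip v s by rewrite !(ipC v) ipB//; [ring|exact: cs.1].
have e2 : ip (u (nk k)) q = ip (u (nk k)) (q - s) + ip (u (nk k)) s.
  by rewrite !(ipC (u _)) ipB//; [ring|exact: cs.1].
rewrite e1 e2.
have b1 : `|ip v (q - s)| <= e / 8 by apply: bd => //; rewrite /M; lra.
have b2 : `|ip (u (nk k)) (q - s)| <= e / 8.
  by apply: bd => //; have := uC (nk k); rewrite /M; lra.
move: b1 b2 hk; set x := ip v (q - s); set y := ip v s.
set z := ip _ (q - s); set w := ip _ s.
rewrite !ler_norml !ltr_norml => /andP[? ?] /andP[? ?] /andP[? ?]; apply/andP; split; lra.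
Qed.

End SemiInnerProduct.

(** * Square integrable functions *)

Section NonnegativeIntegral.
Context d (T : measurableType d) (R : realType) (m : {measure set T -> \bar R}).
Implicit Types f g : T -> R.

Definition nint f : \bar R := (\int[m]_x (f x)%:E)%E.

Lemma nint_ge0 f : (forall x, 0 <= f x) -> (0 <= nint f)%E.
Proof. by move=> f0; apply: integral_ge0 => x _; rewrite lee_fin. Qed.

Lemma le_nint f g : measurable_fun setT f -> measurable_fun setT g ->
  (forall x, 0 <= f x) -> (forall x, f x <= g x) -> (nint f <= nint g)%E.
Proof.
move=> mf mg f0 fg; apply: ge0_le_integral => //.
- by move=> x _; rewrite lee_fin.
- exact/measurable_EFinP.
- exact/measurable_EFinP.
- by move=> x _; rewrite lee_fin.
Qed.

Lemma nintD f g : measurable_fun setT f -> measurable_fun setT g ->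
  (forall x, 0 <= f x) -> (forall x, 0 <= g x) ->
  nint (fun x => f x + g x) = (nint f + nint g)%E.
Proof.
move=> mf mg f0 g0; rewrite /nint; under eq_integral do rewrite EFinD.
rewrite ge0_integralD//; by [move=> x _; rewrite lee_fin|exact/measurable_EFinP].
Qed.

Lemma nintZ c f : measurable_fun setT f -> (forall x, 0 <= f x) -> 0 <= c ->
  nint (fun x => c * f x) = (c%:E * nint f)%E.
Proof.
move=> mf f0 c0; rewrite /nint; under eq_integral do rewrite EFinM.
rewrite ge0_integralZl_EFin//; by [move=> x _; rewrite lee_fin|exact/measurable_EFinP].
Qed.

Lemma eq_nint f g : f =1 g -> nint f = nint g.
Proof. by move=> fg; apply: eq_integral => x _; rewrite fg. Qed.

End NonnegativeIntegral.

Section L2.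
Context d (T : measurableType d) (R : realType) (m : {measure set T -> \bar R}).
Implicit Types f g : T -> R.
Local Notation intg := (nint m).

Definition L2fun : set (T -> R) :=
  [set f : T -> R | measurable_fun setT f /\ (intg (fun x => f x ^+ 2)%R < +oo)%E].

Lemma L2_le f g : measurable_fun setT f -> L2fun g -> (forall x, f x ^+ 2 <= g x ^+ 2) ->
  L2fun f.
Proof.
move=> mf [mg fin] fg; split => //; apply: le_lt_trans fin; apply: le_nint => //.
- exact: measurable_funX.
- exact: measurable_funX.
- by move=> x; exact: sqr_ge0.
Qed.

Definition L2ip f g : R := fine (intg (fun x => f x * g x)).

Lemma L2_integrableM f g : L2fun f -> L2fun g ->
  m.-integrable setT (EFin \o (fun x => f x * g x)).
Proof.
move=> [mf f2] [mg g2].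
have mfg : measurable_fun setT (EFin \o (fun x => f x * g x)).
  exact/measurable_EFinP/measurable_funM.
apply/integrableP; split => //.
have := lte_add_pinfty f2 g2; rewrite -nintD; last 4 first.
- exact: measurable_funX.
- exact: measurable_funX.
- by move=> x; exact: sqr_ge0.
- by move=> x; exact: sqr_ge0.
apply: le_lt_trans; rewrite -[leLHS]/(intg (fun x => `|f x * g x|)).
apply: le_nint => //.
- by apply: measurableT_comp => //; exact: measurable_funM.
- by apply: measurable_funD; exact: measurable_funX.
move=> x; rewrite ler_norml.
by have := sqr_ge0 (f x + g x); have := sqr_ge0 (f x - g x); nra.
Qed.

Lemma L2fun0 : L2fun (0 : T -> R).
Proof.
split; first exact: measurable_cst.
rewrite /nint; under eq_integral do rewrite expr0n.
by rewrite integral0.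
Qed.

Lemma L2_lin a f g : L2fun f -> L2fun g -> L2fun (a *: f + g).
Proof.
move=> L2f L2g; have := L2_integrableM L2f L2f; have := L2_integrableM L2g L2g.
move=> ig if_; have ifg := L2_integrableM L2f L2g.
have mh : measurable_fun setT (a *: f + g).
  by apply: measurable_funD; [apply: measurable_funM => //; exact: L2f.1|exact: L2g.1].
split => //.
pose h := fun x : T => ((2 * a ^+ 2)%:E * (f x * f x)%:E + 2%:E * (g x * g x)%:E)%E.
have ih : m.-integrable setT h by apply: integrableD => //; exact: integrableZl.
apply: le_lt_trans (integrable_lty measurableT ih).
rewrite -[leRHS]/(intg (fun x => (2 * a ^+ 2) * (f x * f x) + 2 * (g x * g x))).
apply: le_nint => [|||x].
- exact: measurable_funX.
- have mf := L2f.1; have mg := L2g.1.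
  by apply: measurable_funD; apply: measurable_funM => //; exact: measurable_funM.
- by move=> x; exact: sqr_ge0.
rewrite [(a *: f + g) x](_ : _ = a * f x + g x)//.
by have := sqr_ge0 (a * f x - g x); nra.
Qed.

Lemma L2B f g : L2fun f -> L2fun g -> L2fun (f - g).
Proof. by move=> Lf Lg; rewrite addrC -scaleN1r; apply: L2_lin. Qed.

Lemma L2ipE f g : L2fun f -> L2fun g -> (L2ip f g)%:E = intg (fun x => f x * g x).
Proof.
move=> L2f L2g; rewrite fineK//; apply: integrable_fin_num => //.
exact: L2_integrableM.
Qed.

Lemma L2ipC f g : L2ip f g = L2ip g f.
Proof. by rewrite /L2ip; congr fine; apply: eq_nint => x; rewrite mulrC. Qed.

Lemma L2ip_lin a f g h : L2fun f -> L2fun g -> L2fun h ->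
  L2ip (a *: f + g) h = a * L2ip f h + L2ip g h.
Proof.
move=> Lf Lg Lh; apply: EFin_inj; rewrite EFinD EFinM !L2ipE//; last exact: L2_lin.
have i1 := L2_integrableM Lf Lh; have i2 := L2_integrableM Lg Lh.
rewrite /nint -integralZl//=.
rewrite -integralD//=; last exact: integrableZl.
apply: eq_integral => x _; rewrite -EFinM -EFinD; congr EFin.
by rewrite [(a *: f + g) x](_ : _ = a * f x + g x)//; ring.
Qed.

Lemma L2ip_ge0 f : 0 <= L2ip f f.
Proof. by apply/fine_ge0/nint_ge0 => x; rewrite -expr2 sqr_ge0. Qed.

Lemma sum_half_pow n : \sum_(0 <= k < n) (2^-1 : R) ^+ k = 2 - 2 * 2^-1 ^+ n.
Proof.
elim: n => [|n IH]; first by rewrite big_geq// expr0; ring.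
by rewrite big_nat_recr//= IH exprS; field.
Qed.

(** The series of [2 ^+ n * (u n.+1 - u n) ^+ 2] has integral at most [2], hence is finite almost
    everywhere. There the increments are summable, because [|z| <= c^-1 + c * |z| ^+ 2] with
    [c = 2 ^+ n]. *)
Lemma ae_cvg_of_fast_cauchy (u : nat -> T -> R) :
  (forall n, L2fun (u n)) ->
  (forall n, L2ip (u n.+1 - u n) (u n.+1 - u n) <= 4^-1 ^+ n) ->
  exists A : set T, [/\ measurable A, m (~` A) = 0 &
    forall x, A x -> cvgn (fun n => u n x)].
Proof.
move=> Lu hu.
have LB n : L2fun (u n.+1 - u n) by exact: L2B.
pose g n x := ((2 ^+ n) * (u n.+1 x - u n x) ^+ 2)%:E.
have g0 n x : (0 <= g n x)%E by rewrite lee_fin mulr_ge0// ?sqr_ge0// exprn_ge0.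
have mg n : measurable_fun setT (g n).
  apply/measurable_EFinP/measurable_funM => //; apply: measurable_funX.
  by apply: measurable_funB; exact: (Lu _).1.
pose G x := (\sum_(n <oo) g n x)%E.
have mG : measurable_fun setT G.
  apply: (@ge0_emeasurable_sum _ _ _ setT g xpredT) => //.
have G0 x : (0 <= G x)%E by exact: nneseries_ge0.
have intg n : (\int[m]_x g n x <= (2^-1 ^+ n)%:E)%E.
  rewrite (_ : \int[m]_x _ = (2 ^+ n)%:E * (L2ip (u n.+1 - u n) (u n.+1 - u n))%:E)%E.
    rewrite -EFinM lee_fin; apply: le_trans (ler_wpM2l _ (hu n)) _.
      by rewrite exprn_ge0.
    by rewrite -exprMn (_ : 2 * 4^-1 = 2^-1 :> R)//; field.
  rewrite L2ipE// -nintZ//; first exact: measurable_funM (LB n).1 (LB n).1.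
  - by move=> x; rewrite -expr2 sqr_ge0.
have IG : (\int[m]_x G x <= 2%:E)%E.
  rewrite /G integral_nneseries//; apply: lime_le.
    by apply: is_cvg_nneseries => n _ _; exact: integral_ge0.
  apply: nearW => n; apply: (@le_trans _ _ (\sum_(0 <= k < n) (2^-1 ^+ k)%:E)%E).
    by apply: lee_sum => k _; exact: intg.
  by rewrite sumEFin lee_fin sum_half_pow gerBl mulr_ge0// exprn_ge0.
have iG : m.-integrable setT G.
  apply/integrableP; split => //.
  under eq_integral do rewrite gee0_abs//.
  by apply: le_lt_trans IG _; rewrite ltry.
exists (setT `&` [set x | G x \is a fin_num]); split.
- exact: emeasurable_fin_num.
- have [N [mN N0 hN]] := integrable_ae measurableT iG.
  have mA : measurable (setT `&` [set x | G x \is a fin_num]).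
    exact: emeasurable_fin_num.
  apply: (subset_measure0 (measurableC mA) mN _ N0).
  by move=> x /= nx; apply: hN => /= h; apply: nx; split => //; exact: h.
move=> x [_ /= Gfin].
have hs n : \sum_(0 <= k < n) 2 ^+ k * (u k.+1 x - u k x) ^+ 2 <= fine (G x).
  rewrite -lee_fin fineK// -sumEFin; apply: nneseries_lim_ge => k _ _; exact: g0.
have : cvgn (series (telescope (u ^~ x))).
  apply: normed_cvg => /=; apply: nondecreasing_is_cvgn.
    by apply: nondecreasing_series => k _ _; rewrite normr_ge0.
  exists (2 + fine (G x)) => _ [n _ <-]; rewrite /= /series /=.
  apply: (@le_trans _ _ (\sum_(0 <= k < n) (2^-1 ^+ k + 2 ^+ k * (u k.+1 x - u k x) ^+ 2))).
    apply: ler_sum => k _; rewrite /telescope.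
    set z := _ - _; rewrite exprVn.
    have : 0 < 2 ^+ k :> R by rewrite exprn_gt0.
    move: (2 ^+ k : R) => c c0; rewrite ler_norml -real_normK ?num_real//.
    have n0 := normr_ge0 z.
    have k1 : `|z| <= c^-1 + c * `|z| ^+ 2.
      rewrite -(ler_pM2l c0) mulrDr divff ?gt_eqF//.
      by have := sqr_ge0 (c * `|z| - 1); have := sqr_ge0 (c * `|z|); nra.
    by rewrite -ler_norml.
  rewrite big_split/= sum_half_pow lerD// ?gerBl ?mulr_ge0// exprn_ge0//.
rewrite telescopeK => h.
suff -> : (fun n => u n x) = (fun n => (u n x - u 0 x) + u 0 x).
  by apply: is_cvgD => //; exact: is_cvg_cst.
by apply/funext => n; rewrite subrK.
Qed.

(** Riesz-Fischer: a fast subsequence [u (s n)] converges almost everywhere, its limit is set to 0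
    on the exceptional set, and Fatou's lemma carries the Cauchy estimate over to the limit. The
    partial sums in [s] make it nondecreasing while [N n <= s n] and [n <= s n]. *)
Lemma L2_complete (u : nat -> T -> R) : (forall n, L2fun (u n)) ->
  (forall e, 0 < e -> exists N, forall i j, (N <= i)%N -> (N <= j)%N ->
     L2ip (u i - u j) (u i - u j) <= e) ->
  exists v, L2fun v /\ forall e, 0 < e -> exists N, forall n, (N <= n)%N ->
     L2ip (v - u n) (v - u n) <= e.
Proof.
move=> Lu cu.
have hN (n : nat) : exists N, forall i j, (N <= i)%N -> (N <= j)%N ->
    L2ip (u i - u j) (u i - u j) <= 4^-1 ^+ n.
  by apply: cu; rewrite exprn_gt0.
pose N n := sval (cid (hN n)).
have NP n i j : (N n <= i)%N -> (N n <= j)%N ->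
    L2ip (u i - u j) (u i - u j) <= 4^-1 ^+ n.
  by rewrite /N; case: cid => N' /=; apply.
pose s n := (\sum_(k < n.+1) N k + n)%N.
have sN n : (N n <= s n)%N by rewrite /s big_ord_recr/= -addnA addnCA leq_addr.
have sS n : (s n <= s n.+1)%N.
  by rewrite /s [in X in (_ <= X)%N]big_ord_recr/= leq_add// leq_addr.
have sn n : (n <= s n)%N by rewrite /s leq_addl.
have [|A [mA A0 Acv]] := @ae_cvg_of_fast_cauchy (fun n => u (s n)) (fun n => Lu (s n)).
  by move=> n; apply: NP => //; apply: leq_trans (sS n).
pose v : T -> R := fun x => limn (fun n => u (s n) x * \1_A x).
have vcv x : (fun n => u (s n) x * \1_A x) @ \oo --> v x.
  rewrite /v; have [xA|xA] := pselect (A x).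
    apply: is_cvgM; [exact: Acv|exact: is_cvg_cst].
  rewrite indicE memNset//; under eq_fun do rewrite mulr0.
  exact: is_cvg_cst.
have mv : measurable_fun setT v.
  apply: (measurable_fun_cvg (h := fun n x => u (s n) x * \1_A x)) => // n.
  by apply: measurable_funM => //; exact: (Lu _).1.
have LB i j : L2fun (u i - u j) by exact: L2B.
have key e : 0 < e -> exists M, forall n, (M <= n)%N ->
    (intg (fun x => (v x - u n x) ^+ 2)%R <= e%:E)%E.
  move=> e0; have [M hM] := cu e e0; exists M => n Mn.
  pose f k x := (((u (s k) x - u n x) ^+ 2)%:E)%E.
  have mf k : measurable_fun setT (f k).
    by apply/measurable_EFinP/measurable_funX/measurable_funB; exact: (Lu _).1.
  have f0 k x : setT x -> (0 <= f k x)%E by rewrite lee_fin sqr_ge0.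
  have F := fatou m measurableT mf f0.
  have E1 : (intg (fun x => ((v x - u n x) ^+ 2)%R) =
             \int[m]_x limn_einf (f^~ x))%E.
    rewrite /nint.
    apply: ae_eq_integral => //.
    - by apply/measurable_EFinP/measurable_funX/measurable_funB => //; exact: (Lu _).1.
    - rewrite (_ : (fun x => _) = (fun x => - limn_esup (fun k => - f k x)))%E.
        apply: measurableT_comp => //.
        by apply: measurable_fun_limn_esup => k; apply: measurableT_comp.
      apply/funext => x; rewrite -limn_einfN; congr limn_einf.
      by apply/funext => k /=; rewrite opprK.
    exists (~` A); split => //; first exact: measurableC.
    move=> x /= h xA; apply: h => _.
    suff /cvg_limn_einf_sup[-> _]: (f^~ x) @ \oo --> (((v x - u n x) ^+ 2)%R)%:E by [].
    apply: cvg_EFin; first exact: nearW.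
    rewrite /f /=; apply: cvgM; apply: cvgB; by [
      have := vcv x; rewrite indicE mem_set//; under eq_fun do rewrite mulr1 | exact: cvg_cst].
  rewrite E1; apply: le_trans F _.
  have hk k : (M <= k)%N -> (\int[m]_x f k x <= e%:E)%E.
    move=> Mk; have := hM (s k) n (leq_trans Mk (sn k)) Mn.
    by rewrite -lee_fin L2ipE//; apply: le_trans; apply: lexx_eq; apply: eq_nint.
  rewrite limn_einf_lim; apply: lime_le; first exact: is_cvg_einfs.
  near=> k; apply: (@le_trans _ _ (\int[m]_x f k x)%E).
    by apply: ereal_inf_lbound; exists k => /=.
  by apply: hk; near: k; exists M.
have LvB n : (intg (fun x => (v x - u n x) ^+ 2)%R < +oo)%E -> L2fun (v - u n).
  by move=> h; split => //; apply: measurable_funB => //; exact: (Lu _).1.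
exists v; split.
  have [M hM] := key 1 ltr01; have h := hM M (leqnn _).
  have Lb : L2fun (v - u M) by apply: LvB; apply: le_lt_trans h _; rewrite ltry.
  by rewrite -(subrK (u M) v) -[v - u M]scale1r; apply: L2_lin.
move=> e e0; have [M hM] := key e e0; exists M => n Mn.
have h := hM n Mn.
have Lb : L2fun (v - u n) by apply: LvB; apply: le_lt_trans h _; rewrite ltry.
by rewrite -lee_fin L2ipE//; apply: le_trans h; apply: lexx_eq; apply: eq_nint.
Unshelve. all: by end_near. Qed.

Lemma L2_cauchy_schwarz f g : L2fun f -> L2fun g ->
  L2ip f g ^+ 2 <= L2ip f f * L2ip g g.
Proof.
apply: (ip_cauchy_schwarz (D := L2fun)).
- exact: L2_lin.
- exact: L2ipC.
- exact: L2ip_lin.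
- by move=> *; exact: L2ip_ge0.
Qed.

Lemma L2_weak_compactness (u : nat -> T -> R) (C : R) :
  (forall n, L2fun (u n)) -> (forall n, L2ip (u n) (u n) <= C) ->
  exists (nk : nat -> nat) (v : T -> R),
    [/\ forall k, (nk k < nk k.+1)%N, L2fun v &
        forall phi, L2fun phi -> (fun k => L2ip (u (nk k)) phi) @ \oo --> L2ip v phi].
Proof.
apply: (weak_sequential_compactness (D := L2fun)).
- exact: L2fun0.
- exact: L2_lin.
- exact: L2ipC.
- exact: L2ip_lin.
- by move=> *; exact: L2ip_ge0.
- exact: L2_complete.
Qed.

End L2.

(** * Translations and reflections of Lebesgue measure *)

Ltac meas := repeat first
  [ assumption
  | exact: measurable_id
  | exact: measurable_cst
  | exact: measurable_fst
  | exact: measurable_snd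
  | exact: measurable_expR
  | match goal with
    | |- measurable_fun _ (fun x => expR _) =>
        apply: (measurableT_comp (@measurable_expR _))
    | |- measurable_fun _ (fun x => (_ + _)%R) => apply: measurable_funD
    | |- measurable_fun _ (fun x => (_ * _)%R) => apply: measurable_funM
    | |- measurable_fun _ (fun x => (- _)%R) => apply: measurable_funN
    | |- measurable_fun _ (fun x => (_ ^+ _)%R) => apply: measurable_funX
    | |- measurable_fun _ (fun x => `|_|%R) =>
        apply: (measurableT_comp (@normr_measurable _ setT))
    | |- measurable_fun _ (fun x => (_, _)) => apply: measurable_fun_pair
    | |- measurable_fun _ (fun x => fst _) => apply: (measurableT_comp measurable_fst)
    | |- measurable_fun _ (fun x => snd _) => apply: (measurableT_comp measurable_snd)
    end ].

Section Invariance.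
Variable R : realType.
Local Notation RT := (measurableTypeR R).
Local Notation mu := (@lebesgue_measure R).
Local Open Scope ereal_scope.

Lemma sigma_finite_leb2 : sigma_finite setT (@leb2 R).
Proof.
have /sigma_finiteP[F [TF ndF Foo]] := sigma_finiteT mu.
exists (fun n => F n `*` F n).
  rewrite -setXTT TF predeqE => -[x y]; split.
    move=> [/= [n _ Fnx] [k _ Gky]]; exists (maxn n k) => //; split.
    - by move: x Fnx; exact/subsetPset/ndF/leq_maxl.
    - by move: y Gky; exact/subsetPset/ndF/leq_maxr.
  by move=> [n _ []/= ? ?]; split; exists n.
move=> k; have [? ?] := Foo k.
split; first exact: measurableX.
by rewrite /leb2 product_measure1E// lte_mul_pinfty// ge0_fin_numE.
Qed.

(** The set function [leb2] packed with its sigma-finiteness, which Tonelli's theorem asks for;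
    integrals against the two agree by conversion. *)
Definition lebesgue2 : {sigma_finite_measure set (RT * RT)%type -> \bar R}.
Proof.
pose m : {measure set (RT * RT)%type -> \bar R} := @leb2 R.
refine (HB.pack_for {sigma_finite_measure set (RT * RT)%type -> \bar R} (m : set _ -> _) (Measure.class m)
  (Measure_isSigmaFinite.Build _ _ _ m sigma_finite_leb2)).
Defined.

Lemma lebesgue2E (D : set (R * R)) (f : R * R -> \bar R) :
  \int[@leb2 R]_(x in D) f x = \int[lebesgue2]_(x in D) f x.
Proof. by []. Qed.

Local Notation leb2 := lebesgue2.

Lemma measurable_translate (c : R) : measurable_fun setT ((fun x => x + c)%R : RT -> RT).
Proof. by meas. Qed.

(** The translation is packed as a measurable function so that its pushforward is a measure;
    uniqueness then reduces the claim to half-open intervals. *)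
Lemma lebesgue_measure_translate (c : R) (A : set R) : measurable A ->
  pushforward mu ((fun x => x + c)%R : RT -> RT) A = mu A.
Proof.
move=> mA.
pose phi : {mfun RT >-> RT} := HB.pack ((fun x => x + c)%R : RT -> RT)
  (isMeasurableFun.Build _ _ _ _ _ (measurable_translate c)).
apply/esym/(lebesgue_measure_unique (mu := pushforward mu phi)) => //= _ [[a b]] _ <-.
rewrite /pushforward (_ : _ @^-1` _ = `]a - c, b - c]%classic)%R.
  rewrite !lebesgue_measure_itv/= !lte_fin ltrD2r -!EFinB; case: ifP => // _.
  by congr EFin; ring.
by apply/seteqP; split => x /=; rewrite !in_itv/= => /andP[? ?]; apply/andP; split; lra.
Qed.

Lemma integral_translate (c : R) (f : R -> \bar R) : measurable_fun setT f ->
  (forall x, 0 <= f x) -> \int[mu]_x f (x + c)%R = \int[mu]_x f x.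
Proof.
move=> mf f0; rewrite -[LHS](@ge0_integral_pushforward _ _ _ _ _ _
  (measurable_translate c) mu setT f)//.
apply: eq_measure_integral => [|mt A mA _]; first exact: measurable_translate.
exact: lebesgue_measure_translate.
Qed.

Lemma integral_oppr (f : R -> \bar R) : measurable_fun setT f ->
  (forall x, 0 <= f x) -> \int[mu]_x f (- x)%R = \int[mu]_x f x.
Proof.
move=> mf f0.
have mN : measurable_fun setT (-%R : RT -> RT) by [].
rewrite -[LHS](@ge0_integral_pushforward _ _ _ _ _ _ mN mu setT f)//.
by apply: eq_measure_integral => A mA _; exact: lebesgue_measureN.
Qed.

Lemma leb2_iterated (f : RT * RT -> \bar R) : measurable_fun setT f ->
  (forall x, 0 <= f x) -> \int[leb2]_x f x = \int[mu]_x \int[mu]_y f (x, y).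
Proof. by move=> mf f0; rewrite fubini_tonelli1. Qed.

Lemma leb2_translate (c : R * R) (f : RT * RT -> \bar R) : measurable_fun setT f ->
  (forall x, 0 <= f x) -> \int[leb2]_x f (x + c)%R = \int[leb2]_x f x.
Proof.
move=> mf f0.
have ms : measurable_fun setT (fun x : RT * RT => (x + c)%R : RT * RT).
  rewrite (_ : (fun x => _) = (fun x : RT * RT => (x.1 + c.1, x.2 + c.2)%R)); first by meas.
  by apply/funext => -[].
have mfs : measurable_fun setT (fun x : RT * RT => f (x + c)%R).
  exact: measurableT_comp.
rewrite (leb2_iterated mfs)// (leb2_iterated mf)//.
transitivity (\int[mu]_x \int[mu]_y f (x + c.1, y)%R).
  apply: eq_integral => x _.
  rewrite -(@integral_translate c.2 (fun y => f (x + c.1, y)%R))//.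
  by apply: (measurableT_comp mf); meas.
rewrite (@integral_translate c.1 (fun x => \int[mu]_y f (x, y)))//.
  exact: measurable_fun_fubini_tonelli_F.
by move=> x; exact: integral_ge0.
Qed.

Lemma leb2_oppr (f : RT * RT -> \bar R) : measurable_fun setT f ->
  (forall x, 0 <= f x) -> \int[leb2]_x f (- x)%R = \int[leb2]_x f x.
Proof.
move=> mf f0.
have ms : measurable_fun setT (fun x : RT * RT => (- x)%R : RT * RT).
  rewrite (_ : (fun x => _) = (fun x : RT * RT => (- x.1, - x.2)%R)); first by meas.
  by apply/funext => -[].
have mfs : measurable_fun setT (fun x : RT * RT => f (- x)%R).
  exact: measurableT_comp.
rewrite (leb2_iterated mfs)// (leb2_iterated mf)//.
transitivity (\int[mu]_x \int[mu]_y f (- x, y)%R).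
  apply: eq_integral => x _.
  rewrite -(@integral_oppr (fun y => f (- x, y)%R))//.
  by apply: (measurableT_comp mf); meas.
rewrite (@integral_oppr (fun x => \int[mu]_y f (x, y)))//.
  exact: measurable_fun_fubini_tonelli_F.
by move=> x; exact: integral_ge0.
Qed.

Lemma leb2_subl (c : R * R) (f : RT * RT -> \bar R) : measurable_fun setT f ->
  (forall x, 0 <= f x) -> \int[leb2]_x f (c - x)%R = \int[leb2]_x f x.
Proof.
move=> mf f0; rewrite -(@leb2_oppr f)// -(@leb2_translate (- c)%R (fun x => f (- x)%R))//.
  by apply: eq_integral => x _; rewrite opprD opprK addrC.
apply: (measurableT_comp mf).
rewrite (_ : -%R = (fun x : RT * RT => (- x.1, - x.2)%R)); first by meas.
by apply/funext => -[].
Qed.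

End Invariance.

(** * The kernel as an integral of Gaussians *)

Section HeatKernel.
Variable R : realType.
Local Notation RT := (measurableTypeR R).
Local Notation mu := (@lebesgue_measure R).

Lemma expR_half_sqr (u : R) : expR (u / 2) ^+ 2 = expR u.
Proof. by rewrite expr2 -expRD -splitr. Qed.

Lemma cvgry_expR : expR x @[x --> +oo] --> (+oo : set_system R).
Proof.
apply: (@ger_cvgy _ _ _ _ (fun x : R => x)); last by [].
by apply: nearW => x; have := expR_ge1Dx x; lra.
Qed.

Lemma integral_scale (c : R) (G : R -> R) : 0 < c -> continuous G ->
  (forall x, 0 <= G x) -> nint mu G = nint mu (fun x => G (c * x) * c).
Proof.
move=> c0 cG G0; rewrite /nint.
have dF (x : R) : is_derive x (1 : R) ( *%R c) c.
  have -> : *%R c = (c *: @id R) by apply/funext.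
  by apply: is_derive_eq; rewrite /GRing.scale /= mulr1.
have dE : ( *%R c)^`()%classic = cst c.
  by apply/funext => x; rewrite derive1E; apply: derive_val.
rewrite (@increasing_ge0_integration_by_substitutionT R ( *%R c) G)//.
- by apply: eq_integral => x _; rewrite dE.
- by move=> x y xy; rewrite ltr_pM2l.
- by rewrite dE => x; exact: cvg_cst.
- by rewrite dE; exact: is_cvg_cst.
- by rewrite dE; exact: is_cvg_cst.
- by apply: (gt0_cvgMrNy c0); exact: cvg_id.
- by apply: (gt0_cvgMry c0); exact: cvg_id.
Qed.

Lemma integral_gauss (k : R) : 0 < k ->
  nint mu (fun z => expR (- (z ^+ 2 * k ^+ 2))) = (Num.sqrt pi / k)%:E.
Proof.
move=> k0; have := integral_scale k0 (@continuous_gauss_fun R) (@gauss_fun_ge0 R).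
rewrite {1}/nint integralT_gauss => h.
have -> : nint mu (fun z => expR (- (z ^+ 2 * k ^+ 2))) =
    ((k^-1)%:E * nint mu (fun z => gauss_fun (k * z) * k)%R)%E.
  rewrite -nintZ//; last 3 first.
  - by rewrite /gauss_fun; meas.
  - by move=> x; apply: mulr_ge0; [exact: gauss_fun_ge0|exact: ltW].
  - by rewrite invr_ge0 ltW.
  by apply: eq_nint => z; rewrite (mulrC _ k) mulKf ?gt_eqF// /gauss_fun exprMn mulrC.
by rewrite -h -EFinM mulrC.
Qed.

Lemma integral_gauss_expR (u : R) :
  nint mu (fun z => expR (- (z ^+ 2 * expR (- u) / 4))) =
  (2 * Num.sqrt pi * expR (u / 2))%:E.
Proof.
have k0 : 0 < expR (- u / 2) / 2 by rewrite divr_gt0// expR_gt0.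
have := integral_gauss k0.
have -> : (fun z => expR (- (z ^+ 2 * (expR (- u / 2) / 2) ^+ 2))) =
   (fun z => expR (- (z ^+ 2 * expR (- u) / 4))).
  apply/funext => z; rewrite exprMn expR_half_sqr.
  by congr expR; field.
move=> ->; congr EFin; rewrite mulNr expRN; have := expR_gt0 (u / 2) => e0.
by field; rewrite gt_eqF.
Qed.

Lemma integral_expexp_tail (a : R) :
  (\int[mu]_(u in `[a, +oo[) (expR u * expR (- expR u))%:E)%E =
  (expR (- expR a))%:E.
Proof.
have dF (x : R) : is_derive x (1 : R) (fun x : R => - expR (- expR x)) (expR x * expR (- expR x)).
  have d1 := is_derive_expR x.
  have d2 : is_derive x 1 (fun x => - expR x) (- expR x) by exact: is_deriveN.
  have d3 : is_derive x (1 : R) (expR \o (fun x : R => - expR x)) (expR (- expR x) * - expR x).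
    by apply: is_derive1_comp.
  have d4 : is_derive x (1 : R) (fun x => - expR (- expR x)) (- (expR (- expR x) * - expR x)).
    exact: is_deriveN.
  by apply: is_derive_eq; rewrite mulrN opprK mulrC.
have cee : continuous (fun x : R => expR (- expR x)).
  move=> x; apply: continuous_comp; last exact: continuous_expR.
  by apply: cvgN; exact: continuous_expR.
rewrite (@ge0_continuous_FTC2y _ _ (fun x => - expR (- expR x)) a 0).
- by rewrite -EFinB sub0r opprK.
- by move=> x _; rewrite mulr_ge0 ?expR_ge0.
- by apply: continuous_subspaceT => x; apply: cvgM; [exact: continuous_expR|exact: cee].
- rewrite -oppr0; apply: cvgN.
  apply: (@cvg_comp _ _ _ (@expR R) (fun y => expR (- y))); first exact: cvgry_expR.
  exact: cvgr_expR.
- by move=> x _; apply: ex_derive.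
- apply: cvg_at_right_filter.
  by apply: cvgN; exact: cee.
- by move=> x _; rewrite derive1E; apply: derive_val.
Qed.

(** This is the integral of e^{-s} over s > 0 in the variable s = e^u. It normalizes [resolvent] to
    total integral 1. *)
Lemma integral_expexp : nint mu (fun u => expR u * expR (- expR u)) = 1%E.
Proof.
pose F (n : nat) : set R := `[- n%:R, +oo[%classic.
have FT : \bigcup_n F n = setT.
  apply/seteqP; split => // x _; have [n xn] : exists n : nat, - x <= n%:R.
    exists (Num.bound `|x|); apply: le_trans (ltW (archi_boundP (normr_ge0 x))).
    by rewrite -normrN ler_norm.
  by exists n => //; rewrite /F /= in_itv/= andbT; lra.
have : (\int[mu]_(x in F n) (expR x * expR (- expR x))%:E)%E @[n --> \oo] -->
    (\int[mu]_(x in \bigcup_n F n) (expR x * expR (- expR x))%:E)%E.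
  apply: ge0_nondecreasing_set_cvg_integral.
  - move=> n m nm; apply/subsetPset => x; rewrite /F /= !in_itv/= !andbT.
    by apply: le_trans; rewrite lerN2 ler_nat.
  - by move=> n; exact: measurable_itv.
  - move=> n; apply/measurable_EFinP; apply: measurable_funTS; meas.
  - by move=> n x _; rewrite lee_fin mulr_ge0// expR_ge0.
rewrite FT -/(nint mu _); under eq_cvg do rewrite integral_expexp_tail.
move=> h; apply/esym/(cvg_unique _ _ h) => //.
apply: cvg_EFin; first exact: nearW.
have h1 : (fun n : nat => expR (- n%:R) : R) @ \oo --> (0 : R).
  apply: (@cvg_comp _ _ _ (fun n : nat => n%:R) (fun y : R => expR (- y))).
    exact: cvgr_idn.
  exact: cvgr_expR.
have := cvg_comp _ _ (cvgN h1) (@continuous_expR R (- 0)).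
by rewrite oppr0 expR0; apply; exact: eventually_filter.
Qed.

(* Substituting u = 2v and using e^{2v} >= 2e^v - 1. *)
Lemma integral_expexp_half :
  (nint mu (fun u => expR (u / 2) * expR (- expR u))%R <= (2 * expR 1)%:E)%E.
Proof.
have cG : continuous (fun u : R => expR (u / 2) * expR (- expR u)).
  move=> x; apply: cvgM.
    apply: continuous_comp; last exact: continuous_expR.
    by apply: cvgM; [exact: cvg_id|exact: cvg_cst].
  apply: continuous_comp; last exact: continuous_expR.
  by apply: cvgN; exact: continuous_expR.
have G0 (x : R) : 0 <= expR (x / 2) * expR (- expR x) by rewrite mulr_ge0 ?expR_ge0.
rewrite (integral_scale (ltr0n _ 2) cG G0).
rewrite -[leRHS]mule1 -integral_expexp -nintZ; last 3 first.
- by meas.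
- by move=> x; rewrite mulr_ge0 ?expR_ge0.
- by rewrite mulr_ge0 ?expR_ge0.
apply: le_nint => [|||x].
- by meas.
- by meas.
- by move=> x; rewrite !mulr_ge0 ?expR_ge0.
rewrite (_ : 2 * x / 2 = x); last by field.
rewrite (_ : 2 * expR 1 * (expR x * expR (- expR x)) =
  expR x * (expR 1 * expR (- expR x)) * 2); last by ring.
rewrite -(expRD 1); apply: ler_wpM2r => //; apply: ler_wpM2l; first exact: expR_ge0.
rewrite ler_expR mulr_natl mulr2n expRD -expr2.
by have := expR_ge0 x; have := sqr_ge0 (expR x - 1); nra.
Qed.

Local Notation leb2 := (@lebesgue2 R).

(** The heat kernel at time s = e^u without its prefactor. The factor 1/s of the prefactor is
    absorbed by ds = s du, so only [(4 * pi)^-1] survives in the density below. *)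
Definition gauss2 (u : R) (z : R * R) : R :=
  expR (- ((z.1 ^+ 2 + z.2 ^+ 2) * expR (- u) / 4)).

(* With s = e^u, the integral over u is the integral of e^(-s) / (4 pi s) e^(-|z|^2 / (4 s)) ds,
   that is K0 (|z|) / (2 pi). *)
Definition resolvent_density (u : R) (z : R * R) : R :=
  (4 * pi)^-1 * (expR (- expR u) * gauss2 u z).
Local Notation q := resolvent_density.

Definition resolvent (z : R * R) : \bar R := nint mu (fun u => q u z).

Lemma gauss2_gt0 u z : 0 < gauss2 u z. Proof. exact: expR_gt0. Qed.

Lemma gauss2_le1 u z : gauss2 u z <= 1.
Proof.
rewrite -expR0 ler_expR oppr_le0 !mulr_ge0 ?expR_ge0//.
by rewrite addr_ge0 ?sqr_ge0.
Qed.

Lemma four_pi_gt0 : 0 < (4 * pi)^-1 :> R.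
Proof. by rewrite invr_gt0 mulr_gt0// pi_gt0. Qed.

Lemma four_pi_le1 : (4 * pi)^-1 <= 1 :> R.
Proof. by rewrite invf_le1 ?mulr_gt0 ?pi_gt0//; have := pi_ge2 R; lra. Qed.

Lemma density_gt0 u z : 0 < q u z.
Proof. by rewrite !mulr_gt0 ?expR_gt0 ?four_pi_gt0 ?gauss2_gt0. Qed.

Lemma density_le u z : q u z <= expR (- expR u).
Proof.
rewrite /resolvent_density mulrCA; apply: ler_piMr; first exact: expR_ge0.
apply: mulr_ile1; [exact/ltW/four_pi_gt0|exact/ltW/gauss2_gt0|exact: four_pi_le1|].
exact: gauss2_le1.
Qed.

Lemma measurable_density : measurable_fun setT (fun p : RT * (RT * RT) => q p.1 p.2).
Proof. by rewrite /resolvent_density /gauss2; meas. Qed.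

Lemma measurable_density1 z : measurable_fun setT (fun u : RT => q u z).
Proof. by rewrite /resolvent_density /gauss2; meas. Qed.

Lemma measurable_density2 u : measurable_fun setT (fun z : RT * RT => q u z).
Proof. by rewrite /resolvent_density /gauss2; meas. Qed.

Lemma densityN u z : q u (- z) = q u z.
Proof. by rewrite /resolvent_density /gauss2 /= !sqrrN. Qed.

Lemma integral_gauss2 u : nint leb2 (gauss2 u) = (4 * pi * expR u)%:E.
Proof.
rewrite /nint leb2_iterated//; last 2 first.
- by apply/measurable_EFinP; rewrite /gauss2; meas.
- by move=> x; rewrite lee_fin ltW// gauss2_gt0.
pose h (x : R) := expR (- (x ^+ 2 * expR (- u) / 4)).
have h0 x : 0 <= h x by exact: expR_ge0.
have mh : measurable_fun setT (h : RT -> RT) by rewrite /h; meas.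
have E x : (\int[mu]_y (gauss2 u (x, y))%:E = (2 * Num.sqrt pi * expR (u / 2) * h x)%:E)%E.
  have -> : (\int[mu]_y (gauss2 u (x, y))%:E = nint mu (fun y => h x * h y)%R)%E.
    apply: eq_nint => y; rewrite /gauss2 /h -expRD /=; congr expR; ring.
  by rewrite nintZ// /h integral_gauss_expR -EFinM mulrC.
under eq_integral do rewrite E.
rewrite -[LHS]/(nint mu (fun x => 2 * Num.sqrt pi * expR (u / 2) * h x)).
have c0 : 0 <= 2 * Num.sqrt pi * expR (u / 2).
  by apply: mulr_ge0; [apply: mulr_ge0; [by []|exact: sqrtr_ge0]|exact: expR_ge0].
rewrite (nintZ _ mh h0 c0).
rewrite /h integral_gauss_expR -EFinM; congr EFin.
have -> : 2 * Num.sqrt pi * expR (u / 2) * (2 * Num.sqrt pi * expR (u / 2)) =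
  4 * Num.sqrt pi ^+ 2 * expR (u / 2) ^+ 2 :> R by ring.
by rewrite sqr_sqrtr ?expR_half_sqr// pi_ge0.
Qed.

Lemma integral_density u : nint leb2 (q u) = (expR u * expR (- expR u))%:E.
Proof.
have mg : measurable_fun setT (fun z : RT * RT => gauss2 u z) by rewrite /gauss2; meas.
have -> : nint leb2 (q u) = nint leb2 (fun z => (4 * pi)^-1 * expR (- expR u) * gauss2 u z).
  by apply: eq_nint => z; rewrite /resolvent_density mulrA.
rewrite nintZ//; last 2 first.
- by move=> z; rewrite ltW// gauss2_gt0.
- by rewrite mulr_ge0 ?expR_ge0// ltW// four_pi_gt0.
rewrite integral_gauss2 -EFinM; congr EFin.
by move: (pi : R) (pi_gt0 R) => p p0; field; rewrite gt_eqF.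
Qed.

Lemma nint_swap (phi : R -> R * R -> R) :
  measurable_fun setT (fun p : RT * (RT * RT) => phi p.1 p.2) ->
  (forall u z, 0 <= phi u z) ->
  (\int[leb2]_z nint mu (phi^~ z) = \int[mu]_u nint leb2 (phi u))%E.
Proof.
move=> mphi phi0.
have := @fubini_tonelli _ _ RT (RT * RT)%type R mu leb2 (fun p => (phi p.1 p.2)%:E).
move=> h; apply/esym; apply: h; first exact/measurable_EFinP.
by move=> x; rewrite lee_fin.
Qed.

Lemma measurable_nint (phi : R -> R * R -> R) :
  measurable_fun setT (fun p : RT * (RT * RT) => phi p.1 p.2) ->
  (forall u z, 0 <= phi u z) ->
  measurable_fun setT (fun z : RT * RT => nint mu (phi^~ z)).
Proof.
move=> mphi phi0.
have := @measurable_fun_fubini_tonelli_G _ _ _ _ _ mu (fun p : RT * (RT * RT) => (phi p.1 p.2)%:E).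
apply; first exact/measurable_EFinP.
by move=> x; rewrite lee_fin.
Qed.

Lemma measurable_resolvent : measurable_fun setT (resolvent : RT * RT -> \bar R).
Proof.
by apply: measurable_nint => [|u z]; [exact: measurable_density|exact/ltW/density_gt0].
Qed.

Lemma resolvent_ge0 z : (0 <= resolvent z)%E.
Proof. by apply: nint_ge0 => u; exact/ltW/density_gt0. Qed.

Lemma integral_resolvent : (\int[leb2]_z resolvent z = 1)%E.
Proof.
rewrite nint_swap; [|exact: measurable_density|by move=> *; exact/ltW/density_gt0].
by under eq_integral do rewrite integral_density; exact: integral_expexp.
Qed.

Lemma expRN_le_inv (x : R) : 0 < x -> expR (- x) <= x^-1.
Proof.
move=> x0; rewrite expRN lef_pV2 ?posrE ?expR_gt0//.
by have := expR_ge1Dx x; lra.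
Qed.

Lemma enorm_sqr (z : R * R) : enorm z ^+ 2 = z.1 ^+ 2 + z.2 ^+ 2.
Proof. by rewrite sqr_sqrtr// addr_ge0 ?sqr_ge0. Qed.

Lemma enorm_gt0 (z : R * R) : z != 0 -> 0 < enorm z.
Proof.
move=> z0; rewrite sqrtr_gt0 lt_neqAle addr_ge0 ?sqr_ge0// andbT eq_sym.
apply: contra z0; rewrite paddr_eq0 ?sqr_ge0// !sqrf_eq0.
by case: z => a b /= /andP[/eqP-> /eqP->].
Qed.

(** Away from the origin [expR (- x) <= x^-1] bounds the Gaussian by [r^-1 * expR u], with
    [r = |z|^2 / 4]. This makes up for the missing decay as u tends to minus infinity. *)
Lemma resolvent_fin z : z != 0 -> (resolvent z < +oo)%E.
Proof.
move=> z0; set r := (z.1 ^+ 2 + z.2 ^+ 2) / 4.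
have r0 : 0 < r by rewrite divr_gt0// -enorm_sqr exprn_gt0// enorm_gt0.
apply: (@le_lt_trans _ _ (nint mu (fun u => r^-1 * (expR u * expR (- expR u))))).
  apply: le_nint => [|||u].
  - exact: measurable_density1.
  - by meas.
  - by move=> u; exact/ltW/density_gt0.
  rewrite /resolvent_density mulrA mulrAC mulrA; apply: ler_wpM2r; first exact: expR_ge0.
  apply: (@le_trans _ _ (gauss2 u z)).
    by rewrite ler_piMl ?four_pi_le1// ltW// gauss2_gt0.
  have -> : gauss2 u z = expR (- (r * expR (- u))).
    by rewrite /gauss2 /r; congr expR; ring.
  apply: le_trans (expRN_le_inv _) _; first by rewrite mulr_gt0// expR_gt0.
  by rewrite invfM expRN invrK.
rewrite nintZ.
- by rewrite integral_expexp mule1 ltry.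
- by meas.
- by move=> u; rewrite mulr_ge0 ?expR_ge0.
- by rewrite invr_ge0 ltW.
Qed.

Lemma cosh_translate (r u : R) : 0 < r ->
  r * cosh (u + - ln (r / 2)) = expR u + r ^+ 2 / 4 * expR (- u).
Proof.
move=> r0; rewrite /cosh opprD opprK !expRD expRN lnK ?posrE ?divr_gt0//.
by field; rewrite gt_eqF.
Qed.

(* The shift t = u - log(r/2) turns r cosh t into e^u + (r^2/4) e^{-u}. *)
Lemma K0_integral (r : R) : 0 < r ->
  (\int[mu]_(t in [set t : R | (0 <= t)%R]) (expR (- (r * cosh t))%R)%:E =
   nint mu (fun u => 2^-1 * expR (- (expR u + r ^+ 2 / 4 * expR (- u))))%R)%E.
Proof.
move=> r0; have cc : continuous (fun t : R => expR (- (r * cosh t))).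
  move=> t; apply: continuous_comp; last exact: continuous_expR.
  apply: cvgN; apply: cvgM; first exact: cvg_cst.
  apply: cvgM; last exact: cvg_cst.
  apply: cvgD; first exact: continuous_expR.
  by apply: continuous_comp; [apply: cvgN; exact: cvg_id|exact: continuous_expR].
have mf : measurable_fun setT (fun t : RT => expR (- (r * cosh t))).
  exact: continuous_measurable_fun.
have := ge0_symfun_integralT (fun t => expR_ge0 (- (r * cosh t))) cc.
rewrite -(@integral_translate R (- ln (r / 2)) (fun t => (expR (- (r * cosh t)))%:E));
  [|exact/measurable_EFinP|by move=> t; rewrite lee_fin expR_ge0].
under eq_integral do rewrite cosh_translate//.
move=> h; rewrite nintZ; last 3 first.
- by meas.
- by move=> x; exact: expR_ge0.
- by [].
rewrite -/(nint mu _) in h; rewrite h; last first.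
  by move=> x; rewrite /cosh /= opprK addrC.
by rewrite muleA -EFinM mulVf// mul1e.
Qed.

(** Since [K0] is the [fine] of an integral, the identity holds only once that integral is known to
    be finite, which comes from [resolvent_fin]. *)
Lemma resolventE z : z != 0 -> ((2 * pi)^-1 * K0 (enorm z))%:E = resolvent z.
Proof.
move=> z0; have e0 := enorm_gt0 z0; have := resolvent_fin z0.
have -> : resolvent z = (((2 * pi)^-1)%:E *
    nint mu (fun u => 2^-1 * expR (- (expR u + enorm z ^+ 2 / 4 * expR (- u))))%R)%E.
  rewrite -nintZ; last 3 first.
  - by meas.
  - by move=> u; rewrite mulr_ge0 ?expR_ge0.
  - by rewrite invr_ge0 mulr_ge0 ?pi_ge0.
  apply: eq_nint => u; rewrite enorm_sqr /resolvent_density /gauss2 -expRD mulrA -invfM.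
  by congr (_^-1 * expR _); ring.
rewrite -K0_integral// /K0; set X := (\int[mu]_(_ in _) _)%E => h.
have X0 : (0 <= X)%E by apply: integral_ge0 => t _; rewrite lee_fin expR_ge0.
rewrite EFinM fineK// ge0_fin_numE//; move: h; case: X X0 => [x _ _|_|//]; first by rewrite ltry.
by rewrite gt0_muley ?lte_fin ?invr_gt0 ?mulr_gt0 ?pi_gt0.
Qed.

(** The defining integral is [+oo] at 0, and [fine] sends it to 0. *)
Lemma K0_0 : K0 (0 : R) = 0.
Proof.
rewrite /K0 -set_itvcy; under eq_integral do rewrite mul0r oppr0 expR0.
by rewrite integral_cst//= lebesgue_measure_itv/= ltry mul1e.
Qed.

Lemma measurable_K0 : measurable_fun setT (@K0 R : RT -> RT).
Proof.
apply: (measurableT_comp (@fine_measurable R setT measurableT)).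
pose D : set R := [set t : R | 0 <= t].
have mD : measurable D by rewrite /D -set_itvcy.
rewrite (_ : (fun r => _) = fubini_F mu (fun p : RT * RT =>
  (expR (- (p.1 * cosh p.2)) * \1_D p.2)%:E)); last first.
  apply/funext => r; rewrite /fubini_F -/D [LHS]integral_mkcond; apply: eq_integral => t _.
  rewrite /patch indicE; case: ifPn => _; by rewrite ?mulr1 ?mulr0.
apply: measurable_fun_fubini_tonelli_F.
  apply/measurable_EFinP; apply: measurable_funM.
    by rewrite /cosh; meas.
  exact: (measurableT_comp (measurable_indic mD) measurable_snd).
by move=> p; rewrite lee_fin mulr_ge0 ?expR_ge0.
Qed.

End HeatKernel.

(** * The Green function of the half-plane *)

Section KernelEstimates.
Variable R : realType.
Local Notation RT := (measurableTypeR R).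
Local Notation mu := (@lebesgue_measure R).
Local Notation leb2 := (@lebesgue2 R).
Local Notation q := (@resolvent_density R).
Local Notation Pi := (@Pi R).

(* GPi extended by 0. The clipping only acts on the diagonal, where the junk value K0 0 = 0 makes
   GPi negative. *)
Definition greenPi (x y : R * R) : R := \1_Pi x * \1_Pi y * Num.max (GPi x y) 0.
Local Notation Hk := greenPi.

Lemma greenPi_ge0 x y : 0 <= Hk x y.
Proof. by rewrite !mulr_ge0// le_max lexx orbT. Qed.

Lemma greenPi_sym x y : Hk x y = Hk y x.
Proof.
have E1 : enorm (x - y) = enorm (y - x).
  by rewrite /enorm /= -(opprB y.1) -(opprB y.2) !sqrrN.
have E2 : enorm (Defs.refl x - y) = enorm (Defs.refl y - x).
  by rewrite /enorm /=; congr Num.sqrt; ring.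
by rewrite /greenPi (mulrC (\1_Pi x)) /GPi /G E1 E2.
Qed.

Lemma greenPi_translate (c : R) (x y : R * R) :
  Hk (x + (c, 0)) (y + (c, 0)) = Hk x y.
Proof.
have PiE z : \1_Pi (z + (c, 0)) = \1_Pi z :> R.
  by rewrite !indicE; congr (_ _)%:R; apply/idP/idP; rewrite !inE /Defs.Pi /= addr0.
have E1 : x + (c, 0) - (y + (c, 0)) = x - y by rewrite opprD addrACA subrr addr0.
have E2 : Defs.refl (x + (c, 0)) - (y + (c, 0)) = Defs.refl x - y.
  by rewrite /Defs.refl /=; congr pair => /=; ring.
by rewrite /greenPi !PiE /GPi /G E1 E2.
Qed.

Lemma measurable_Pi : measurable (Pi : set (RT * RT)).
Proof.
rewrite (_ : Pi = setT `*` `]0, +oo[%classic); first exact: measurableX.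
by apply/seteqP; split => x; rewrite /Defs.Pi /= in_itv/= andbT// => -[].
Qed.

Lemma measurable_indic_Pi : measurable_fun setT (\1_Pi : RT * RT -> R).
Proof. exact: measurable_indic measurable_Pi. Qed.

Lemma measurable_enorm : measurable_fun setT (@enorm R : RT * RT -> RT).
Proof.
have ms : measurable_fun setT (Num.sqrt : RT -> RT).
  by apply: continuous_measurable_fun; exact: sqrt_continuous.
by apply: (measurableT_comp ms); meas.
Qed.

Lemma measurable_greenPi :
  measurable_fun setT (fun p : (RT * RT) * (RT * RT) => Hk p.1 p.2).
Proof.
have mG (f : (RT * RT) * (RT * RT) -> RT * RT) : measurable_fun setT f ->
    measurable_fun setT (fun p => (2 * pi)^-1 * K0 (enorm (f p))).
  move=> mf; apply: measurable_funM; first exact: measurable_cst.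
  apply: (measurableT_comp (@measurable_K0 R)).
  exact: (measurableT_comp measurable_enorm).
apply: measurable_funM.
  apply: measurable_funM.
    exact: (measurableT_comp measurable_indic_Pi measurable_fst).
  exact: (measurableT_comp measurable_indic_Pi measurable_snd).
apply: measurable_maxr; last exact: measurable_cst.
apply: measurable_funB; apply: mG.
  rewrite (_ : (fun _ => _) = (fun p : (RT * RT) * (RT * RT) =>
    (p.1.1 - p.2.1, p.1.2 - p.2.2))); first by meas.
  by apply/funext => -[[a b] [c e]].
rewrite (_ : (fun _ => _) = (fun p : (RT * RT) * (RT * RT) =>
    (p.1.1 - p.2.1, - p.1.2 - p.2.2))); first by meas.
by apply/funext => -[[a b] [c e]].
Qed.

Lemma measurable_greenPi2 x : measurable_fun setT (Hk x : RT * RT -> R).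
Proof.
apply: (measurableT_comp measurable_greenPi (g := fun y : RT * RT => (x : RT * RT, y))).
exact: measurable_fun_pair (measurable_cst _) (@measurable_id _ _ _).
Qed.

(** The integrand of [GPi x y] over [u]: the reflected Gaussian equals the direct one times exp(-x_2
    y_2 / s), because reflection adds 4 x_2 y_2 to the squared distance. *)
Definition kernel_density (x y : R * R) (u : R) : R :=
  q u (x - y) * (1 - expR (- (x.2 * y.2 * expR (- u)))).

Lemma measurable_kernel_density x y : measurable_fun setT (kernel_density x y : RT -> R).
Proof. by rewrite /kernel_density /resolvent_density /gauss2; meas. Qed.

Lemma kernel_density_ge0 x y u : Pi x -> Pi y -> 0 <= kernel_density x y u.
Proof.
rewrite /Defs.Pi /= => x2 y2; rewrite mulr_ge0 ?ltW ?density_gt0//.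
by rewrite subr_gt0 expR_lt1 oppr_lt0 !mulr_gt0// expR_gt0.
Qed.

Lemma kernel_densityE x y u :
  q u (x - y) = kernel_density x y u + q u (Defs.refl x - y).
Proof.
rewrite /kernel_density mulrBr mulr1 -addrA; apply/esym/eqP; rewrite addrC -subr_eq0 addrK.
rewrite addrC subr_eq0 /resolvent_density -!mulrA; apply/eqP; congr (_ * (_ * _)).
by rewrite /gauss2 -expRD /=; congr expR; field.
Qed.

Lemma greenPi_diag x : Hk x x = 0.
Proof.
rewrite /greenPi [X in _ * X](_ : _ = 0) ?mulr0//; apply/max_r.
have e0 : enorm (x - x) = 0 by rewrite subrr /enorm /= expr0n addr0 sqrtr0.
rewrite /GPi /G e0 K0_0 mulr0 sub0r oppr_le0.
rewrite mulr_ge0 ?invr_ge0 ?mulr_ge0 ?pi_ge0//.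
by apply/fine_ge0/integral_ge0 => t _; rewrite lee_fin expR_ge0.
Qed.

Lemma greenPi_off x y : ~ (Pi x /\ Pi y) -> Hk x y = 0.
Proof.
rewrite /greenPi !indicE => /not_andP[h|h]; rewrite (memNset h).
  by rewrite !mul0r.
by rewrite mulr0 mul0r.
Qed.

Lemma GPi_integral x y : Pi x -> Pi y -> x != y ->
  (GPi x y)%:E = nint mu (kernel_density x y).
Proof.
move=> Px Py xy.
have d1 : x - y != 0 by rewrite subr_eq0.
have d2 : Defs.refl x - y != 0.
  apply: contraTneq Px => /(congr1 snd) /= h; move: Py; rewrite /Defs.Pi /= => y0.
  by apply/negP => x0; lra.
have E : resolvent (x - y) =
    (nint mu (kernel_density x y) + resolvent (Defs.refl x - y)%R)%E.
  rewrite -nintD; last 4 first.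
  - exact: measurable_kernel_density.
  - exact: measurable_density1.
  - by move=> u; exact: kernel_density_ge0.
  - by move=> u; exact/ltW/density_gt0.
  by apply: eq_nint => u; exact: kernel_densityE.
have r1 := resolventE d1; have r2 := resolventE d2.
have -> : (GPi x y)%:E = (resolvent (x - y)%R - resolvent (Defs.refl x - y)%R)%E.
  by rewrite -r1 -r2 -EFinB.
rewrite E addeK//.
rewrite ge0_fin_numE; [exact: resolvent_fin|exact: resolvent_ge0].
Qed.

Lemma greenPi_GPi x y : Pi x -> Pi y -> x != y -> Hk x y = GPi x y.
Proof.
move=> Px Py xy; rewrite /greenPi !indicE (mem_set Px) (mem_set Py) !mul1r max_l//.
rewrite -lee_fin (GPi_integral Px Py xy).
by apply: nint_ge0 => u; exact: kernel_density_ge0.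
Qed.

Lemma greenPi_integral x y : Pi x -> Pi y -> x != y ->
  (Hk x y)%:E = nint mu (kernel_density x y).
Proof. by move=> Px Py xy; rewrite greenPi_GPi// GPi_integral. Qed.

Lemma greenPi_le x y (phi : R -> R) : measurable_fun setT (phi : RT -> R) ->
  (forall u, 0 <= phi u) ->
  (Pi x -> Pi y -> forall u, kernel_density x y u <= phi u) ->
  ((Hk x y)%:E <= nint mu phi)%E.
Proof.
move=> mphi phi0 h; have [[Px Py]|/greenPi_off->] := pselect (Pi x /\ Pi y); last exact: nint_ge0.
have [->|xy] := eqVneq x y; first by rewrite greenPi_diag; exact: nint_ge0.
rewrite greenPi_integral//; apply: le_nint => //.
- exact: measurable_kernel_density.
- by move=> u; exact: kernel_density_ge0.
- exact: h.
Qed.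

Lemma kernel_density_le x y u : Pi x -> Pi y -> kernel_density x y u <= q u (x - y).
Proof.
move=> _ _; apply: ler_piMr; first exact/ltW/density_gt0.
by rewrite gerBl expR_ge0.
Qed.

Lemma kernel_density_le_mul x y u : Pi x -> Pi y ->
  kernel_density x y u <= q u (x - y) * (x.2 * y.2 * expR (- u)).
Proof.
move=> Px Py; apply: ler_wpM2l; first exact/ltW/density_gt0.
by have := expR_ge1Dx (- (x.2 * y.2 * expR (- u))); lra.
Qed.

Lemma greenPi_le_resolvent x y : ((Hk x y)%:E <= resolvent (x - y)%R)%E.
Proof.
apply: greenPi_le => [|u|Px Py u]; first exact: measurable_density1.
  exact/ltW/density_gt0.
exact: kernel_density_le.
Qed.

Lemma measurable_subl (x : R * R) : measurable_fun setT ((fun y => x - y) : RT * RT -> RT * RT).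
Proof.
rewrite (_ : (fun _ => _) = (fun y : RT * RT => (x.1 - y.1, x.2 - y.2))); first by meas.
by apply/funext => -[a b].
Qed.

Lemma integral_greenPi x : (nint leb2 (Hk x) <= 1)%E.
Proof.
rewrite -(@integral_resolvent R) -(@leb2_subl R x); last 2 first.
- exact: measurable_resolvent.
- exact: resolvent_ge0.
apply: ge0_le_integral => //.
- by move=> y _; rewrite lee_fin greenPi_ge0.
- by apply/measurable_EFinP; exact: measurable_greenPi2.
- exact: (measurableT_comp (@measurable_resolvent R) (measurable_subl x)).
- by move=> y _; exact: greenPi_le_resolvent.
Qed.

(** Estimate the density of larger time by its supremum and integrate the other one exactly;
    [expR u <= expR (u / 2) * expR (v / 2)] for [u <= v] then gives a bound that factors in [u] and
    [v]. *)
Lemma resolvent_density_product u v :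
  (nint leb2 (fun z => q u z * q v z)%R <=
   (expR (u / 2) * expR (- expR u) * (expR (v / 2) * expR (- expR v)))%:E)%E.
Proof.
have bnd a b : (nint leb2 (fun z => q a z * q b z)%R <=
    (expR a * expR (- expR a) * expR (- expR b))%:E)%E.
  rewrite EFinM muleC -integral_density -nintZ; last 3 first.
  - exact: measurable_density2.
  - by move=> z; exact/ltW/density_gt0.
  - exact: expR_ge0.
  apply: le_nint => [|||z].
  - by apply: measurable_funM; exact: measurable_density2.
  - by apply: measurable_funM; [exact: measurable_cst|exact: measurable_density2].
  - by move=> z; rewrite mulr_ge0// ltW// density_gt0.
  rewrite mulrC; apply: ler_wpM2r; first exact/ltW/density_gt0.
  exact: density_le.
wlog uv : u v / u <= v.
  move=> h; have [uv|/ltW vu] := leP u v; first exact: h.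
  rewrite [X in (_ <= X%:E)%E]mulrC; apply: le_trans (h v u vu).
  by apply: lexx_eq; apply: eq_nint => z; rewrite mulrC.
apply: le_trans (bnd u v) _; rewrite lee_fin.
have e1 : expR u <= expR (u / 2) * expR (v / 2) by rewrite -expRD ler_expR; lra.
rewrite mulrACA -mulrA; apply: ler_wpM2r => //.
Qed.

Lemma eint_swap (f : RT * (RT * RT) -> \bar R) : measurable_fun setT f ->
  (forall p, 0 <= f p)%E ->
  (\int[leb2]_z \int[mu]_u f (u, z) = \int[mu]_u \int[leb2]_z f (u, z))%E.
Proof.
move=> mf f0; have := @fubini_tonelli _ _ RT (RT * RT)%type R mu leb2 f.
by move=> h; apply/esym; apply: h.
Qed.

(** By Tonelli the square is a double integral over two times, dominated by a product of two copies
    of [integral_expexp_half]. Square integrable sections let weak L^2 convergence act pointwise on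
    potentials. *)
Lemma integral_resolvent_sqr :
  (\int[leb2]_z (resolvent z * resolvent z) <= ((2 * expR 1) ^+ 2)%:E)%E.
Proof.
have q0 u z : 0 <= q u z by exact/ltW/density_gt0.
have mres := @measurable_resolvent R.
pose a (u : R) := expR (u / 2) * expR (- expR u).
have a0 u : 0 <= a u by rewrite mulr_ge0 ?expR_ge0.
have ma : measurable_fun setT (a : RT -> R) by rewrite /a; meas.
have E1 z : (resolvent z * resolvent z = \int[mu]_u ((q u z)%:E * resolvent z))%E.
  rewrite ge0_integralZr//.
  - by apply/measurable_EFinP; exact: measurable_density1.
  - by move=> u _; rewrite lee_fin.
  - exact: resolvent_ge0.
have E2 u : (\int[leb2]_z ((q u z)%:E * resolvent z) =
    \int[mu]_v nint leb2 (fun z => q u z * q v z)%R)%E.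
  rewrite -nint_swap//; last 2 first.
  - apply: measurable_funM; last exact: measurable_density.
    exact: (measurableT_comp (@measurable_density2 R u) measurable_snd).
  - by move=> v z; rewrite mulr_ge0.
  apply: eq_integral => z _; rewrite -nintZ//.
  exact: measurable_density1.
under eq_integral do rewrite E1.
rewrite (@eint_swap (fun p => ((q p.1 p.2)%:E * resolvent p.2)%E))/=; last 2 first.
- apply: emeasurable_funM; first by apply/measurable_EFinP; exact: measurable_density.
  exact: (measurableT_comp mres measurable_snd).
- by move=> p; rewrite mule_ge0 ?lee_fin// resolvent_ge0.
have mint : measurable_fun setT
    (fun u : RT => \int[mu]_v nint leb2 (fun z => q u z * q v z)%R)%E.
  under eq_fun do rewrite -E2.
  apply: (@measurable_fun_fubini_tonelli_F _ _ RT (RT * RT)%type R leb2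
    (fun p => ((q p.1 p.2)%:E * resolvent p.2)%E)).
    apply: emeasurable_funM; first by apply/measurable_EFinP; exact: measurable_density.
    exact: (measurableT_comp mres measurable_snd).
  by move=> p; rewrite mule_ge0 ?lee_fin// resolvent_ge0.
under eq_integral do rewrite E2.
have C0 : (0 <= (2 * expR 1 : R)) by rewrite mulr_ge0 ?expR_ge0.
apply: (@le_trans _ _ (\int[mu]_u ((2 * expR 1)%:E * (a u)%:E))%E).
  apply: ge0_le_integral => //.
  - by move=> u _; apply: integral_ge0 => v _; apply: nint_ge0 => z; rewrite mulr_ge0.
  - by apply/measurable_EFinP/measurable_funM.
  - move=> u _; apply: (@le_trans _ _ (nint mu (fun v => a u * a v))).
      apply: ge0_le_integral => //.
      + by move=> v _; apply: nint_ge0 => z; rewrite mulr_ge0.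
      + have := @measurable_fun_fubini_tonelli_F _ _ RT (RT * RT)%type R leb2
          (fun p => (q u p.2 * q p.1 p.2)%:E).
        apply; last by move=> p; rewrite lee_fin mulr_ge0.
        apply/measurable_EFinP/measurable_funM; last exact: measurable_density.
        exact: (measurableT_comp (@measurable_density2 R u) measurable_snd).
      + by apply/measurable_EFinP/measurable_funM.
      + by move=> v _; exact: resolvent_density_product.
    rewrite nintZ// muleC; apply: lee_wpmul2r; first by rewrite lee_fin.
    exact: integral_expexp_half.
rewrite ge0_integralZl_EFin//; last 2 first.
- by move=> u _; rewrite lee_fin.
- exact/measurable_EFinP.
rewrite expr2 (EFinM (2 * expR 1)); apply: lee_wpmul2l; first by rewrite lee_fin.
exact: integral_expexp_half.
Qed.

Lemma integral_greenPi_sqr x :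
  (nint leb2 (fun y => Hk x y ^+ 2)%R <= ((2 * expR 1) ^+ 2)%:E)%E.
Proof.
apply: le_trans integral_resolvent_sqr.
have mres := @measurable_resolvent R.
rewrite -(@leb2_subl R x (fun z => resolvent z * resolvent z)%E); last 2 first.
- exact: emeasurable_funM.
- by move=> z; rewrite mule_ge0// resolvent_ge0.
apply: ge0_le_integral => //.
- by move=> y _; rewrite lee_fin sqr_ge0.
- by apply/measurable_EFinP; apply: measurable_funX; exact: measurable_greenPi2.
- by apply: emeasurable_funM; exact: (measurableT_comp mres (measurable_subl x)).
- move=> y _; rewrite expr2 EFinM; apply: lee_pmul.
  + by rewrite lee_fin greenPi_ge0.
  + by rewrite lee_fin greenPi_ge0.
  + exact: greenPi_le_resolvent.
  + exact: greenPi_le_resolvent.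
Qed.

(** Integrand of the integrable b with G_Pi(x,y) <= x_2 b(x - y). The factor [expR (- (u / 2))] is
    1/sqrt s. Doubling the time ([u + ln 2]) gives up half of the Gaussian exponent, which absorbs
    the growth of 1 + |x_2 - y_2| / sqrt s with constant 3. *)
Definition boundary_density (u : R) (z : R * R) : R :=
  3 * expR (- (u / 2)) * ((4 * pi)^-1 * (expR (- expR u) * gauss2 (u + ln 2) z)).

Definition boundary_kernel (z : R * R) : \bar R := nint mu (fun u => boundary_density u z).

Lemma boundary_density_ge0 u z : 0 <= boundary_density u z.
Proof.
by rewrite !mulr_ge0 ?expR_ge0//; exact/ltW/four_pi_gt0.
Qed.

Lemma measurable_boundary_density :
  measurable_fun setT (fun p : RT * (RT * RT) => boundary_density p.1 p.2).
Proof. by rewrite /boundary_density /gauss2; meas. Qed.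

(** At fixed [u] the doubled Gaussian integrates to 8 pi e^u, leaving
    [6 * (expR (u / 2) * expR (- expR u))]; [integral_expexp_half] contributes the remaining
    [2 * expR 1]. *)
Lemma integral_boundary_kernel :
  (\int[leb2]_z boundary_kernel z <= (12 * expR 1)%:E)%E.
Proof.
rewrite nint_swap; [|exact: measurable_boundary_density|exact: boundary_density_ge0].
have E u : nint leb2 (boundary_density u) = (6 * (expR (u / 2) * expR (- expR u)))%:E.
  have mg : measurable_fun setT (fun z : RT * RT => gauss2 (u + ln 2) z).
    by rewrite /gauss2; meas.
  pose c := 3 * expR (- (u / 2)) * ((4 * pi)^-1 * expR (- expR u)).
  have c0 : 0 <= c by rewrite !mulr_ge0 ?expR_ge0//; exact/ltW/four_pi_gt0.
  have -> : nint leb2 (boundary_density u) = nint leb2 (fun z => c * gauss2 (u + ln 2) z).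
    by apply: eq_nint => z; rewrite /boundary_density /c !mulrA.
  rewrite (nintZ _ mg (fun z => ltW (gauss2_gt0 _ z)) c0) integral_gauss2 -EFinM.
  congr EFin; rewrite /c expRD lnK ?posrE// (expRN (u / 2)).
  move: (expR (- expR u)) => w; rewrite -(expR_half_sqr u).
  move: (pi_gt0 R) (expR_gt0 (u / 2)).
  move: (expR (u / 2)) (pi : R) => s p p0 s0; field.
  by rewrite !gt_eqF.
under eq_integral do rewrite E.
rewrite -[leLHS]/(nint mu (fun u => 6 * (expR (u / 2) * expR (- expR u)))).
rewrite nintZ.
- rewrite (_ : 12 * expR 1 = 6 * (2 * expR 1)); last by ring.
  by rewrite (EFinM 6); apply: lee_wpmul2l; [rewrite lee_fin|exact: integral_expexp_half].
- by meas.
- by move=> u; rewrite mulr_ge0 ?expR_ge0.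
- by [].
Qed.

(* With beta = x2/sqrt s: 1 - exp(-x2 y2/s) is at most min(1, x2|x2-y2|/s + beta^2), hence
   at most x2|x2-y2|/s + beta. *)
Lemma kernel_density_le_boundary x y u : Pi x -> Pi y ->
  kernel_density x y u <= x.2 * boundary_density u (x - y).
Proof.
rewrite /Defs.Pi /= => x2 y2.
set k := expR (- (u / 2)); have k0 : 0 < k by exact: expR_gt0.
have kE : expR (- u) = k ^+ 2 by rewrite -mulNr in k k0 *; rewrite expR_half_sqr.
pose d := `|x.2 - y.2|; have d0 : 0 <= d by exact: normr_ge0.
have yd : y.2 <= x.2 + d by rewrite /d; have := ler_norm (y.2 - x.2); rewrite distrC; lra.
have F1 : 1 - expR (- (x.2 * y.2 * expR (- u))) <= x.2 * (d * k ^+ 2 + k).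
  rewrite kE; set w := x.2 * y.2 * k ^+ 2.
  have w1 : 1 - expR (- w) <= w by have := expR_ge1Dx (- w); lra.
  have w2 : 1 - expR (- w) <= 1 by have := expR_ge0 (- w); lra.
  have wle : w <= x.2 * (x.2 + d) * k ^+ 2.
    rewrite /w; apply: ler_wpM2r; first exact: sqr_ge0.
    by apply: ler_wpM2l yd; exact: ltW.
  have dk : 0 <= x.2 * (d * k ^+ 2) by rewrite !mulr_ge0 ?sqr_ge0// ltW.
  have [b1|b1] := leP (x.2 * k) 1.
    have b0 : 0 <= x.2 * k by rewrite mulr_ge0 ?ltW.
    have bb : (x.2 * k) ^+ 2 <= x.2 * k by rewrite expr2 ler_piMr.
    apply: le_trans w1 _; apply: le_trans wle _.
    rewrite (_ : x.2 * (x.2 + d) * k ^+ 2 = (x.2 * k) ^+ 2 + x.2 * (d * k ^+ 2)); last by ring.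
    rewrite mulrDr; lra.
  apply: le_trans w2 _; rewrite mulrDr; lra.
set g := gauss2 (u + ln 2) (x - y); have g0 : 0 < g by exact: gauss2_gt0.
have gE : gauss2 u (x - y) = g ^+ 2.
  rewrite /g /gauss2 [RHS]expr2 -expRD; congr expR.
  by rewrite (opprD u) (expRD (- u)) (expRN (ln 2)) lnK ?posrE//; field.
have F2 : g * (d * k + 1) <= 3.
  pose t := d * k.
  have t1 : t + 1 <= 3 * expR (t ^+ 2 / 8).
    have := expR_ge1Dx (t ^+ 2 / 8); have := sqr_ge0 (3 * t - 4); nra.
  have t2 : g * expR (t ^+ 2 / 8) <= 1.
    rewrite /g /gauss2 -expRD -[leRHS]expR0 ler_expR (opprD u) (expRD (- u)) (expRN (ln 2)).
    rewrite lnK ?posrE// kE.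
    rewrite /t exprMn /d real_normK ?num_real//=.
    have := sqr_ge0 ((x.1 - y.1) * k); rewrite exprMn.
    set X := (x.1 - y.1) ^+ 2 * k ^+ 2.
    rewrite (_ : - (((x.1 - y.1) ^+ 2 + (x.2 - y.2) ^+ 2) * (k ^+ 2 * 2^-1) / 4) +
      (x.2 - y.2) ^+ 2 * k ^+ 2 / 8 = - X / 8); first by lra.
    by rewrite /X; field.
  apply: le_trans (ler_wpM2l (ltW g0) t1) _.
  by rewrite mulrCA ler_piMr.
rewrite /kernel_density /resolvent_density gE.
have P0 : 0 <= (4 * pi)^-1 * (expR (- expR u) * g ^+ 2).
  by rewrite !mulr_ge0 ?expR_ge0 ?sqr_ge0//; exact/ltW/four_pi_gt0.
apply: le_trans (ler_wpM2l P0 F1) _; rewrite /boundary_density -/k -/g.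
have Q0 : 0 <= x.2 * k * ((4 * pi)^-1 * (expR (- expR u) * g)).
  by rewrite !mulr_ge0 ?expR_ge0 ?(ltW x2) ?(ltW k0) ?(ltW g0)//; exact/ltW/four_pi_gt0.
have := ler_wpM2l Q0 F2; congr (_ <= _); ring.
Qed.

Lemma greenPi_le_boundary x y : Pi x ->
  ((Hk x y)%:E <= (x.2)%:E * boundary_kernel (x - y)%R)%E.
Proof.
move=> Px; have x0 := ltW Px.
have mb : measurable_fun setT (fun u : RT => boundary_density u (x - y)).
  by rewrite /boundary_density /gauss2; meas.
rewrite -nintZ//; last by move=> u; exact: boundary_density_ge0.
apply: greenPi_le => [|u|_ Py u].
- by apply: measurable_funM; [exact: measurable_cst|].
- by rewrite mulr_ge0// boundary_density_ge0.
- exact: kernel_density_le_boundary.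
Qed.

Lemma boundary_kernelN z : boundary_kernel (- z) = boundary_kernel z.
Proof. by apply: eq_nint => u; rewrite /boundary_density /gauss2 /= !sqrrN. Qed.

Lemma measurable_boundary_kernel : measurable_fun setT (boundary_kernel : RT * RT -> \bar R).
Proof.
apply: measurable_nint; [exact: measurable_boundary_density|exact: boundary_density_ge0].
Qed.

Lemma boundary_kernel_ge0 z : (0 <= boundary_kernel z)%E.
Proof. by apply: nint_ge0 => u; exact: boundary_density_ge0. Qed.

(** * Splitting the kernel into short times and a tail controlled by the heights *)

Section HeadTail.
Variable a : R.
Local Notation lo := (\1_(`]-oo, a]%classic : set R) : R -> R).
Local Notation hi := (\1_(`]a, +oo[%classic : set R) : R -> R).

Let mlo : measurable_fun setT (lo : RT -> R).
Proof. by apply: measurable_indic; exact: measurable_itv. Qed.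
Let mhi : measurable_fun setT (hi : RT -> R).
Proof. by apply: measurable_indic; exact: measurable_itv. Qed.

Let lohi u : lo u + hi u = 1.
Proof.
rewrite !indicE; case: (leP u a) => ua.
  by rewrite mem_set ?memNset ?addr0//= in_itv/= ?andbT//; apply/negP; rewrite -leNgt.
by rewrite memNset ?mem_set ?add0r//= in_itv/= ?andbT//; apply/negP; rewrite -ltNge.
Qed.

Definition head_kernel (z : R * R) : \bar R := nint mu (fun u => lo u * q u z).

Let head0 u z : 0 <= lo u * q u z.
Proof. by rewrite mulr_ge0// ltW// density_gt0. Qed.

Let mhead : measurable_fun setT (fun p : RT * (RT * RT) => lo p.1 * q p.1 p.2).
Proof.
apply: measurable_funM; last exact: measurable_density.
exact: (measurableT_comp mlo measurable_fst).
Qed.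

Lemma head_kernel_ge0 z : (0 <= head_kernel z)%E.
Proof. by apply: nint_ge0 => u; exact: head0. Qed.

Lemma measurable_head_kernel : measurable_fun setT (head_kernel : RT * RT -> \bar R).
Proof. exact: (@measurable_nint R (fun u z => lo u * q u z)). Qed.

Lemma head_kernelN z : head_kernel (- z) = head_kernel z.
Proof. by apply: eq_nint => u; rewrite densityN. Qed.

(** The times beyond [a] carry exactly [expR (- expR a)] of the total integral 1, and 1 - exp(-e^a)
    <= e^a. *)
Lemma integral_head_kernel : (\int[leb2]_z head_kernel z <= (expR a)%:E)%E.
Proof.
rewrite (@nint_swap R (fun u z => lo u * q u z))//.
pose f (u : R) := expR u * expR (- expR u).
have f0 u : 0 <= f u by rewrite mulr_ge0 ?expR_ge0.
have mf : measurable_fun setT (f : RT -> R) by rewrite /f; meas.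
have E u : nint leb2 (fun z => lo u * q u z) = (lo u * f u)%:E.
  rewrite nintZ//; [by rewrite integral_density|exact: measurable_density2|].
  by move=> z; exact/ltW/density_gt0.
under eq_integral do rewrite E.
rewrite -[leLHS]/(nint mu (fun u => lo u * f u)).
have S : (nint mu (fun u => lo u * f u)%R + (expR (- expR a))%:E = 1%:E)%E.
  rewrite -integral_expexp_tail -integral_itv_obnd_cbnd; last first.
    by apply/measurable_EFinP; apply: measurable_funTS.
  rewrite integral_mkcond -integral_expexp.
  have -> : (\int[mu]_x ((fun u => (expR u * expR (- expR u))%:E) \_ `]a, +oo[) x =
      nint mu (fun u => hi u * f u)%R)%E.
    apply: eq_integral => u _; rewrite /patch indicE; case: ifPn => _.
      by rewrite mul1r.
    by rewrite mul0r.
  rewrite -nintD.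
  - by apply: eq_nint => u; rewrite -mulrDl lohi mul1r.
  - exact: measurable_funM.
  - exact: measurable_funM.
  - by move=> u; rewrite mulr_ge0.
  - by move=> u; rewrite mulr_ge0.
have : (0 <= nint mu (fun u => lo u * f u)%R)%E.
  by apply: nint_ge0 => u; rewrite mulr_ge0.
move: S; case: (nint mu _) => [r| |]//= [S] _; rewrite lee_fin.
by have := expR_ge1Dx (- expR a); lra.
Qed.

Lemma greenPi_le_head_tail x y (phi : R -> R) : measurable_fun setT (phi : RT -> R) ->
  (forall u, 0 <= phi u) ->
  (Pi x -> Pi y -> forall u, a < u -> kernel_density x y u <= phi u) ->
  ((Hk x y)%:E <= head_kernel (x - y)%R + nint mu phi)%E.
Proof.
move=> mphi phi0 h.
have mh : measurable_fun setT (fun u : RT => lo u * q u (x - y)).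
  by apply: measurable_funM => //; exact: measurable_density1.
rewrite -nintD//; apply: greenPi_le => [|u|Px Py u].
- exact: measurable_funD.
- by rewrite addr_ge0.
have [ua|ua] := leP u a.
  apply: le_trans (kernel_density_le u Px Py) _.
  by rewrite indicE mem_set ?mul1r ?lerDl//= in_itv.
by apply: le_trans (h Px Py u ua) _; rewrite lerDr.
Qed.

(** Beyond [a] the factor 1/s is traded for s at the price [expR (- (2 * a))], so that the tail
    integrals reduce to integrals of e^{-s} or e^{-s/2} over s > 0. *)
Let expN_le u : a < u -> expR (- u) <= expR (- (2 * a)) * expR u.
Proof. by move=> au; rewrite -expRD ler_expR; lra. Qed.

Lemma integral_expexpZ (c : R) : 0 <= c ->
  nint mu (fun u => c * (expR u * expR (- expR u))) = c%:E.
Proof.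
move=> c0; rewrite nintZ.
- by rewrite integral_expexp mule1.
- by meas.
- by move=> u; rewrite mulr_ge0 ?expR_ge0.
- exact: c0.
Qed.

Lemma greenPi_le_head x y : Pi x -> Pi y ->
  ((Hk x y)%:E <= head_kernel (x - y)%R + (expR (- (2 * a)) * (x.2 * y.2))%:E)%E.
Proof.
move=> Px Py; have xy : 0 < x.2 * y.2 by rewrite mulr_gt0.
pose c := expR (- (2 * a)) * (x.2 * y.2).
have c0 : 0 <= c by rewrite mulr_ge0 ?expR_ge0 ?ltW.
rewrite -/c -(integral_expexpZ c0).
apply: greenPi_le_head_tail => [|u|_ _ u au].
- by meas.
- by apply: mulr_ge0; [exact: c0|rewrite mulr_ge0 ?expR_ge0].
have w0 : 0 <= x.2 * y.2 * expR (- u) by rewrite mulr_ge0 ?expR_ge0 ?ltW.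
apply: le_trans (kernel_density_le_mul u Px Py) _.
apply: le_trans (ler_wpM2r w0 (density_le _ _)) _.
have h := ler_wpM2l (ltW xy) (expN_le au).
have h2 := ler_wpM2l (expR_ge0 (- expR u)) h.
by apply: le_trans h2 _; rewrite /c; apply: lexx_eq; ring.
Qed.

Lemma integral_expexp_scaled :
  nint mu (fun u => expR u * expR (- (expR u / 2))) = 2%:E :> \bar R.
Proof.
rewrite /nint -(@integral_translate R (ln 2) (fun u => (expR u * expR (- (expR u / 2)))%:E)).
- transitivity (nint mu (fun u => 2 * (expR u * expR (- expR u)))).
    apply: eq_integral => u _; rewrite expRD lnK ?posrE// mulfK//.
    by congr EFin; ring.
  by rewrite integral_expexpZ.
- by apply/measurable_EFinP; meas.
- by move=> u; rewrite lee_fin mulr_ge0 ?expR_ge0.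
Qed.

(** Half of the decay e^{-s} is kept for the integration over [u]; the other half combines with the
    Gaussian into a factor exp(-L/2). *)
Lemma greenPi_le_head_far x y (L : R) : Pi x -> Pi y -> 0 <= L ->
  L <= `|x.1 - y.1| \/ L <= `|x.2 - y.2| ->
  ((Hk x y)%:E <= head_kernel (x - y)%R +
     (2 * expR (- (2 * a)) * expR (- (L / 2)) * (x.2 * y.2))%:E)%E.
Proof.
move=> Px Py L0 far; have xy : 0 < x.2 * y.2 by rewrite mulr_gt0.
have L2 : L ^+ 2 <= (x.1 - y.1) ^+ 2 + (x.2 - y.2) ^+ 2.
  have h t : L <= `|t| -> L ^+ 2 <= t ^+ 2.
    by move=> Lt; rewrite -[t ^+ 2]real_normK ?num_real// ler_sqr ?nnegrE.
  by case: far => /h; [have := sqr_ge0 (x.2 - y.2)|have := sqr_ge0 (x.1 - y.1)]; lra.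
pose c := expR (- (2 * a)) * expR (- (L / 2)) * (x.2 * y.2).
have c0 : 0 <= c by rewrite !mulr_ge0 ?expR_ge0 ?ltW.
have -> : 2 * expR (- (2 * a)) * expR (- (L / 2)) * (x.2 * y.2) = c * 2.
  by rewrite /c; ring.
rewrite (EFinM c) -integral_expexp_scaled -nintZ; last 3 first.
- by meas.
- by move=> u; rewrite mulr_ge0 ?expR_ge0.
- exact: c0.
apply: greenPi_le_head_tail => [|u|_ _ u au].
- by meas.
- by apply: mulr_ge0; [exact: c0|rewrite mulr_ge0 ?expR_ge0].
have w0 : 0 <= x.2 * y.2 * expR (- u) by rewrite mulr_ge0 ?expR_ge0 ?ltW.
apply: le_trans (kernel_density_le_mul u Px Py) _.
apply: (@le_trans _ _ (expR (- (expR u / 2)) * expR (- (L / 2)) * (x.2 * y.2 * expR (- u)))).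
  apply: ler_wpM2r => //.
  apply: (@le_trans _ _ (expR (- expR u) * gauss2 u (x - y))).
    apply: ler_piMl; last exact: four_pi_le1.
    by rewrite mulr_ge0 ?expR_ge0//; exact/ltW/gauss2_gt0.
  rewrite /gauss2 -!expRD ler_expR /= expRN.
  have := expR_gt0 u; move: (expR u) => s s0.
  set D := (_ + _) in L2 *.
  (* AM-GM: s/2 + L^2/(4s) >= L/2 *)
  have : 0 <= (s - L) ^+ 2 / (4 * s) + (s + L) * 0 + (D - L ^+ 2) / (4 * s).
    rewrite mulr0 addr0 addr_ge0// divr_ge0 ?sqr_ge0// ?mulr_ge0 ?(ltW s0)//; lra.
  have -> : (s - L) ^+ 2 / (4 * s) + (s + L) * 0 + (D - L ^+ 2) / (4 * s) =
     s / 4 - L / 2 + D * s^-1 / 4 by field; rewrite gt_eqF.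
  lra.
have h := ler_wpM2l (ltW xy) (expN_le au).
have e0 : 0 <= expR (- (expR u / 2)) * expR (- (L / 2)) by rewrite mulr_ge0 ?expR_ge0.
have h2 := ler_wpM2l e0 h.
by apply: le_trans h2 _; rewrite /c; apply: lexx_eq; ring.
Qed.

(** Far from the boundary the reflection gives no smallness, but the bound is relative to
    [x.2 * y.2]: the constant 1 is at most [x.2 * y.2 / M] times [expR (- a) * expR u]. *)
Lemma greenPi_le_head_high x y (M : R) : Pi x -> Pi y -> 0 < M -> M <= x.2 * y.2 ->
  ((Hk x y)%:E <= head_kernel (x - y)%R + (expR (- a) / M * (x.2 * y.2))%:E)%E.
Proof.
move=> Px Py M0 Mxy; have xy : 0 < x.2 * y.2 by rewrite mulr_gt0.
pose c := expR (- a) / M * (x.2 * y.2).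
have c0 : 0 <= c by rewrite !mulr_ge0 ?expR_ge0 ?invr_ge0 ?ltW.
rewrite -/c -(integral_expexpZ c0).
apply: greenPi_le_head_tail => [|u|_ _ u au].
- by meas.
- by apply: mulr_ge0; [exact: c0|rewrite mulr_ge0 ?expR_ge0].
apply: le_trans (kernel_density_le u Px Py) _.
apply: (@le_trans _ _ (expR (- expR u))).
  exact: density_le.
rewrite mulrA; apply: ler_peMl; first exact: expR_ge0.
have -> : c * expR u = (x.2 * y.2 / M) * (expR (- a) * expR u) by rewrite /c; ring.
apply: mulr_ege1; first by rewrite ler_pdivlMr ?mul1r.
by rewrite -expRD -[leLHS]expR0 ler_expR; lra.
Qed.

(** This excludes vertical escape. If [y] is high, either [x] has height at least [L / 2], so that
    the product of the heights is large, or the two points are at vertical distance at least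
    [L / 2]. *)
Lemma greenPi_le_head_small (eta : R) : 0 < eta -> exists2 L, 0 < L &
  forall x y, Pi x -> Pi y -> L <= `|x.1 - y.1| \/ L <= y.2 ->
  ((Hk x y)%:E <= head_kernel (x - y)%R + (eta * (x.2 * y.2))%:E)%E.
Proof.
move=> eta0.
(* The first term comes from the distant case at distance [L / 2], where exp(-L/4) <= 4/L; the
   second from the high case with height product at least [L / 2 * L]. Both tails are small as soon
   as [1 <= L] and [A <= eta * L]. *)
pose A := 8 * expR (- (2 * a)) + 2 * expR (- a).
have e1 := expR_gt0 (- (2 * a)); have e2 := expR_gt0 (- a).
have A0 : 0 < A by rewrite /A; lra.
pose L := 1 + A / eta; have Ae : 0 < A / eta by rewrite divr_gt0.
have L1 : 1 <= L by rewrite /L; lra.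
have L0 : 0 < L by lra.
have AL : A <= eta * L.
  by rewrite /L mulrDr mulr1 mulrCA divff ?gt_eqF// mulr1; lra.
exists L => // x y Px Py far; have xy : 0 < x.2 * y.2 by rewrite mulr_gt0.
have farcase : L / 2 <= `|x.1 - y.1| \/ L / 2 <= `|x.2 - y.2| ->
    ((Hk x y)%:E <= head_kernel (x - y)%R + (eta * (x.2 * y.2))%:E)%E.
  move=> h; apply: le_trans (greenPi_le_head_far Px Py _ h) _; first lra.
  apply: leeD2l; rewrite lee_fin; apply: ler_wpM2r; first exact: ltW.
  have := expRN_le_inv (x := L / 2 / 2) _; rewrite divr_gt0 ?divr_gt0// => /(_ isT) h1.
  apply: le_trans (ler_wpM2l _ h1) _; first lra.
  rewrite -(ler_pM2r L0) (_ : 2 * expR (- (2 * a)) * (L / 2 / 2)^-1 * L = 8 * expR (- (2 * a))).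
    by apply: le_trans AL; rewrite /A; lra.
  by field; rewrite gt_eqF.
case: far => far; first by apply: farcase; left; lra.
have [xL|xL] := leP (L / 2) x.2; last first.
  apply: farcase; right; rewrite distrC; have := ler_norm (y.2 - x.2); lra.
have M0 : 0 < L / 2 * L by rewrite mulr_gt0//; lra.
have Mle : L / 2 * L <= x.2 * y.2 by apply: ler_pM => //; lra.
apply: le_trans (greenPi_le_head_high Px Py M0 Mle) _.
apply: leeD2l; rewrite lee_fin; apply: ler_wpM2r; first exact: ltW.
rewrite ler_pdivrMr//; have : 2 * expR (- a) <= eta * L by rewrite /A in AL; lra.
have : eta * L * 1 <= eta * L * L by apply: ler_wpM2l L1; rewrite mulr_ge0 ?ltW.
lra.
Qed.

End HeadTail.

(** * The kernel on large squares *)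

Definition box (c r : R) : set (R * R) := [set z | `|z.1| < r /\ `|z.2 - c| < r].

Lemma boxE c r : box c r = `]-r, r[%classic `*` `]c - r, c + r[%classic.
Proof.
apply/seteqP; split => z; rewrite /box /= !in_itv/= !ltr_norml.
  by move=> [-> /andP[h1 h2]]; split => //; apply/andP; split; lra.
by move=> [-> /andP[h1 h2]]; split => //; apply/andP; split; lra.
Qed.

Lemma measurable_box c r : measurable (box c r : set (RT * RT)).
Proof. by rewrite boxE; apply: measurableX; exact: measurable_itv. Qed.

Lemma lebesgue2_box (c r : R) : 0 < r -> leb2 (box c r) = (4 * r ^+ 2)%:E.
Proof.
move=> r0; have -> : leb2 (box c r) = (mu \x mu)%E (box c r) by [].
rewrite boxE.
pose I1 : set R := `]-r, r[%classic; pose I2 : set R := `]c - r, c + r[%classic.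
transitivity (mu I1 * mu I2)%E.
  by apply: product_measure1E; exact: measurable_itv.
have lr : - r < r by lra.
have lc : c - r < c + r by lra.
rewrite /I1 /I2 !lebesgue_measure_itv/= !lte_fin lr lc.
by rewrite -!EFinB -EFinM; congr EFin; ring.
Qed.

Lemma box_nd k l : (k <= l)%N -> box 0 k.+1%:R `<=` box 0 l.+1%:R.
Proof.
move=> kl x [h1 h2]; have : k.+1%:R <= l.+1%:R :> R by rewrite ler_nat.
by split; lra.
Qed.

Lemma box_cover : \bigcup_k box 0 k.+1%:R = setT.
Proof.
apply/seteqP; split => // x _; pose N := Num.truncn (`|x.1| + `|x.2|).
have N0 : 0 <= `|x.1| + `|x.2| by rewrite addr_ge0.
have /andP[_ h] := truncn_itv N0.
by exists N => //; split; rewrite ?subr0; apply: le_lt_trans h; rewrite ?lerDl ?lerDr.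
Qed.

Lemma set1_pair (x : R * R) : [set x] = [set x.1] `*` [set x.2].
Proof. by apply/seteqP; split => [z ->//|[a b] [/= -> ->]]; case: x. Qed.

Lemma lebesgue2_set1 x : leb2 [set x] = 0%E.
Proof.
have -> : leb2 [set x] = (mu \x mu)%E [set x] by [].
rewrite set1_pair.
transitivity (mu [set x.1] * mu [set x.2])%E; first exact: product_measure1E.
by rewrite !lebesgue_measure_set1 mule0.
Qed.

Lemma measurable_set1x x : measurable ([set x] : set (RT * RT)).
Proof.
rewrite set1_pair.
by apply: measurableX; exact: measurable_set1.
Qed.

Lemma measurable_indic_box c r : measurable_fun setT (\1_(box c r) : RT * RT -> R).
Proof. by apply: measurable_indic; exact: measurable_box. Qed.

Lemma integral_indic_box (c r : R) : 0 < r -> nint leb2 \1_(box c r) = (4 * r ^+ 2)%:E.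
Proof.
move=> r0; rewrite /nint integral_indic; [|exact: measurableT|exact: measurable_box].
by rewrite setIT; exact: lebesgue2_box.
Qed.

Lemma resolvent_box (eta : R) : 0 < eta -> exists2 r, 0 < r &
  ((1 - eta)%:E <= \int[leb2]_z ((\1_(box 0 r) z)%:E * resolvent z))%E.
Proof.
move=> eta0; have mres := @measurable_resolvent R.
pose F n : set (R * R) := box 0 n.+1%:R.
have cv : (\int[leb2]_(x in F n) resolvent x)%E @[n --> \oo] -->
    (\int[leb2]_(x in \bigcup_n F n) resolvent x)%E.
  apply: ge0_nondecreasing_set_cvg_integral.
  - by move=> n m nm; apply/subsetPset; exact: box_nd.
  - by move=> n; exact: measurable_box.
  - by move=> n; apply: measurable_funTS; exact: mres.
  - by move=> n x _; exact: resolvent_ge0.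
rewrite box_cover integral_resolvent in cv.
apply: contrapT => /forall2NP h.
have : (1 <= (1 - eta)%:E :> \bar R)%E.
  rewrite -(cvg_lim _ cv)//; apply: lime_le; first exact: cvgP cv.
  apply: nearW => n; have [|/negP] := h n.+1%:R; first by [].
  rewrite -ltNge => /ltW; apply: le_trans.
  rewrite integral_mkcond; apply: lexx_eq.
  apply: eq_integral => z _; rewrite /patch indicE.
  by case: ifPn => _; rewrite ?mul1e ?mul0e.
by rewrite lee_fin; lra.
Qed.

Lemma box_inner (r L : R) (x y : R * R) : box L (L - r) x -> box 0 r (x - y) ->
  [/\ box L L y, Pi y & ~ box 0 r (Defs.refl x - y)].
Proof.
move=> [/= + +] [/= + +]; rewrite !ltr_norml subr0.
move=> /andP[? ?] /andP[? ?] /andP[? ?] /andP[? ?].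
have y2 : 0 < y.2 by lra.
split => //.
  by split; rewrite ltr_norml; apply/andP; split; lra.
by move=> [_ /=]; rewrite subr0 ltr_norml => /andP[h1 _]; lra.
Qed.

(** For [x] at distance at least [r] from the sides, the square contains the box of half-side [r]
    around [x], while the reflected difference stays outside [box 0 r]. So one [eta] is lost by
    localizing the resolvent, and another by its reflected copy. *)
Lemma greenPi_inner (eta r L : R) (x : R * R) : 0 < eta -> 0 < r -> r < L ->
  ((1 - eta)%:E <= \int[leb2]_z ((\1_(box 0 r) z)%:E * resolvent z))%E ->
  box L (L - r) x ->
  ((1 - 2 * eta)%:E <= \int[leb2]_y (Hk x y * \1_(box L L) y)%:E)%E.
Proof.
move=> eta0 r0 rL hr xin.
have mres := @measurable_resolvent R.
have mi := @measurable_indic_box 0 r.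
pose A z := ((\1_(box 0 r) z)%:E * @resolvent R z)%E.
pose C z := ((1 - \1_(box 0 r) z)%:E * @resolvent R z)%E.
have i1 z : 0 <= \1_(box 0 r) z :> R by [].
have i2 z : 0 <= 1 - \1_(box 0 r) z :> R.
  by rewrite subr_ge0 indicE; case: (_ \in _).
have A0 z : (0 <= A z)%E by rewrite mule_ge0 ?lee_fin ?resolvent_ge0.
have C0 z : (0 <= C z)%E by rewrite mule_ge0 ?lee_fin ?resolvent_ge0.
have mA : measurable_fun setT (A : RT * RT -> \bar R).
  by apply: emeasurable_funM => //; exact/measurable_EFinP.
have mC : measurable_fun setT (C : RT * RT -> \bar R).
  apply: emeasurable_funM => //; apply/measurable_EFinP.
  by apply: measurable_funB => //; exact: measurable_cst.
have AC : (\int[leb2]_z A z + \int[leb2]_z C z = 1%:E)%E.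
  rewrite -ge0_integralD// -(@integral_resolvent R); apply: eq_integral => z _.
  rewrite /A /C -ge0_muleDl ?lee_fin// -EFinD.
  by rewrite addrC subrK mul1e.
have Px : Pi x.
  by move: xin => [_ /=]; rewrite /Defs.Pi /= ltr_norml => /andP[? ?]; lra.
pose X := (\int[leb2]_y (Hk x y * \1_(box L L) y)%:E)%E.
have mH : measurable_fun setT (fun y : RT * RT => Hk x y * \1_(box L L) y).
  by apply: measurable_funM; [exact: measurable_greenPi2|exact: measurable_indic_box].
have H0 y : 0 <= Hk x y * \1_(box L L) y by rewrite mulr_ge0// greenPi_ge0.
(* Written additively, since extended reals do not subtract freely. The pointwise inequality fails
   at most at [y = x], a null set. *)
have key : (\int[leb2]_z A z <= X + \int[leb2]_z C z)%E.
  have eA := leb2_subl x mA A0; have eC := leb2_subl (Defs.refl x) mC C0.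
  have mA' := measurableT_comp mA (measurable_subl x).
  have mC' := measurableT_comp mC (measurable_subl (Defs.refl x)).
  have mH' : measurable_fun setT (EFin \o (fun y : RT * RT => Hk x y * \1_(box L L) y)).
    exact/measurable_EFinP.
  have eS := ge0_integralD leb2 measurableT
    (fun y _ => H0 y : (0 <= (Hk x y * \1_(box L L) y)%:E)%E) mH'
    (fun y _ => C0 (Defs.refl x - y)) mC'.
  rewrite -eA -eC; apply: le_trans (lexx_eq eS).
  apply: ae_ge0_le_integral.
  - exact: measurableT.
  - by move=> y _; exact: A0.
  - exact: mA'.
  - by move=> y _; apply: adde_ge0; [exact: H0|exact: C0].
  - exact: emeasurable_funD.
  exists [set x]; split; [exact: measurable_set1x|exact: lebesgue2_set1|].
  move=> y /= h; apply: contrapT => /eqP xy; apply: h => _.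
  suff : (A (x - y)%R <= (Hk x y * \1_(box L L) y)%:E + C (Defs.refl x - y)%R)%E by exact.
  have [hb|hb] := pselect (box 0 r (x - y)); last first.
    have -> : A (x - y) = 0%E by rewrite /A indicE (memNset hb) mul0e.
    by apply: adde_ge0; [exact: H0|exact: C0].
  have [yB yP nb] := box_inner xin hb.
  have A1 : A (x - y) = resolvent (x - y) by rewrite /A indicE (mem_set hb) mul1e.
  have C1 : C (Defs.refl x - y) = resolvent (Defs.refl x - y).
    by rewrite /C indicE (memNset nb) subr0 mul1e.
  have B1 : \1_(box L L) y = 1 :> R by rewrite indicE (mem_set yB).
  have xy' : x != y by rewrite eq_sym.
  have k1 : (Hk x y * \1_(box L L) y)%:E = nint mu (kernel_density x y).
    by rewrite B1 mulr1 (greenPi_integral Px yP xy').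
  rewrite A1 C1 k1.
  apply: lexx_eq; rewrite -nintD.
  - by apply: eq_nint => u; exact: kernel_densityE.
  - exact: measurable_kernel_density.
  - exact: measurable_density1.
  - by move=> u; exact: kernel_density_ge0.
  - by move=> u; exact/ltW/density_gt0.
have X0 : (0 <= X)%E by apply: integral_ge0 => y _; rewrite lee_fin.
have a0 : (0 <= \int[leb2]_z A z)%E by apply: integral_ge0 => z _; exact: A0.
have c0 : (0 <= \int[leb2]_z C z)%E by apply: integral_ge0 => z _; exact: C0.
have hr' : ((1 - eta)%:E <= \int[leb2]_z A z)%E := hr.
suff : ((1 - 2 * eta)%:E <= X)%E by [].
move: hr' AC key X0 a0 c0; clear.
move: (\int[leb2]_z A z)%E (\int[leb2]_z C z)%E X => [a| |] [c| |] [b| |]//.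
  rewrite -!EFinD !lee_fin => h1 [h2] h3 _ _ _; lra.
by move=> *; exact: leey.
Qed.

(** On [box L L], a square resting on the boundary of [Pi], the choice [L = 4 * r / eta] makes the
    margin [r] the fraction [eta / 4] of the half-side; the loss is then governed by (1 - eta/2)(1 -
    eta/4)^2 >= 1 - eta. *)
Lemma greenPi_box (eta : R) : 0 < eta -> eta <= 1 -> exists2 L, 0 < L &
  (((1 - eta) * (4 * L ^+ 2))%:E <=
    \int[leb2]_x \int[leb2]_y (\1_(box L L) x * Hk x y * \1_(box L L) y)%:E)%E.
Proof.
move=> eta0 eta1; have e4 : 0 < eta / 4 by rewrite divr_gt0.
have [r r0 hr] := resolvent_box e4.
pose L := 4 * r / eta; have L0 : 0 < L by rewrite divr_gt0// mulr_gt0.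
have rL : r < L by rewrite /L ltr_pdivlMr//; nra.
exists L => //.
have mH : measurable_fun setT (fun p : (RT * RT) * (RT * RT) =>
    (\1_(box L L) p.1 * Hk p.1 p.2 * \1_(box L L) p.2)%:E).
  apply/measurable_EFinP; apply: measurable_funM; first apply: measurable_funM.
  - exact: (measurableT_comp (@measurable_indic_box L L) measurable_fst).
  - exact: measurable_greenPi.
  - exact: (measurableT_comp (@measurable_indic_box L L) measurable_snd).
have H0 x y : 0 <= \1_(box L L) x * Hk x y * \1_(box L L) y.
  by apply: mulr_ge0 => //; apply: mulr_ge0 => //; exact: greenPi_ge0.
have rL0 : 0 < L - r by lra.
pose k := 1 - 2 * (eta / 4); have k0 : 0 <= k by rewrite /k; lra.
apply: (@le_trans _ _ (\int[leb2]_x (k * \1_(box L (L - r)) x)%:E)%E).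
  rewrite -[leRHS]/(nint leb2 (fun x => k * \1_(box L (L - r)) x)).
  rewrite (nintZ _ (@measurable_indic_box L (L - r)) (fun=> ler0n _ _) k0).
  rewrite integral_indic_box// -EFinM lee_fin.
  have LE : r = L * eta / 4 by rewrite /L; field; rewrite gt_eqF.
  rewrite LE /k (_ : (L - L * eta / 4) ^+ 2 = L ^+ 2 * (1 - eta / 4) ^+ 2); last by field.
  have L2 : 0 < L ^+ 2 by rewrite exprn_gt0.
  rewrite (_ : (1 - 2 * (eta / 4)) * (4 * (L ^+ 2 * (1 - eta / 4) ^+ 2)) =
    ((1 - eta / 2) * (1 - eta / 4) ^+ 2) * (4 * L ^+ 2)); last by field.
  apply: ler_wpM2r; first lra.
  have : 0 <= (1 - eta / 2) by lra.
  have := sqr_ge0 (eta / 4); nra.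
apply: ge0_le_integral => //.
- by move=> x _; rewrite lee_fin mulr_ge0.
- apply/measurable_EFinP; apply: measurable_funM; first exact: measurable_cst.
  exact: measurable_indic_box.
- apply: (@measurable_fun_fubini_tonelli_F _ _ (RT * RT)%type (RT * RT)%type R leb2 _ mH).
  by move=> p; rewrite lee_fin.
move=> x _; have [hx|hx] := pselect (box L (L - r) x); last first.
  have -> : \1_(box L (L - r)) x = 0 :> R by rewrite indicE (memNset hx).
  rewrite mulr0.
  by apply: integral_ge0 => y _; rewrite lee_fin.
have hB : box L L x by move: hx => [h1 h2]; split; lra.
have -> : \1_(box L (L - r)) x = 1 :> R by rewrite indicE (mem_set hx).
have h1 : \1_(box L L) x = 1 :> R by rewrite indicE (mem_set hB).
rewrite mulr1; apply: le_trans (greenPi_inner e4 r0 rL hr hx) _.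
apply: lexx_eq; apply: eq_integral => y _.
by rewrite h1 mul1r.
Qed.

End KernelEstimates.

(** * Quadratic form of a symmetric kernel *)

Section KernelForm.
Context d (T : measurableType d) (R : realType).
Variable m : {sigma_finite_measure set T -> \bar R}.
Variable H : T -> T -> R.
Hypothesis H_ge0 : forall x y, 0 <= H x y.
Hypothesis H_sym : forall x y, H x y = H y x.
Hypothesis measurable_H : measurable_fun setT (fun p : T * T => H p.1 p.2).
Implicit Types f g : T -> R.

Definition nonneg_mfun : set (T -> R) :=
  [set f : T -> R | measurable_fun setT f /\ forall x, 0 <= f x].
Local Notation nn := nonneg_mfun.

Definition pot g x : \bar R := nint m (fun y => H x y * g y).
Definition eform f g : \bar R := (\int[m]_x ((f x)%:E * pot g x))%E.

Lemma measurable_pair1 (x : T) : measurable_fun setT (fun y : T => (x, y)).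
Proof. by apply: measurable_fun_pair; [exact: measurable_cst|exact: measurable_id]. Qed.

Lemma measurable_section x : measurable_fun setT (H x).
Proof.
exact: (measurableT_comp measurable_H (measurable_pair1 x)).
Qed.

Lemma nn_patch f (A : set T) : measurable A -> nn f -> nn (fun x => f x * \1_A x).
Proof.
move=> mA [mf f0]; split; first exact: measurable_funM.
by move=> x; rewrite mulr_ge0.
Qed.

Lemma nnM f g : nn f -> nn g -> nn (fun x => f x * g x).
Proof.
by move=> [mf f0] [mg g0]; split => [|x]; [exact: measurable_funM|exact: mulr_ge0].
Qed.

Lemma nnD f g : nn f -> nn g -> nn (fun x => f x + g x).
Proof.
by move=> [mf f0] [mg g0]; split => [|x]; [exact: measurable_funD|exact: addr_ge0].
Qed.

Lemma nnZ c f : 0 <= c -> nn f -> nn (fun x => c * f x).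
Proof.
by move=> c0 [mf f0]; split => [|x]; [exact: measurable_funM|exact: mulr_ge0].
Qed.

Lemma pot_integrand g x : nn g -> nn (fun y => H x y * g y).
Proof. by move=> ng; apply: nnM => //; split => //; exact: measurable_section. Qed.

Lemma pot_ge0 g x : nn g -> (0 <= pot g x)%E.
Proof. by move=> /(pot_integrand x)[_ h]; exact: nint_ge0. Qed.

Lemma measurable_pot g : nn g -> measurable_fun setT (pot g).
Proof.
move=> [mg g0].
apply: (@measurable_fun_fubini_tonelli_F _ _ T T R m (fun p => (H p.1 p.2 * g p.2)%:E)).
  apply/measurable_EFinP; apply: measurable_funM => //.
  exact: (measurableT_comp mg measurable_snd).
by move=> p; rewrite lee_fin mulr_ge0.
Qed.

Lemma mul_pot_ge0 f g x : nn f -> nn g -> (0 <= (f x)%:E * pot g x)%E.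
Proof. by move=> [_ f0] ng; apply: mule_ge0; [rewrite lee_fin|exact: pot_ge0]. Qed.

Lemma measurable_mul_pot f g : nn f -> nn g -> measurable_fun setT (fun x => (f x)%:E * pot g x)%E.
Proof.
move=> [mf _] ng; apply: emeasurable_funM; [exact/measurable_EFinP|exact: measurable_pot].
Qed.

Lemma eform_ge0 f g : nn f -> nn g -> (0 <= eform f g)%E.
Proof. by move=> nf ng; apply: integral_ge0 => x _; exact: mul_pot_ge0. Qed.

Lemma eformE f g : nn f -> nn g ->
  eform f g = (\int[m]_x \int[m]_y (f x * H x y * g y)%:E)%E.
Proof.
move=> [mf f0] ng; apply: eq_integral => x _.
have [mh h0] := pot_integrand x ng.
rewrite /pot -nintZ//; by apply: eq_nint => y; rewrite mulrA.
Qed.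

Let mfHg f g : nn f -> nn g ->
  measurable_fun setT (fun p : T * T => (f p.1 * H p.1 p.2 * g p.2)%:E).
Proof.
move=> [mf _] [mg _]; apply/measurable_EFinP; apply: measurable_funM.
  by apply: measurable_funM => //; exact: (measurableT_comp mf measurable_fst).
exact: (measurableT_comp mg measurable_snd).
Qed.

Lemma eformC f g : nn f -> nn g -> eform f g = eform g f.
Proof.
move=> nf ng; rewrite (eformE nf ng) (eformE ng nf).
have := @fubini_tonelli _ _ T T R m m _ (mfHg nf ng).
move=> /= ->; last by move=> p; rewrite lee_fin !mulr_ge0// ?nf.2 ?ng.2.
apply: eq_integral => y _; apply: eq_integral => x _; congr EFin.
by rewrite (H_sym x y); ring.
Qed.

Lemma potD f g x : nn f -> nn g -> pot (fun y => f y + g y) x = (pot f x + pot g x)%E.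
Proof.
move=> nf ng; have [mf f0] := pot_integrand x nf; have [mg g0] := pot_integrand x ng.
by rewrite /pot -nintD//; apply: eq_nint => y; rewrite mulrDr.
Qed.

Lemma potZ c f x : 0 <= c -> nn f -> pot (fun y => c * f y) x = (c%:E * pot f x)%E.
Proof.
move=> c0 nf; have [mf f0] := pot_integrand x nf.
by rewrite /pot -nintZ//; apply: eq_nint => y; rewrite mulrCA.
Qed.

Lemma eformDr f g k : nn f -> nn g -> nn k ->
  eform k (fun y => f y + g y) = (eform k f + eform k g)%E.
Proof.
move=> nf ng nk; rewrite /eform -ge0_integralD//.
- apply: eq_integral => x _; rewrite potD// ge0_muleDr//; exact: pot_ge0.
- by move=> x _; exact: mul_pot_ge0.
- exact: measurable_mul_pot.
- by move=> x _; exact: mul_pot_ge0.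
- exact: measurable_mul_pot.
Qed.

Lemma eformDl f g k : nn f -> nn g -> nn k ->
  eform (fun y => f y + g y) k = (eform f k + eform g k)%E.
Proof.
by move=> nf ng nk; rewrite eformC ?eformDr 1?(eformC nk nf) 1?(eformC nk ng)//; exact: nnD.
Qed.

Lemma eformZr c f k : 0 <= c -> nn f -> nn k ->
  eform k (fun y => c * f y) = (c%:E * eform k f)%E.
Proof.
move=> c0 nf nk; rewrite /eform -ge0_integralZl_EFin//.
- by apply: eq_integral => x _; rewrite potZ// muleCA.
- by move=> x _; exact: mul_pot_ge0.
- exact: measurable_mul_pot.
Qed.

Lemma eformZl c f k : 0 <= c -> nn f -> nn k ->
  eform (fun y => c * f y) k = (c%:E * eform f k)%E.
Proof.
by move=> c0 nf nk; rewrite eformC ?eformZr 1?(eformC nk nf)//; exact: nnZ.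
Qed.

(* Schur's test, from f(x)g(y) <= (f(x)^2 + g(y)^2)/2. *)
Lemma schur_test (K : T -> T -> \bar R) (c : R) f g : 0 <= c ->
  measurable_fun setT (fun p : T * T => K p.1 p.2) ->
  (forall x y, 0 <= K x y)%E -> (forall x y, K x y = K y x) ->
  (forall x, \int[m]_y K x y <= c%:E)%E -> nn f -> nn g ->
  (\int[m]_x \int[m]_y ((f x * g y)%:E * K x y) <=
   (c / 2)%:E * (nint m (fun x => f x ^+ 2)%R + nint m (fun x => g x ^+ 2)%R))%E.
Proof.
move=> c0 mK K0 Ksym Kc [mf f0] [mg g0].
have mK1 x : measurable_fun setT (K x).
  exact: (measurableT_comp mK (measurable_pair1 x)).
have c20 : 0 <= c / 2 by rewrite divr_ge0.
pose F1 (p : T * T) := ((f p.1 ^+ 2 / 2)%:E * K p.1 p.2)%E.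
pose F2 (p : T * T) := ((g p.2 ^+ 2 / 2)%:E * K p.1 p.2)%E.
have F10 p : (0 <= F1 p)%E by rewrite mule_ge0// lee_fin divr_ge0// sqr_ge0.
have F20 p : (0 <= F2 p)%E by rewrite mule_ge0// lee_fin divr_ge0// sqr_ge0.
have mF1 : measurable_fun setT F1.
  apply: emeasurable_funM => //; apply/measurable_EFinP; apply: measurable_funM => //.
  by apply: measurable_funX; exact: (measurableT_comp mf measurable_fst).
have mF2 : measurable_fun setT F2.
  apply: emeasurable_funM => //; apply/measurable_EFinP; apply: measurable_funM => //.
  by apply: measurable_funX; exact: (measurableT_comp mg measurable_snd).
have mF1x x : measurable_fun setT (fun y => F1 (x, y)).
  exact: (measurableT_comp mF1 (measurable_pair1 x)).
have mF2x x : measurable_fun setT (fun y => F2 (x, y)).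
  exact: (measurableT_comp mF2 (measurable_pair1 x)).
have bnd (k : T -> R) : measurable_fun setT k ->
    (\int[m]_x \int[m]_y ((k x ^+ 2 / 2)%:E * K x y) <=
     (c / 2)%:E * nint m (fun x => k x ^+ 2)%R)%E.
  move=> mk; rewrite -nintZ//; last 2 first.
  - exact: measurable_funX.
  - by move=> x; exact: sqr_ge0.
  have mkK : measurable_fun setT (fun p : T * T => ((k p.1 ^+ 2 / 2)%:E * K p.1 p.2)%E).
    apply: emeasurable_funM => //; apply/measurable_EFinP; apply: measurable_funM => //.
    by apply: measurable_funX; exact: (measurableT_comp mk measurable_fst).
  have kK0 x y : (0 <= (k x ^+ 2 / 2)%:E * K x y)%E.
    by rewrite mule_ge0// lee_fin divr_ge0// sqr_ge0.
  apply: ge0_le_integral => //.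
  - by move=> x _; apply: integral_ge0.
  - exact: (@measurable_fun_fubini_tonelli_F _ _ T T R m _ mkK).
  - by apply/measurable_EFinP; apply: measurable_funM => //; exact: measurable_funX.
  move=> x _; rewrite ge0_integralZl_EFin ?divr_ge0 ?sqr_ge0//.
  rewrite (_ : c / 2 * k x ^+ 2 = k x ^+ 2 / 2 * c); last by ring.
  by rewrite (EFinM (k x ^+ 2 / 2)); apply: lee_wpmul2l => //; rewrite lee_fin divr_ge0// sqr_ge0.
apply: (@le_trans _ _ (\int[m]_x \int[m]_y (F1 (x, y) + F2 (x, y)))%E).
  have mfg : measurable_fun setT (fun p : T * T => ((f p.1 * g p.2)%:E * K p.1 p.2)%E).
    apply: emeasurable_funM => //; apply/measurable_EFinP; apply: measurable_funM.
      exact: (measurableT_comp mf measurable_fst).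
    exact: (measurableT_comp mg measurable_snd).
  have mF12 : measurable_fun setT (fun p => (F1 p + F2 p)%E) by exact: emeasurable_funD.
  have fg0 x y : (0 <= (f x * g y)%:E * K x y)%E by rewrite mule_ge0// lee_fin mulr_ge0.
  apply: ge0_le_integral => //.
  - by move=> x _; apply: integral_ge0.
  - exact: (@measurable_fun_fubini_tonelli_F _ _ T T R m _ mfg).
  - by apply: (@measurable_fun_fubini_tonelli_F _ _ T T R m _ mF12) => p; rewrite adde_ge0.
  move=> x _; apply: ge0_le_integral => //.
  - exact: (measurableT_comp mfg (measurable_pair1 x)).
  - exact: emeasurable_funD.
  move=> y _; rewrite /F1 /F2/= -ge0_muleDl ?lee_fin ?divr_ge0 ?sqr_ge0//.
  apply: lee_wpmul2r => //; rewrite -EFinD lee_fin.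
  by have := sqr_ge0 (f x - g y); nra.
rewrite (_ : (\int[m]_x \int[m]_y (F1 (x, y) + F2 (x, y)) =
   \int[m]_x \int[m]_y F1 (x, y) + \int[m]_x \int[m]_y F2 (x, y))%E); last first.
  under eq_integral do rewrite ge0_integralD//.
  rewrite ge0_integralD//.
  - by move=> x _; apply: integral_ge0.
  - exact: (@measurable_fun_fubini_tonelli_F _ _ T T R m _ mF1).
  - by move=> x _; apply: integral_ge0.
  - exact: (@measurable_fun_fubini_tonelli_F _ _ T T R m _ mF2).
rewrite ge0_muleDr; [|by apply: nint_ge0 => x; exact: sqr_ge0..].
rewrite -[X in (X + _)%E]/(\int[m]_x \int[m]_y ((f x ^+ 2 / 2)%:E * K x y))%E.
apply: leeD; first exact: (bnd f mf).
have E2 := @fubini_tonelli _ _ T T R m m F2 mF2 F20.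
apply: le_trans (lexx_eq E2) _; apply: le_trans (bnd g mg).
apply: lexx_eq; apply: eq_integral => y _.
by apply: eq_integral => x _; rewrite /F2 /= Ksym.
Qed.

Hypothesis H_int : forall x, (nint m (H x) <= 1)%E.

Lemma eform_le f g : nn f -> nn g ->
  (eform f g <= (2^-1)%:E * (nint m (fun x => f x ^+ 2)%R + nint m (fun x => g x ^+ 2)%R))%E.
Proof.
move=> nf ng; rewrite eformE//.
have := @schur_test (fun x y => (H x y)%:E) 1 f g ler01.
rewrite mul1r => h; apply: le_trans (h _ _ _ _ nf ng) => //.
- apply: lexx_eq; apply: eq_integral => x _.
  by apply: eq_integral => y _; rewrite -EFinM; congr EFin; ring.
- exact/measurable_EFinP.
- by move=> x y; rewrite H_sym.
Qed.

Variable C2 : R.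
Hypothesis H_sqr : forall x, (nint m (fun y => H x y ^+ 2)%R <= C2%:E)%E.

Lemma L2_section x : L2fun m (H x).
Proof.
split; first exact: measurable_section.
by apply: le_lt_trans (H_sqr x) _; rewrite ltry.
Qed.

Lemma potE g x : nn g -> L2fun m g -> pot g x = (L2ip m (H x) g)%:E.
Proof. by move=> ng Lg; rewrite L2ipE//; exact: L2_section. Qed.

Lemma L2_section_le x : L2ip m (H x) (H x) <= C2.
Proof.
rewrite -lee_fin L2ipE; [|exact: L2_section..].
by apply: le_trans (H_sqr x); apply/lexx_eq/eq_nint.
Qed.

End KernelForm.

(** * Maximal energy at fixed moment *)

(** The gap between the two sides is i (2 a q - i q - K a^3 / 3). As i <= a and q >= K a^2 / 2, the
    bracket is at least K a^3 / 2 - K a^3 / 3. *)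
Lemma rescaling_gain (R : realFieldType) (K a q i : R) : 0 <= i -> i <= a -> 0 < K -> 0 < a ->
  K * a * a / 2 <= q -> (a - i) ^+ 2 * q <= a ^+ 2 * (q - K * a / 3 * i).
Proof.
move=> i0 ia K0 a0 hq.
have : 0 <= i * (2 * q * a - K * a * a * a / 3 - q * i).
  apply: mulr_ge0 => //.
  have q0 : 0 <= q by apply: le_trans hq; rewrite !mulr_ge0// ltW.
  have h1 := ler_wpM2l q0 ia.
  have h2 : (K * a * a / 2) * a <= q * a by apply: ler_wpM2r => //; exact: ltW.
  have h3 : 0 < K * a * a * a by rewrite !mulr_gt0.
  lra.
by rewrite -subr_ge0 => h; rewrite -subr_ge0; move: h; congr (is_true (0 <= _)); field.
Qed.

Section Functional.
Context d (T : measurableType d) (R : realType).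
Variable m : {sigma_finite_measure set T -> \bar R}.
Variable H : T -> T -> R.
Hypothesis H_ge0 : forall x y, 0 <= H x y.
Hypothesis H_sym : forall x y, H x y = H y x.
Hypothesis measurable_H : measurable_fun setT (fun p : T * T => H p.1 p.2).
Hypothesis H_int : forall x, (nint m (H x) <= 1)%E.
Variables (h : T -> R) (D : set T).
Hypothesis measurable_h : measurable_fun setT h.
Hypothesis h_ge0 : forall x, 0 <= h x.
Implicit Types f g : T -> R.
Local Notation nn := (@nonneg_mfun d T R).
Local Notation ip := (L2ip m).
Local Notation eform := (eform m H).
Local Notation pot := (pot m H).

(** Functions are defined on all of [T] and vanish off [D], so that no integral has to be restricted
    to [D]. *)
Definition admissible : set (T -> R) := [set f : T -> R |
  [/\ nn f, forall x, ~ D x -> f x = 0, L2fun m f &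
      (nint m (fun x => h x * f x)%R < +oo)%E]].

Definition moment f : R := fine (nint m (fun x => h x * f x)).
Definition form f g : R := fine (eform f g).
Definition patch1 f (A : set T) : T -> R := fun x => f x * \1_A x.

Lemma adm_nn f : admissible f -> nn f. Proof. by case. Qed.
Lemma adm_L2 f : admissible f -> L2fun m f. Proof. by case. Qed.

Lemma nn_h : nn h. Proof. by []. Qed.

Lemma momentE f : admissible f -> (moment f)%:E = nint m (fun x => h x * f x).
Proof.
move=> [nf _ _ fin]; rewrite fineK// ge0_fin_numE//.
by apply: nint_ge0 => x; exact: (nnM nn_h nf).2.
Qed.

Lemma moment_ge0 f : nn f -> 0 <= moment f.
Proof. by move=> nf; apply/fine_ge0/nint_ge0 => x; exact: (nnM nn_h nf).2. Qed.

Lemma nint_sqr f : L2fun m f -> nint m (fun x => f x ^+ 2) = (ip f f)%:E.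
Proof. by move=> Lf; rewrite L2ipE//; apply: eq_nint. Qed.

Lemma eform_le_ip f g : nn f -> nn g -> L2fun m f -> L2fun m g ->
  (eform f g <= (2^-1 * (ip f f + ip g g))%:E)%E.
Proof.
move=> nf ng Lf Lg; apply: le_trans (eform_le H_ge0 H_sym measurable_H H_int nf ng) _.
by rewrite !nint_sqr.
Qed.

Lemma formE f g : admissible f -> admissible g -> (form f g)%:E = eform f g.
Proof.
move=> [nf _ Lf _] [ng _ Lg _]; rewrite fineK// ge0_fin_numE; last exact: eform_ge0.
by apply: le_lt_trans (eform_le_ip nf ng Lf Lg) _; rewrite ltry.
Qed.

Lemma form_ge0 f g : nn f -> nn g -> 0 <= form f g.
Proof. by move=> nf ng; apply/fine_ge0/eform_ge0. Qed.

Lemma adm_scale c f : 0 <= c -> admissible f -> admissible (fun x => c * f x).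
Proof.
move=> c0 [nf fD Lf fin]; split.
- exact: nnZ.
- by move=> x /fD ->; rewrite mulr0.
- by have := L2_lin c Lf (L2fun0 m); rewrite addr0.
- rewrite (@eq_nint _ _ _ _ _ (fun x => c * (h x * f x))); last by move=> x; rewrite mulrCA.
  rewrite nintZ//; [|exact: (nnM nn_h nf).1|exact: (nnM nn_h nf).2].
  by rewrite lte_mul_pinfty// ?lee_fin.
Qed.

Lemma adm_mul f (t : T -> R) : measurable_fun setT t -> (forall x, 0 <= t x <= 1) ->
  admissible f -> admissible (fun x => f x * t x).
Proof.
move=> mt t01 [[mf f0] fD Lf fin].
have t0 x : 0 <= t x by have /andP[] := t01 x.
have ft x : f x * t x <= f x by apply: ler_piMr => //; have /andP[] := t01 x.
have nft : nn (fun x => f x * t x) by split => [|x]; [exact: measurable_funM|exact: mulr_ge0].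
split => //.
- by move=> x /fD ->; rewrite mul0r.
- by apply: (L2_le nft.1 Lf) => x; rewrite ler_sqr ?nnegrE ?nft.2.
- apply: le_lt_trans fin; apply: le_nint.
  + exact: (nnM nn_h nft).1.
  + exact: measurable_funM.
  + exact: (nnM nn_h nft).2.
  + by move=> x; apply: ler_wpM2l.
Qed.

Lemma indic01 (A : set T) x : 0 <= (\1_A x : R) <= 1.
Proof. by rewrite indicE; case: (_ \in _); rewrite ?lexx ?ler01. Qed.

Lemma adm_patch f A : measurable A -> admissible f -> admissible (patch1 f A).
Proof.
by move=> mA; apply: adm_mul; [exact: measurable_indic|exact: indic01].
Qed.

Lemma patch1_split f A : f = (fun x => patch1 f A x + patch1 f (~` A) x).
Proof.
apply/funext => x; rewrite /patch1 -mulrDr !indicE in_setC.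
by case: (_ \in _); rewrite ?addr0 ?add0r mulr1.
Qed.

Lemma moment_scale c f : 0 <= c -> nn f -> moment (fun x => c * f x) = c * moment f.
Proof.
move=> c0 nf; rewrite /moment (@eq_nint _ _ _ _ _ (fun x => c * (h x * f x))); last first.
  by move=> x; rewrite mulrCA.
have [mhf hf0] := nnM nn_h nf.
rewrite nintZ//; have := nint_ge0 m hf0; case: (nint m _) => [r| |]//= _.
have [->|cn0] := eqVneq c 0; first by rewrite mul0e mul0r.
by rewrite gt0_muley ?lte_fin ?lt_neqAle 1?eq_sym ?cn0//= mulr0.
Qed.

Lemma momentD f g : admissible f -> admissible g ->
  moment (fun x => f x + g x) = moment f + moment g.
Proof.
move=> af ag; have [m1 f0] := nnM nn_h (adm_nn af); have [m2 g0] := nnM nn_h (adm_nn ag).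
rewrite /moment (@eq_nint _ _ _ _ _ (fun x => h x * f x + h x * g x)); last first.
  by move=> x; rewrite mulrDr.
by rewrite nintD// -!momentE.
Qed.

Lemma moment_patch f A : measurable A -> admissible f ->
  moment f = moment (patch1 f A) + moment (patch1 f (~` A)).
Proof.
move=> mA af; rewrite {1}(patch1_split f A) momentD//.
  exact: adm_patch.
by apply: adm_patch => //; exact: measurableC.
Qed.

Lemma ip_patch f A : measurable A -> L2fun m f -> admissible f ->
  ip f f = ip (patch1 f A) (patch1 f A) + ip (patch1 f (~` A)) (patch1 f (~` A)).
Proof.
move=> mA Lf af; have mAC := measurableC mA.
have a1 := adm_patch mA af; have a2 := adm_patch mAC af.
have [m1 p1] := nnM (adm_nn a1) (adm_nn a1); have [m2 p2] := nnM (adm_nn a2) (adm_nn a2).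
apply: EFin_inj; rewrite EFinD !L2ipE; [|by apply: adm_L2..].
rewrite -nintD//; apply: eq_nint => x; rewrite /patch1 !indicE in_setC.
by case: (_ \in _); rewrite /= ?mulr0 ?mulr1 ?addr0 ?add0r.
Qed.

Lemma formC f g : nn f -> nn g -> form f g = form g f.
Proof. by move=> nf ng; rewrite /form eformC. Qed.

Lemma formDr f g k : admissible f -> admissible g -> admissible k ->
  form k (fun x => f x + g x) = form k f + form k g.
Proof.
move=> af ag ak; rewrite /form eformDr//; [|exact: adm_nn..].
by rewrite -!formE.
Qed.

Lemma formDl f g k : admissible f -> admissible g -> admissible k ->
  form (fun x => f x + g x) k = form f k + form g k.
Proof.
move=> af ag ak; rewrite /form eformDl//; [|exact: adm_nn..].
by rewrite -!formE.
Qed.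

Lemma form_scale c f : 0 <= c -> admissible f ->
  form (fun x => c * f x) (fun x => c * f x) = c ^+ 2 * form f f.
Proof.
move=> c0 af; have nf := adm_nn af.
rewrite /form eformZr// ?eformZl//; last exact: nnZ.
by rewrite -formE//= mulrA.
Qed.

Lemma ip_scale c f : L2fun m f -> ip (fun x => c * f x) (fun x => c * f x) = c ^+ 2 * ip f f.
Proof.
move=> Lf; have L0 := L2fun0 m.
have E : (fun x => c * f x) = c *: f + (0 : T -> R) by rewrite addr0.
have Lc : L2fun m (fun x => c * f x) by rewrite E; exact: L2_lin.
have ip0 g : ip 0 g = 0.
  rewrite /L2ip (@eq_nint _ _ _ _ _ (fun=> 0)); last by move=> x; exact: mul0r.
  by rewrite /nint integral0.
by rewrite {1}E L2ip_lin// ip0 addr0 L2ipC E L2ip_lin// ip0 addr0 mulrA.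
Qed.

Variable lam : R.
Hypothesis lam1 : 1 < lam.

Lemma lam_gt0 : 0 < lam. Proof. exact: lt_trans lam1. Qed.

Definition energyQ f : R := form f f / 2 - ip f f / (2 * lam).

Lemma energyQ_scale c f : 0 <= c -> admissible f ->
  energyQ (fun x => c * f x) = c ^+ 2 * energyQ f.
Proof.
by move=> c0 af; rewrite /energyQ form_scale// ip_scale; [ring|exact: adm_L2].
Qed.

(** Only the pairing [form (patch1 f A) f] enters the bracket with a positive sign, so deleting [f]
    on [A] costs at most the integral over [A] of [f] times its own potential. *)
Lemma energyQ_patch f A : measurable A -> admissible f ->
  energyQ f = energyQ (patch1 f (~` A)) +
    (form (patch1 f A) f - form (patch1 f A) (patch1 f A) / 2
     - ip (patch1 f A) (patch1 f A) / (2 * lam)).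
Proof.
move=> mA af; have mAC := measurableC mA.
have a1 := adm_patch mA af; have a2 := adm_patch mAC af.
rewrite /energyQ (ip_patch mA (adm_L2 af) af).
have E1 : form f f = form (patch1 f A) f + form (patch1 f (~` A)) f.
  by rewrite {1}(patch1_split f A) formDl.
have E2 k : admissible k -> form k f = form k (patch1 f A) + form k (patch1 f (~` A)).
  by move=> ak; rewrite {1}(patch1_split f A) formDr.
have E3 := formC (adm_nn a1) (adm_nn a2).
rewrite E1 (E2 _ a1) (E2 _ a2) E3.
move: (form (patch1 f A) (patch1 f A)) (form (patch1 f (~` A)) (patch1 f A)) => p r.
move: (form (patch1 f (~` A)) (patch1 f (~` A))) => s.
rewrite (mulrDl _ _ (2 * lam)^-1); set u := ip (patch1 f A) _ / _; set v := ip _ _ / _.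
by move: u v => u v; field.
Qed.

Lemma measurable_double f (hd : T -> T -> \bar R) : nn f ->
  measurable_fun setT (fun p : T * T => hd p.1 p.2) -> (forall x y, 0 <= hd x y)%E ->
  measurable_fun setT (fun x => \int[m]_y ((f x * f y)%:E * hd x y))%E.
Proof.
move=> [mf f0] mhd hd0.
apply: (@measurable_fun_fubini_tonelli_F _ _ T T R m
  (fun p => ((f p.1 * f p.2)%:E * hd p.1 p.2)%E)) => [|p]; last first.
  by rewrite mule_ge0// lee_fin mulr_ge0.
apply: emeasurable_funM => //; apply/measurable_EFinP; apply: measurable_funM.
  exact: (measurableT_comp mf measurable_fst).
exact: (measurableT_comp mf measurable_snd).
Qed.

(** Schur's test controls the singular part by the L^2 norm; the remainder, proportional to [h],
    integrates against [f] to a moment. *)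
Lemma form_head (hd : T -> T -> \bar R) (eps c : R) f : 0 <= eps -> 0 <= c ->
  measurable_fun setT (fun p : T * T => hd p.1 p.2) ->
  (forall x y, 0 <= hd x y)%E -> (forall x y, hd x y = hd y x) ->
  (forall x, \int[m]_y hd x y <= eps%:E)%E -> admissible f ->
  (forall x, D x -> (pot f x <= \int[m]_y ((f y)%:E * hd x y) + (h x * c)%:E)%E) ->
  form f f <= eps * ip f f + c * moment f.
Proof.
move=> e0 c0 mhd hd0 hds hdi af hp.
have [nf fD Lf _] := af; have [mf f0] := nf; have [mhf hf0] := nnM nn_h nf.
have S := schur_test e0 mhd hd0 hds hdi nf nf.
rewrite !nint_sqr// in S.
have fhd0 x y : (0 <= (f x * f y)%:E * hd x y)%E by rewrite mule_ge0// lee_fin mulr_ge0.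
have mF := measurable_double nf mhd hd0.
rewrite -lee_fin formE//.
apply: (@le_trans _ _ (\int[m]_x (\int[m]_y ((f x * f y)%:E * hd x y) +
    (c * (h x * f x))%:E))%E).
  apply: ge0_le_integral => //.
  - by move=> x _; exact: mul_pot_ge0.
  - exact: measurable_mul_pot.
  - apply: emeasurable_funD => //; apply/measurable_EFinP.
    exact: measurable_funM.
  move=> x _; have [Dx|Dx] := pselect (D x); last first.
    rewrite fD// mul0e adde_ge0//; last by rewrite mulr0 mulr0.
    by apply: integral_ge0 => y _; rewrite mul0r mul0e.
  apply: le_trans (lee_wpmul2l _ (hp x Dx)) _; first by rewrite lee_fin.
  rewrite ge0_muleDr; last 2 first.
  - by apply: integral_ge0 => y _; rewrite mule_ge0 ?lee_fin.
  - by rewrite lee_fin mulr_ge0.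
  apply: leeD; last by rewrite -EFinM lee_fin mulrC -mulrA mulrCA.
  have mx : measurable_fun setT (fun y => (f y)%:E * hd x y)%E.
    apply: emeasurable_funM; first exact/measurable_EFinP.
    exact: (measurableT_comp mhd (measurable_pair1 x)).
  rewrite -ge0_integralZl_EFin//; last by move=> y _; rewrite mule_ge0 ?lee_fin.
  by under eq_integral do rewrite muleA -EFinM.
rewrite ge0_integralD//; last 3 first.
- by move=> x _; apply: integral_ge0.
- by move=> x _; rewrite lee_fin mulr_ge0.
- by apply/measurable_EFinP; exact: measurable_funM.
rewrite EFinD; apply: leeD.
  by apply: le_trans S _; rewrite -EFinD -EFinM lee_fin; lra.
by rewrite -/(nint m (fun x => c * (h x * f x))) nintZ// EFinM momentE.
Qed.

(** The weight [t] allows two uses: a constant for the global bound, and a constant on a window plus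
    a small number elsewhere for nonvanishing. *)
Lemma pot_head (hd : T -> T -> \bar R) f (t : T -> R) x : admissible f ->
  measurable_fun setT (fun p : T * T => hd p.1 p.2) ->
  (forall x y, 0 <= hd x y)%E -> nn t -> D x ->
  (forall y, D y -> ((H x y)%:E <= hd x y + (h x * (h y * t y))%:E)%E) ->
  (pot f x <= \int[m]_y ((f y)%:E * hd x y) +
     (h x)%:E * nint m (fun y => h y * f y * t y)%R)%E.
Proof.
move=> [nf fD Lf _] mhd hd0 nt Dx hH; have [mf f0] := nf.
have [mhft hft0] := nnM (nnM nn_h nf) nt.
have mx : measurable_fun setT (fun y => (f y)%:E * hd x y)%E.
  apply: emeasurable_funM; first exact/measurable_EFinP.
  exact: (measurableT_comp mhd (measurable_pair1 x)).
have [mHf Hf0] := pot_integrand H_ge0 measurable_H x nf.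
rewrite -nintZ// /nint -ge0_integralD//; last 3 first.
- by move=> y _; rewrite mule_ge0 ?lee_fin.
- by move=> y _; rewrite lee_fin mulr_ge0.
- by apply/measurable_EFinP; exact: measurable_funM.
apply: ge0_le_integral => //.
- by move=> y _; rewrite lee_fin.
- exact/measurable_EFinP.
- by apply: emeasurable_funD => //; apply/measurable_EFinP; exact: measurable_funM.
move=> y _; have [Dy|Dy] := pselect (D y); last first.
  by rewrite fD// !mulr0 mul0r mulr0 mul0e adde0.
rewrite mulrC EFinM; apply: le_trans (lee_wpmul2l _ (hH y Dy)) _.
  by rewrite lee_fin.
rewrite ge0_muleDr//; last by rewrite lee_fin !mulr_ge0 ?nt.2.
apply: leeD => //; rewrite -EFinM lee_fin; apply: lexx_eq; ring.
Qed.

(** [B x L] plays the role of a window of size [L] at [x]. Outside it the kernel without its head is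
    negligible relative to [h x * h y]. *)
Definition far_small (B : T -> R -> set T) (hd : T -> T -> \bar R) :=
  forall eta : R, 0 < eta -> exists L, forall x y, D x -> D y -> ~ B x L y ->
    ((H x y)%:E <= hd x y + (h x * (h y * eta))%:E)%E.

Variable B : T -> R -> set T.
Hypothesis measurable_B : forall x L, measurable (B x L).

Hypothesis H_head : forall eps : R, 0 < eps -> exists (hd : T -> T -> \bar R) (C : R),
  [/\ [/\ measurable_fun setT (fun p : T * T => hd p.1 p.2),
      forall x y, (0 <= hd x y)%E, forall x y, hd x y = hd y x &
      forall x, (\int[m]_y hd x y <= eps%:E)%E],
      0 < C,
      forall x y, D x -> D y -> ((H x y)%:E <= hd x y + (h x * (h y * C))%:E)%E &
      far_small B hd].

Lemma form_le_moment (eps : R) : 0 < eps -> exists2 C : R, 0 < C &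
  forall f, admissible f -> form f f <= eps * ip f f + C * moment f ^+ 2.
Proof.
move=> e0; have [hd [C [[mhd hd0 hds hdi] C0 hH _]]] := H_head e0.
exists C => // f af; have [nf _ _ _] := af.
have m0 := moment_ge0 nf; have [mhf hf0] := nnM nn_h nf.
have := @form_head hd eps (C * moment f) f (ltW e0).
rewrite expr2 mulrA; apply => //; first by rewrite mulr_ge0// ltW.
move=> x Dx.
have nC : nn (fun=> C) by split => // y; exact: ltW.
apply: le_trans (pot_head af mhd hd0 nC Dx (fun y Dy => hH x y Dx Dy)) _.
apply: leeD => //.
rewrite (@eq_nint _ _ _ _ _ (fun y => C * (h y * f y))); last by move=> y; rewrite mulrC.
by rewrite nintZ ?(ltW C0)// -momentE// -!EFinM.
Qed.

(** With [eps = (2 * lam)^-1] the singular part uses up half of the L^2 penalty. The other half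
    remains on the right, so an energy bounded below also bounds the L^2 norm. *)
Lemma energyQ_moment : exists2 C : R, 0 < C & forall f, admissible f ->
  energyQ f <= C * moment f ^+ 2 - ip f f / (4 * lam).
Proof.
have l0 := lam_gt0.
have [|C C0 hC] := @form_le_moment ((2 * lam)^-1); first by rewrite invr_gt0 mulr_gt0.
exists C => // f af; rewrite /energyQ; have := hC f af.
have m0 : 0 <= C * moment f ^+ 2 by rewrite mulr_ge0 ?sqr_ge0// ltW.
have -> : (2 * lam)^-1 * ip f f = ip f f / (2 * lam) by rewrite mulrC.
have -> : ip f f / (4 * lam) = ip f f / (2 * lam) / 2 by field; rewrite gt_eqF.
by move: (ip f f / (2 * lam)) => w; lra.
Qed.

Hypothesis H_test : forall eta : R, 0 < eta -> eta <= 1 -> exists f,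
  [/\ admissible f, 0 < ip f f & (1 - eta) * ip f f <= form f f].

(** The constraint [<= 1] instead of an equality admits the zero function, which makes the set
    visibly nonempty; competitors of prescribed moment are recovered by scaling. *)
Definition maxQ : R := sup [set energyQ f | f in [set f | admissible f /\ moment f <= 1]].

Lemma maxQ_has_sup :
  has_sup [set energyQ f | f in [set f | admissible f /\ moment f <= 1]].
Proof.
have l0 := lam_gt0.
split.
  have [f [af _ _]] := H_test ltr01 (lexx 1).
  exists (energyQ (fun x => 0 * f x)), (fun x => 0 * f x) => //; split.
    exact: adm_scale.
  by rewrite moment_scale ?mul0r ?ler01//; exact: adm_nn.
have [C C0 hC] := energyQ_moment.
exists C => _ [f [af mf] <-]; apply: le_trans (hC f af) _.
have m0 := moment_ge0 (adm_nn af).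
have : C * moment f ^+ 2 <= C.
  by rewrite ler_piMr ?(ltW C0)// expr_le1.
have : 0 <= ip f f / (4 * lam) by rewrite divr_ge0 ?L2ip_ge0// mulr_ge0// ltW.
lra.
Qed.

(** Homogeneity, except at moment 0, where [energyQ_moment] shows that the energy is not
    positive. *)
Lemma energyQ_le_maxQ f : admissible f -> energyQ f <= maxQ * moment f ^+ 2.
Proof.
move=> af; have m0 := moment_ge0 (adm_nn af).
have [mf0|mfn0] := eqVneq (moment f) 0.
  have [C C0 hC] := energyQ_moment; apply: le_trans (hC f af) _.
  have l0 := lam_gt0.
  rewrite mf0 expr0n/= !mulr0 sub0r oppr_le0; apply: divr_ge0; first exact: L2ip_ge0.
  by apply: mulr_ge0; [|exact: ltW].
have mf : 0 < moment f by rewrite lt_neqAle eq_sym mfn0.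
have i0 : 0 <= (moment f)^-1 by rewrite invr_ge0.
have : energyQ (fun x => (moment f)^-1 * f x) <= maxQ.
  apply: ub_le_sup; first exact: maxQ_has_sup.2.
  exists (fun x => (moment f)^-1 * f x) => //; split; first exact: adm_scale.
  by rewrite moment_scale ?mulVf//; exact: adm_nn.
rewrite energyQ_scale// => hq.
rewrite mulrC -ler_pdivrMl ?exprn_gt0//; apply: le_trans hq.
by rewrite exprVn.
Qed.

Lemma maxQ_gt0 : 0 < maxQ.
Proof.
have l0 := lam_gt0.
(* Half of the gap below 1, so that [1 - eta - lam^-1] is still positive. *)
pose eta := (1 - lam^-1) / 2.
have il : lam^-1 < 1 by rewrite invf_lt1.
have il0 : 0 < lam^-1 by rewrite invr_gt0.
have e0 : 0 < eta by rewrite /eta; lra.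
have e1 : eta <= 1 by rewrite /eta; lra.
have [f [af n0 hf]] := H_test e0 e1.
have Q0 : 0 < energyQ f.
  have -> : energyQ f = (form f f - lam^-1 * ip f f) / 2.
    by rewrite /energyQ; field; rewrite gt_eqF.
  have : 0 < (1 - eta - lam^-1) * ip f f by rewrite mulr_gt0// /eta; lra.
  by move: (lam^-1 * ip f f) (lam^-1) hf => *; lra.
have h1 := lt_le_trans Q0 (energyQ_le_maxQ af).
rewrite ltNge; apply/negP => K0; move: h1; rewrite ltNge; apply/negP/negPn.
exact: mulr_le0_ge0 K0 (sqr_ge0 _).
Qed.

Lemma maxQ_approx (a : R) : 0 < a -> forall e, 0 < e -> exists f,
  [/\ admissible f, moment f = a & maxQ * a ^+ 2 - e < energyQ f].
Proof.
move=> a0 e e0; have a2 : 0 < a ^+ 2 by rewrite exprn_gt0.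
(* The bound by [maxQ] forces positive energy, hence positive moment, on the near-maximizer, which
   can then be rescaled to moment exactly [a]. *)
pose e' := Num.min (e / a ^+ 2) maxQ.
have e'0 : 0 < e' by rewrite lt_min divr_gt0//= maxQ_gt0.
have [_ [f [af mf] <-] hf] := sup_adherent e'0 maxQ_has_sup.
rewrite -/maxQ in hf.
have Q0 : 0 < energyQ f.
  apply: le_lt_trans hf; rewrite subr_ge0 /e' ge_min lexx orbT//.
have mf0 : 0 < moment f.
  have := energyQ_le_maxQ af; rewrite lt_neqAle moment_ge0 ?andbT; last exact: adm_nn.
  by case: eqVneq => [<-|//]; rewrite expr0n mulr0; lra.
pose c := a / moment f; have c0 : 0 <= c by rewrite divr_ge0 ?ltW.
exists (fun x => c * f x); split; first exact: adm_scale.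
  by rewrite moment_scale ?divfK ?gt_eqF//; exact: adm_nn.
rewrite energyQ_scale//.
have ac : a ^+ 2 <= c ^+ 2.
  rewrite ler_sqr ?nnegrE ?(ltW a0)// /c ler_pdivlMr// ler_piMr// ltW//.
have : e' <= e / a ^+ 2 by rewrite /e' ge_min lexx.
rewrite ler_pdivlMr// => h1.
apply: (@lt_le_trans _ _ (a ^+ 2 * energyQ f)); last by apply: ler_wpM2r => //; exact: ltW.
have : a ^+ 2 * (maxQ - e') < a ^+ 2 * energyQ f by rewrite ltr_pM2l.
by move: (a ^+ 2) h1 => s h1; nra.
Qed.

Hypothesis h_gt0 : forall x, D x -> 0 < h x.
Variables (bk : T -> T -> \bar R) (C3 : R).
Hypothesis C3_ge0 : 0 <= C3.
Hypothesis measurable_bk : measurable_fun setT (fun p : T * T => bk p.1 p.2).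
Hypothesis bk_ge0 : forall x y, (0 <= bk x y)%E.
Hypothesis bk_sym : forall x y, bk x y = bk y x.
Hypothesis bk_int : forall x, (\int[m]_y bk x y <= C3%:E)%E.
Hypothesis H_le_bk : forall x y, D x -> ((H x y)%:E <= (h x)%:E * bk x y)%E.

(** On [A] one has delta h(x) <= h(x) times the [bk]-potential of [f]. Dividing by [h x > 0] and
    integrating against [f] leaves delta times the mass on [A], below a quadratic form to which
    Schur's test applies. *)
Lemma mass_le f (delta : R) (A : set T) : 0 < delta -> admissible f -> measurable A ->
  (forall x, A x -> ((delta * h x)%:E <= pot f x)%E) ->
  (nint m (patch1 f A) <= (delta^-1 * C3 * ip f f)%:E)%E.
Proof.
move=> d0 af mA hA; have [nf fD Lf _] := af; have [mf f0] := nf.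
have S := schur_test C3_ge0 measurable_bk bk_ge0 bk_sym bk_int nf nf.
rewrite !nint_sqr// in S.
have fb0 x y : (0 <= (f x * f y)%:E * bk x y)%E by rewrite mule_ge0// lee_fin mulr_ge0.
have mF := measurable_double nf measurable_bk bk_ge0.
have [mp p0] := nn_patch mA nf.
have key x : ((delta * patch1 f A x)%:E <= \int[m]_y ((f x * f y)%:E * bk x y))%E.
  have [Ax|Ax] := pselect (A x); last first.
    rewrite /patch1 indicE (memNset Ax) !mulr0.
    by apply: integral_ge0.
  have [Dx|Dx] := pselect (D x); last first.
    by rewrite /patch1 (fD _ Dx) mul0r mulr0; apply: integral_ge0 => y _; rewrite mul0r mul0e.
  rewrite /patch1 indicE (mem_set Ax) mulr1 mulrC EFinM.
  under eq_integral do rewrite EFinM -muleA.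
  have mx : measurable_fun setT (fun y => (f y)%:E * bk x y)%E.
    apply: emeasurable_funM; first exact/measurable_EFinP.
    exact: (measurableT_comp measurable_bk (measurable_pair1 x)).
  have x0 y : (0 <= (f y)%:E * bk x y)%E by rewrite mule_ge0// lee_fin.
  rewrite ge0_integralZl_EFin//; apply: lee_wpmul2l; first by rewrite lee_fin.
  have hx := h_gt0 Dx; have hx' : (0 < (h x)%:E)%E by rewrite lte_fin.
  rewrite -(@lee_pmul2l _ (h x)%:E)// -EFinM mulrC.
  apply: le_trans (hA x Ax) _.
  have [mHf Hf0] := pot_integrand H_ge0 measurable_H x nf.
  rewrite -ge0_integralZl_EFin ?(ltW hx)//; apply: ge0_le_integral => //.
  - by move=> y _; rewrite lee_fin.
  - exact/measurable_EFinP.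
  - exact: emeasurable_funM.
  move=> y _; rewrite mulrC EFinM muleCA; apply: lee_wpmul2l; first by rewrite lee_fin.
  exact: H_le_bk.
have : (delta%:E * nint m (patch1 f A) <= (C3 * ip f f)%:E)%E.
  rewrite -nintZ ?(ltW d0)//.
  apply: (@le_trans _ _ (\int[m]_x \int[m]_y ((f x * f y)%:E * bk x y))%E); last first.
    by apply: le_trans S _; rewrite -EFinD -EFinM lee_fin; lra.
  apply: ge0_le_integral => //.
  - by move=> x _; rewrite lee_fin; apply: mulr_ge0; [exact: ltW|exact: p0].
  - by apply/measurable_EFinP; apply: measurable_funM; [exact: measurable_cst|exact: mp].
have := nint_ge0 m p0; case: (nint m _) => [r| |]// _.
  by rewrite -EFinM !lee_fin -mulrA ler_pdivlMl.
by rewrite gt0_muley ?lte_fin.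
Qed.

(* Deleting the part of f where the potential is small compared with h costs little energy
   and much moment; restoring the moment by scaling then increases the energy. *)
Lemma bounded_mass_competitor : exists2 M : R, 0 < M & forall (a : R) f, 0 < a ->
  admissible f -> moment f = a -> maxQ * a ^+ 2 / 2 <= energyQ f ->
  exists g, [/\ admissible g, moment g = a, energyQ f <= energyQ g &
    (nint m g <= (M * a)%:E)%E].
Proof.
have [C C0 hC] := energyQ_moment; have K0 := maxQ_gt0; set K := maxQ in K0 *.
have l0 := lam_gt0.
have pos36 : 0 <= 36 * C3 * lam * C / K.
  apply: divr_ge0; last exact: ltW.
  by apply: mulr_ge0; [apply: mulr_ge0; [exact: mulr_ge0|exact: ltW]|exact: ltW].
(* The number 36 is the scaling factor 3, times 3 from [delta^-1 = 3 / (K * a)], times 4 from the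
   bound [4 * lam * C * a ^+ 2] on the L^2 norm; the added 1 only gives strict positivity. *)
exists (1 + 36 * C3 * lam * C / K).
  apply: ltr_pwDl => //; exact: pos36.
move=> a f a0 af mfa hQ; have [nf fD Lf _] := af.
(* Removing moment [i] then costs at most [K * a / 3 * i] of energy, which [rescaling_gain]
   recovers. *)
pose delta := K * a / 3; have d0 : 0 < delta by rewrite divr_gt0// mulr_gt0.
pose A := [set x | ((delta * h x)%:E <= pot f x)%E].
have mA : measurable A.
  rewrite -[A]setTI; apply: emeasurable_fun_le => //.
    by apply/measurable_EFinP; exact: measurable_funM.
  exact: measurable_pot.
have mAC := measurableC mA.
have a1 := adm_patch mA af; have a2 := adm_patch mAC af.
set fi := patch1 f (~` A) in a2; set fo := patch1 f A in a1.
have EQ : energyQ f = energyQ fo + (form fi f - form fi fi / 2 - ip fi fi / (2 * lam)).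
  by have := energyQ_patch mAC af; rewrite setCK.
have mom : a = moment fo + moment fi by rewrite -mfa; exact: moment_patch.
set i := moment fi in mom *.
have i0 : 0 <= i by apply/moment_ge0/adm_nn.
have o0 : 0 <= moment fo by apply/moment_ge0/adm_nn.
have bfi : form fi f <= delta * i.
  rewrite -lee_fin formE// EFinM momentE// -nintZ ?(ltW d0)//; last 2 first.
  - exact: (nnM nn_h (adm_nn a2)).1.
  - exact: (nnM nn_h (adm_nn a2)).2.
  apply: ge0_le_integral => //.
  - move=> x _; apply: mule_ge0; last exact: pot_ge0.
    by rewrite lee_fin; exact: (adm_nn a2).2.
  - apply: emeasurable_funM; last exact: measurable_pot.
    by apply/measurable_EFinP; exact: (adm_nn a2).1.
  - apply/measurable_EFinP; apply: measurable_funM => //.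
    exact: (nnM nn_h (adm_nn a2)).1.
  move=> x _; have [Ax|Ax] := pselect (A x).
    by rewrite /fi /patch1 indicE memNset ?mulr0 ?mul0e ?mulr0//= => /(_ Ax).
  have : (pot f x <= (delta * h x)%:E)%E by move/negP : Ax; rewrite -ltNge => /ltW.
  rewrite [in X in _ -> X]mulrA [in X in _ -> X]mulrC EFinM => hx.
  by apply: lee_wpmul2l hx; rewrite lee_fin; exact: (adm_nn a2).2.
have Qo : energyQ f - delta * i <= energyQ fo.
  have f1 := form_ge0 (adm_nn a2) (adm_nn a2).
  have f2 : 0 <= ip fi fi / (2 * lam) by rewrite divr_ge0 ?L2ip_ge0// mulr_ge0// ltW.
  by rewrite EQ; lra.
have KQ := energyQ_le_maxQ a1; rewrite -/K in KQ.
have Ka : K * a * a / 2 <= energyQ f by move: hQ; rewrite expr2 mulrA.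
have ia : i <= a by lra.
have di : delta * i <= K * a * a / 3.
  by rewrite /delta mulrAC; apply: ler_wpM2r => //; apply: ler_wpM2l => //; rewrite mulr_ge0 ?ltW.
have Ka0 : 0 < K * a * a by rewrite !mulr_gt0.
(* At least a third of the moment survives: the energy left is at least K a^2 / 2 - K a^2 / 3 and at
   most [K * moment fo ^+ 2]. Hence the scaling factor [c] is at most 3. *)
have o9 : a ^+ 2 <= (3 * moment fo) ^+ 2.
  have : K * (a * a) <= K * (6 * moment fo ^+ 2) by lra.
  rewrite ler_pM2l// => h6; rewrite exprMn expr2.
  by have := sqr_ge0 (moment fo); lra.
have o3 : a <= 3 * moment fo by rewrite -ler_sqr ?nnegrE ?mulr_ge0// ltW.
have o1 : 0 < moment fo by lra.
pose c := a / moment fo; have c0 : 0 <= c by rewrite divr_ge0 ?ltW.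
have c3 : c <= 3 by rewrite /c ler_pdivrMr.
exists (fun x => c * fo x); split.
- exact: adm_scale.
- by rewrite moment_scale ?divfK ?gt_eqF//; exact: adm_nn.
- rewrite energyQ_scale// /c expr_div_n mulrAC ler_pdivlMr ?exprn_gt0//.
  apply: (@le_trans _ _ (a ^+ 2 * (energyQ f - delta * i))); last first.
    by apply: ler_wpM2l => //; exact: sqr_ge0.
  have moE : moment fo = a - i by lra.
  rewrite moE.
  by rewrite (mulrC (energyQ f)); exact: rescaling_gain.
have [mfo fo0] := adm_nn a1.
rewrite nintZ//.
have n2 : ip f f <= 4 * lam * C * a ^+ 2.
  have := hC f af; rewrite mfa => h1.
  have : ip f f / (4 * lam) <= C * a ^+ 2 by lra.
  by rewrite ler_pdivrMr ?mulr_gt0//; lra.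
have h1 := mass_le d0 af mA (fun x Ax => Ax).
apply: (@le_trans _ _ (3%:E * (delta^-1 * C3 * (4 * lam * C * a ^+ 2))%:E)%E).
  apply: lee_pmul.
  - by rewrite lee_fin.
  - exact: nint_ge0.
  - by rewrite lee_fin.
  - apply: le_trans h1 _; rewrite lee_fin; apply: ler_wpM2l => //.
    by rewrite mulr_ge0// invr_ge0 ltW.
rewrite -EFinM lee_fin.
have -> : 3 * (delta^-1 * C3 * (4 * lam * C * a ^+ 2)) = 36 * C3 * lam * C / K * a.
  by rewrite /delta; field; rewrite !gt_eqF.
by apply: ler_wpM2r; [exact: ltW|rewrite lerDr].
Qed.

(** If no window carried moment [beta], the potential minus its singular part would be at most [h]
    times [C * beta + eta * moment f]. The values of [beta] and [eta] make this contribute at most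
    [q0] to the form, while the head is cancelled by the L^2 penalty, so the energy would be at most
    [q0 / 2]. *)
Lemma nonvanishing (q0 a : R) : 0 < q0 -> 0 < a -> exists (L beta : R), 0 < beta /\
  forall f, admissible f -> moment f <= a -> q0 <= energyQ f ->
  exists x, D x /\ (beta%:E <= nint m (fun y => h y * f y * \1_(B x L) y)%R)%E.
Proof.
move=> q00 a0; have l0 := lam_gt0.
have il0 : 0 < lam^-1 by rewrite invr_gt0.
have [hd [C [[mhd hd0 hds hdi] C0 hH fs]]] := H_head il0.
pose eta := q0 / (2 * a ^+ 2); have eta0 : 0 < eta by rewrite divr_gt0 ?mulr_gt0 ?exprn_gt0.
have [L hL] := fs eta eta0.
pose beta := q0 / (2 * a * C); have b0 : 0 < beta by rewrite divr_gt0 ?mulr_gt0.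
exists L, beta; split => // f af mfa hQ; apply: contrapT => hn.
have [nf fD Lf _] := af; have [mhf hf0] := nnM nn_h nf.
have m0 := moment_ge0 nf.
have bx x : D x -> (nint m (fun y => h y * f y * \1_(B x L) y)%R <= beta%:E)%E.
  move=> Dx; rewrite leNgt; apply/negP => hb; apply: hn; exists x; split => //.
  exact: ltW.
pose c := C * beta + eta * moment f.
have c0 : 0 <= c by rewrite addr_ge0// mulr_ge0// ltW.
have : form f f <= lam^-1 * ip f f + c * moment f.
  apply: (form_head (ltW il0) c0 mhd hd0 hds hdi af) => x Dx.
  have mI : measurable_fun setT (\1_(B x L) : T -> R) by exact: measurable_indic.
  have nt : nn (fun y => C * \1_(B x L) y + eta).
    split; first by apply: measurable_funD => //; exact: measurable_funM.
    by move=> y; rewrite addr_ge0 ?(ltW eta0)// mulr_ge0// ltW.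
  have ph := pot_head af mhd hd0 nt Dx.
  apply: le_trans (ph _) _.
    move=> y Dy; have [By|By] := pselect (B x L y).
      apply: le_trans (hH x y Dx Dy) _; apply: leeD => //; rewrite lee_fin.
      do 2 apply: ler_wpM2l => //.
      by rewrite indicE mem_set// mulr1 lerDl ltW.
    apply: le_trans (hL x y Dx Dy By) _; apply: leeD => //; rewrite lee_fin.
    do 2 apply: ler_wpM2l => //.
    by rewrite indicE memNset// mulr0 add0r.
  apply: leeD => //; rewrite EFinM; apply: lee_wpmul2l; first by rewrite lee_fin.
  rewrite (@eq_nint _ _ _ _ _ (fun y => C * (h y * f y * \1_(B x L) y) + eta * (h y * f y))); last first.
    by move=> y; ring.
  have [mhfB hfB0] := nn_patch (measurable_B x L) (nnM nn_h nf).
  rewrite nintD//; last 4 first.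
  - exact: measurable_funM.
  - exact: measurable_funM.
  - by move=> y; rewrite mulr_ge0// ltW.
  - by move=> y; rewrite mulr_ge0// ltW.
  rewrite !nintZ ?(ltW C0) ?(ltW eta0)// -momentE// /c EFinD !EFinM.
  by apply: leeD => //; apply: lee_wpmul2l; [rewrite lee_fin ltW|exact: bx].
move=> hf.
have cm : c * moment f <= q0.
  apply: (@le_trans _ _ ((C * beta + eta * a) * a)).
    apply: ler_pM => //; rewrite /c lerD2l; exact: ler_wpM2l (ltW eta0) _ _ mfa.
  by apply: lexx_eq; rewrite /beta /eta; field; rewrite !gt_eqF.
move: hQ; rewrite /energyQ.
have -> : ip f f / (2 * lam) = lam^-1 * ip f f / 2 by field; rewrite gt_eqF.
by move: (lam^-1 * ip f f) hf => w hf; lra.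
Qed.

End Functional.

(** * Compactness of maximizing sequences *)

Lemma cvg_sqr0 (R : realType) (x y : nat -> R) (C : R) :
  (forall n, x n ^+ 2 <= C * y n) -> y @ \oo --> (0 : R) -> x @ \oo --> (0 : R).
Proof.
move=> xy y0; have Cy : (fun n => C * y n) @ \oo --> (0 : R).
  by rewrite -(mulr0 C); apply: cvgM => //; exact: cvg_cst.
apply/cvgrPdist_lt => e e0; have e2 : 0 < e ^+ 2 by rewrite exprn_gt0.
move/cvgrPdist_lt : Cy => /(_ _ e2); apply: filterS => n.
rewrite !sub0r !normrN => h; rewrite -ltr_sqr ?nnegrE ?(ltW e0)// real_normK ?num_real//.
by apply: le_lt_trans (xy n) _; apply: le_lt_trans (ler_norm _) h.
Qed.

Section Exhaustion.
Context d (T : measurableType d) (R : realType).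
Variable m : {measure set T -> \bar R}.
Variable E : nat -> set T.
Hypothesis measurable_E : forall k, measurable (E k).
Hypothesis E_nd : forall k l, (k <= l)%N -> E k `<=` E l.
Hypothesis E_cover : \bigcup_k E k = setT.
Local Notation nn := (@nonneg_mfun d T R).

Lemma nint_le_exhaustion (f : T -> R) (c : \bar R) : nn f ->
  (forall k, nint m (patch1 f (E k)) <= c)%E -> (nint m f <= c)%E.
Proof.
move=> [mf f0] fc.
have cv : (\int[m]_(x in E k) (f x)%:E)%E @[k --> \oo] -->
    (\int[m]_(x in \bigcup_k E k) (f x)%:E)%E.
  apply: ge0_nondecreasing_set_cvg_integral => //.
  - by move=> k l kl; apply/subsetPset; exact: E_nd.
  - by move=> k; apply/measurable_EFinP; exact: measurable_funTS.
  - by move=> k x _; rewrite lee_fin.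
rewrite E_cover in cv; rewrite /nint -(cvg_lim _ cv)//; apply: lime_le.
  exact: cvgP cv.
apply: nearW => k; apply: le_trans (fc k); rewrite integral_mkcond.
apply: lexx_eq; apply: eq_integral => x _.
by rewrite /patch /patch1 indicE; case: ifPn => _; rewrite ?mulr1 ?mulr0.
Qed.

Lemma nint_tail (f : T -> R) (e : R) : nn f -> (nint m f < +oo)%E -> 0 < e ->
  exists k, (nint m (patch1 f (~` E k)) <= e%:E)%E.
Proof.
move=> nf ffin e0; have f0 := nint_ge0 m nf.2.
have fin : nint m f \is a fin_num by rewrite ge0_fin_numE.
apply: contrapT => /forallNP h.
have : (nint m f <= nint m f - e%:E)%E.
  apply: nint_le_exhaustion => // k; have mEC := measurableC (measurable_E k).
  have [m1 p1] := nn_patch (measurable_E k) nf; have [m2 p2] := nn_patch mEC nf.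
  have S : nint m f = (nint m (patch1 f (E k)) + nint m (patch1 f (~` E k)))%E.
    by rewrite -nintD//; apply: eq_nint => x; rewrite {1}(patch1_split f (E k)).
  rewrite leeBrDr// {1}S; apply: leeD => //.
  by have /negP := h k; rewrite -ltNge => /ltW.
rewrite leeBrDr//; move: fin; case: (nint m f) => [r _| |]//.
by rewrite -EFinD lee_fin; lra.
Qed.

End Exhaustion.

(** Splitting is never optimal: mv^2 + (a - mv)^2 >= a^2 means mv (a - mv) <= 0, hence mv = a since
    mv > 0. *)
Lemma split_moment_arith (R : realFieldType) (K a mv q : R) : 0 < K -> 0 < mv -> mv <= a ->
  q <= K * mv ^+ 2 -> K * a ^+ 2 <= q + K * (a - mv) ^+ 2 -> mv = a /\ q = K * a ^+ 2.
Proof.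
move=> K0 m0 ma h1 h2.
have h3 : K * a ^+ 2 <= K * (mv ^+ 2 + (a - mv) ^+ 2) by lra.
rewrite ler_pM2l// in h3.
have h4 : a <= mv.
  by rewrite -(ler_pM2l m0); have : mv * a <= mv * mv by lra.
have am : mv = a by apply/eqP; rewrite eq_le ma.
split => //; rewrite am in h1 h2; apply/eqP; rewrite eq_le h1.
by move: h2; rewrite subrr expr0n mulr0 addr0.
Qed.

(** Bookkeeping for a cut whose outer moment [mo] and outer squared norm [i] are at most [t].
    Passing from [mi] to [mv] in the quadratic term costs at most [K * (2 * a + 1) * t], dropping
    the outer energy at most [t * L]. *)
Lemma cut_arith (R : realFieldType) (K L a mv mi mo e t i Q X Qo : R) :
  0 < K -> 0 < L -> 0 <= mo -> mo <= t -> t <= 1 -> t * (L + K * (2 * a + 1)) <= e ->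
  i <= t -> 0 < mv -> mv <= a -> mv = mi + mo -> Q = X + Qo -> - (i * L) <= Qo ->
  K * a ^+ 2 <= X + K * (a - mi) ^+ 2 -> K * a ^+ 2 <= Q + K * (a - mv) ^+ 2 + e.
Proof.
move=> K0 L0 mo0 mot t1 te it mv0 mva emv eQ hQo h.
have iL : i * L <= t * L by apply: ler_wpM2r => //; exact: ltW.
have h1 : (a - mv) * mo <= a * t by apply: ler_pM => //; lra.
have h2 : mo * mo <= 1 * t by apply: ler_pM => //; lra.
have h3 : K * (2 * ((a - mv) * mo) + mo * mo) <= K * (2 * (a * t) + 1 * t).
  by apply: ler_wpM2l; [exact: ltW|lra].
have E : (a - mi) ^+ 2 = (a - mv) ^+ 2 + (2 * ((a - mv) * mo) + mo * mo) by rewrite emv; ring.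
rewrite E mulrDr in h; lra.
Qed.

Lemma norm_arith (R : realFieldType) (F G t c p s : R) :
  0 < s / 4 -> 0 <= G -> t <= s / 4 -> c <= s / 4 -> F + c + t - (F + G / 2 - p) < p + s.
Proof. by lra. Qed.

Lemma small_factor (R : realFieldType) (B e : R) : 0 < e ->
  exists t, [/\ 0 < t, t <= 1 & t * B <= e].
Proof.
move=> e0; have B0 : 0 < `|B| + 1 by apply: ltr_wpDl.
exists (Num.min 1 (e / (`|B| + 1))); split.
- by rewrite lt_min ltr01 divr_gt0.
- by rewrite ge_min lexx.
- apply: (@le_trans _ _ (Num.min 1 (e / (`|B| + 1)) * (`|B| + 1))).
    apply: ler_wpM2l; last by apply: le_trans (ler_norm B) _; rewrite lerDl.
    by rewrite le_min ler01 divr_ge0 ?ltW.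
  by rewrite -ler_pdivlMr// ge_min lexx orbT.
Qed.

Section Compactness.
Context d (T : measurableType d) (R : realType).
Variable m : {sigma_finite_measure set T -> \bar R}.
Variable H : T -> T -> R.
Hypothesis H_ge0 : forall x y, 0 <= H x y.
Hypothesis H_sym : forall x y, H x y = H y x.
Hypothesis measurable_H : measurable_fun setT (fun p : T * T => H p.1 p.2).
Hypothesis H_int : forall x, (nint m (H x) <= 1)%E.
Variable C2 : R.
Hypothesis H_sqr : forall x, (nint m (fun y => H x y ^+ 2)%R <= C2%:E)%E.
Variables (h : T -> R) (D : set T).
Hypothesis measurable_h : measurable_fun setT h.
Hypothesis h_ge0 : forall x, 0 <= h x.
Hypothesis measurable_D : measurable D.
Local Notation nn := (@nonneg_mfun d T R).
Local Notation ip := (L2ip m).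
Local Notation frm := (form m H).
Local Notation mom := (moment m h).
Local Notation admissible := (@admissible d T R m h D).
Variables (lam K : R).
Hypothesis lam_gt0 : 0 < lam.
Hypothesis K_gt0 : 0 < K.
Local Notation Q := (energyQ m H lam).
Hypothesis hK : forall f, admissible f -> Q f <= K * mom f ^+ 2.
Hypothesis hF : forall eps : R, 0 < eps -> exists2 C : R, 0 < C &
  forall f, admissible f -> frm f f <= eps * ip f f + C * mom f ^+ 2.
Variable E : nat -> set T.
Hypothesis measurable_E : forall k, measurable (E k).
Hypothesis E_nd : forall k l, (k <= l)%N -> E k `<=` E l.
Hypothesis E_cover : \bigcup_k E k = setT.
Hypothesis E_fin : forall k, (m (E k) < +oo)%E.
Hypothesis h_bound : forall k, exists c, forall x, E k x -> h x <= c.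

Lemma L2_bounded_patch (t : T -> R) (c : R) k : measurable_fun setT t ->
  (forall x, E k x -> `|t x| <= c) -> L2fun m (patch1 t (E k)).
Proof.
move=> mt tc.
have mI : measurable_fun setT (\1_(E k) : T -> R) by exact: measurable_indic.
split; first exact: measurable_funM.
apply: (@le_lt_trans _ _ (nint m (fun x => c ^+ 2 * \1_(E k) x))).
  apply: le_nint => [|||x].
  - by apply: measurable_funX; exact: measurable_funM.
  - exact: measurable_funM.
  - by move=> x; exact: sqr_ge0.
  rewrite /patch1 indicE; have [Ex|Ex] := pselect (E k x); last first.
    by rewrite memNset// !mulr0 expr0n.
  rewrite mem_set// !mulr1 -(real_normK (num_real (t x))) ler_sqr ?nnegrE ?tc//.
  exact: le_trans (normr_ge0 _) (tc x Ex).
rewrite nintZ ?sqr_ge0// /nint integral_indic// setIT.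
by apply: lte_mul_pinfty; [rewrite lee_fin sqr_ge0//|by []|exact: E_fin].
Qed.

Lemma ipBl f g k : L2fun m f -> L2fun m g -> L2fun m k -> ip (f - g) k = ip f k - ip g k.
Proof. by move=> Lf Lg Lk; rewrite addrC -scaleN1r L2ip_lin// mulN1r addrC. Qed.

Lemma ipBr f g k : L2fun m f -> L2fun m g -> L2fun m k -> ip k (f - g) = ip k f - ip k g.
Proof. by move=> Lf Lg Lk; rewrite L2ipC ipBl// !(L2ipC m k). Qed.

Lemma ip_sqrB f g : L2fun m f -> L2fun m g ->
  ip (f - g) (f - g) = ip f f - 2 * ip f g + ip g g.
Proof.
move=> Lf Lg; have LB := L2B Lf Lg.
by rewrite ipBl// !ipBr// (L2ipC m g f); ring.
Qed.

Lemma ip_eq f g f' g' : (forall x, f x * g x = f' x * g' x) -> ip f g = ip f' g'.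
Proof. by move=> e; rewrite /L2ip (eq_nint _ e). Qed.

Lemma ip_le0 f : L2fun m f -> ip f f <= 0 -> forall g, L2fun m g -> ip f g = 0.
Proof.
move=> Lf f0 g Lg; have := L2_cauchy_schwarz Lf Lg.
have -> : ip f f = 0 by apply/eqP; rewrite eq_le f0 L2ip_ge0.
by rewrite mul0r => hs; apply/eqP; rewrite -sqrf_eq0 eq_le hs sqr_ge0.
Qed.

Section Sequence.
Variables (u : nat -> T -> R) (C a : R).
Hypothesis u_adm : forall n, admissible (u n).
Hypothesis u_bound : forall n, ip (u n) (u n) <= C.
Hypothesis u_moment : (fun n => mom (u n)) @ \oo --> a.
Local Notation weak_to v := (forall phi, L2fun m phi ->
  (fun n => ip (u n) phi) @ \oo --> ip v phi).

Let uL n : L2fun m (u n). Proof. exact: adm_L2. Qed.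
Let un n : nn (u n). Proof. exact: adm_nn. Qed.

(** A weak limit is known only up to null sets, so the positive part of [v] on [D] is taken as
    representative. Testing with [v - v'] gives [ip v (v - v') <= 0], and this number is the squared
    norm of [v - v']. *)
Lemma weak_limit_nonneg v : L2fun m v -> weak_to v ->
  exists v', [/\ nn v', forall x, ~ D x -> v' x = 0, L2fun m v' & weak_to v'].
Proof.
move=> Lv wv; have mv := Lv.1.
pose v' x := Num.max (v x) 0 * \1_D x.
have mv' : measurable_fun setT v'.
  by apply: measurable_funM; [exact: measurable_maxr|exact: measurable_indic].
have v'0 x : 0 <= v' x by rewrite mulr_ge0// le_max lexx orbT.
have Lv' : L2fun m v'.
  apply: (L2_le mv' Lv) => x; rewrite /v' indicE; case: (_ \in _); last by rewrite mulr0 expr0n sqr_ge0.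
  by rewrite mulr1; case: (leP (v x) 0) => hx; rewrite ?expr0n ?sqr_ge0.
have LB := L2B Lv Lv'.
have v'D x : ~ D x -> v' x = 0 by move=> nD; rewrite /v' indicE memNset// mulr0.
exists v'; split => //.
have neg n : ip (u n) (v - v') <= 0.
  rewrite ipBr// subr_le0 -lee_fin !L2ipE//.
  have [mf f0] := un n.
  have -> : nint m (fun x => u n x * v' x) =
      nint m (fun x => Num.max (u n x * v x) 0).
    apply: eq_nint => x; have [Dx|Dx] := pselect (D x).
      by rewrite /v' indicE mem_set// mulr1 maxr_pMr// mulr0.
    by have [_ uD _ _] := u_adm n; rewrite (uD _ Dx) !mul0r maxxx.
  rewrite /nint; apply: le_integral => //.
  - exact: L2_integrableM.
  - have := L2_integrableM (uL n) Lv'; apply: eq_integrable => // x _ /=; congr EFin.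
    have [Dx|Dx] := pselect (D x).
      by rewrite /v' indicE mem_set// mulr1 maxr_pMr// mulr0.
    by have [_ uD _ _] := u_adm n; rewrite (uD _ Dx) !mul0r maxxx.
  - by move=> x _; rewrite lee_fin le_max lexx.
have h1 : ip v (v - v') <= 0.
  by apply: (cvgr_to_le (wv _ LB)); apply: nearW => n; exact: neg.
have h2 : ip v (v - v') = ip (v - v') (v - v').
  apply: ip_eq => x; rewrite [(v - v') x](_ : _ = v x - v' x)// /v' indicE.
  case: (_ \in _); last by rewrite mulr0 subr0.
  by rewrite mulr1; case: (leP (v x) 0) => hx; rewrite ?subr0// subrr !mulr0.
rewrite h2 in h1 => {neg}.
move=> phi Lphi; have := ip_le0 LB h1 Lphi; rewrite ipBl// => /eqP.
by rewrite subr_eq0 => /eqP <-; exact: wv.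
Qed.

(** The weight cut to [E k] is an admissible L^2 test function; exhaustion then yields a Fatou-type
    inequality. It serves for the moment with [t = h] and for the mass with [t = 1]. *)
Lemma weak_limit_integral v (t : T -> R) (c : R) : nn v -> L2fun m v -> weak_to v -> nn t ->
  (forall k, exists M, forall x, E k x -> t x <= M) ->
  (forall b, c < b -> \forall n \near \oo, (nint m (fun x => t x * u n x)%R <= b%:E)%E) ->
  (nint m (fun x => t x * v x)%R <= c%:E)%E.
Proof.
move=> nv Lv wv nt tb hc.
apply: (nint_le_exhaustion measurable_E E_nd E_cover (nnM nt nv)) => k.
have [M hM] := tb k.
have LtE : L2fun m (patch1 t (E k)).
  by apply: (@L2_bounded_patch _ M); [exact: nt.1|move=> x Ex; rewrite ger0_norm ?nt.2 ?hM].
have E1 w : (fun x => w x * patch1 t (E k) x) =1 patch1 (fun x => t x * w x) (E k).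
  by move=> x; rewrite /patch1; ring.
rewrite -(eq_nint _ (E1 v)) -L2ipE// lee_fin; apply/ler_addgt0Pr => e e0.
apply: (cvgr_to_le (wv _ LtE)); have /hc : c < c + e by lra.
apply: filterS => n hn; rewrite -lee_fin L2ipE// (eq_nint _ (E1 _)).
apply: le_trans hn.
have [mtu tu0] := nnM nt (un n); have [mp p0] := nn_patch (measurable_E k) (nnM nt (un n)).
by apply: le_nint => // x; rewrite /patch1; apply: ler_piMr => //.
Qed.

Lemma weak_limit_moment v : nn v -> L2fun m v -> (forall x, ~ D x -> v x = 0) -> weak_to v ->
  admissible v /\ mom v <= a.
Proof.
move=> nv Lv vD wv.
have hm : (nint m (fun x => h x * v x)%R <= a%:E)%E.
  apply: weak_limit_integral => // b ab.
  move/cvgrPdist_lt : u_moment => /(_ (b - a)); rewrite subr_gt0 => /(_ ab).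
  apply: filterS => n; rewrite distrC => /(le_lt_trans (ler_norm _)) hn.
  by rewrite -(momentE measurable_h h_ge0 (u_adm n)) lee_fin; lra.
have av : admissible v by split => //; apply: le_lt_trans hm _; rewrite ltry.
by split => //; rewrite -lee_fin (momentE measurable_h h_ge0 av).
Qed.

Section Limit.
Variable v : T -> R.
Hypothesis v_adm : admissible v.
Hypothesis u_weak : weak_to v.

Let vL : L2fun m v. Proof. exact: (adm_L2 v_adm). Qed.
Let vn : nn v. Proof. exact: (adm_nn v_adm). Qed.

Lemma weak_limit_bound : ip v v <= C.
Proof.
have : ip v v <= (C + ip v v) / 2.
  apply: (cvgr_to_le (u_weak vL)); apply: nearW => n.
  have := L2ip_ge0 m (u n - v); rewrite ip_sqrB//; have := u_bound n; lra.
lra.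
Qed.

(** * Cutting along one set of the exhaustion *)

Section Cut.
Variable k : nat.
Local Notation inn f := (patch1 f (E k)).
Local Notation out f := (patch1 f (~` E k)).

(* Halved on E k, so that pairs of points of E k are not counted twice. *)
Definition half_cut (x : T) : R := 1 - \1_(E k) x / 2.
Local Notation hc f := (fun x => f x * half_cut x).

Lemma half_cut01 x : 0 <= half_cut x <= 1.
Proof. by rewrite /half_cut indicE; case: (_ \in _) => /=; apply/andP; split; lra. Qed.

Lemma measurable_half_cut : measurable_fun setT half_cut.
Proof.
apply: measurable_funB => //; apply: measurable_funM => //; exact: measurable_indic.
Qed.

Lemma adm_inn f : admissible f -> admissible (inn f).
Proof. by apply: adm_patch. Qed.
Lemma adm_out f : admissible f -> admissible (out f).
Proof. by apply: adm_patch => //; exact: measurableC. Qed.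
Lemma adm_half_cut f : admissible f -> admissible (hc f).
Proof. by apply: adm_mul => //; [exact: measurable_half_cut|exact: half_cut01]. Qed.

(** All pairs with a point in [E k] are collected in one term whose first factor lives on a set of
    finite measure; this term turns out to be weakly continuous. *)
Lemma form_cut f : admissible f -> frm f f / 2 = frm (inn f) (hc f) + frm (out f) (out f) / 2.
Proof.
move=> af; have ai := adm_inn af; have ao := adm_out af.
have ai2 : admissible (fun x => 2^-1 * inn f x) by apply: adm_scale => //; rewrite invr_ge0.
have E1 : hc f = (fun x => out f x + 2^-1 * inn f x).
  apply/funext => x; rewrite /half_cut /patch1 !indicE in_setC.
  by case: (_ \in _) => /=; field.
have E2 : frm (inn f) (hc f) = frm (inn f) (out f) + 2^-1 * frm (inn f) (inn f).
  rewrite E1 (formDr H_ge0 H_sym measurable_H H_int ao ai2 ai); congr (_ + _).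
  have c0 : 0 <= (2^-1 : R) by rewrite invr_ge0.
  rewrite /form (eformZr m H_ge0 measurable_H c0 (adm_nn ai) (adm_nn ai)).
  by rewrite -(formE H_ge0 H_sym measurable_H H_int ai ai).
have E3 g : admissible g -> frm g f = frm g (inn f) + frm g (out f).
  move=> ag; rewrite -(formDr H_ge0 H_sym measurable_H H_int ai ao ag).
  by rewrite -patch1_split.
have E4 : frm f f = frm (inn f) f + frm (out f) f.
  rewrite -(formDl H_ge0 H_sym measurable_H H_int ai ao af).
  by rewrite -patch1_split.
have E5 := formC m H_ge0 H_sym measurable_H (adm_nn ai) (adm_nn ao).
rewrite E2 E4 (E3 _ ai) (E3 _ ao) E5.
by move: (frm _ _) (frm _ _) (frm _ _) => p q r; field.
Qed.

Lemma ip_inn f g : ip (inn f) (inn g) = ip f (inn g).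
Proof.
apply: ip_eq => x; rewrite /patch1 indicE; case: (_ \in _); rewrite ?mulr1// !mulr0.
by [].
Qed.

Lemma energyQ_cut f : admissible f ->
  Q f = frm (inn f) (hc f) - ip (inn f) (inn f) / (2 * lam) + Q (out f).
Proof.
move=> af; rewrite /energyQ (form_cut af)
  (ip_patch measurable_h h_ge0 (measurable_E k) (adm_L2 af) af).
rewrite (mulrDl _ _ (2 * lam)^-1).
move: (ip _ _ / (2 * lam)) (ip _ _ / (2 * lam)) (frm _ _) (frm _ _ / 2) => p q r s.
ring.
Qed.

Lemma moment_cut f : admissible f -> mom f = mom (inn f) + mom (out f).
Proof. by apply: moment_patch. Qed.

Lemma moment_inn_cvg : (fun n => mom (inn (u n))) @ \oo --> mom (inn v).
Proof.
have [M hM] := h_bound k.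
have LhE : L2fun m (inn h).
  by apply: (@L2_bounded_patch _ M) => // x Ex; rewrite ger0_norm ?hM.
have E1 w : mom (inn w) = ip w (inn h).
  by rewrite /moment /L2ip; congr fine; apply: eq_nint => x; rewrite /patch1; ring.
by rewrite E1; under eq_fun do rewrite E1; exact: u_weak.
Qed.

Lemma L2_half_section x : L2fun m (hc (H x)).
Proof.
have LH := L2_section measurable_H H_sqr x.
have mh : measurable_fun setT (hc (H x)).
  by apply: measurable_funM; [exact: LH.1|exact: measurable_half_cut].
apply: (L2_le mh LH) => y; have /andP[h1 h2] := half_cut01 y.
by rewrite ler_sqr ?nnegrE ?mulr_ge0// ler_piMr.
Qed.

(** The potential of the half-cut function, with the cut moved onto the section of the kernel: an
    inner product of [f] itself with a fixed L^2 function, hence weakly continuous at each [x]. *)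
Definition cut_pot f x := ip f (hc (H x)).

Lemma cut_potE f x : admissible f -> pot m H (hc f) x = (cut_pot f x)%:E.
Proof.
move=> af; have ah := adm_half_cut af.
rewrite (potE measurable_H H_sqr x (adm_nn ah) (adm_L2 ah)); congr EFin.
by apply: ip_eq => y; ring.
Qed.

Lemma cut_pot_le f x : L2fun m f -> ip f f <= C -> cut_pot f x ^+ 2 <= C2 * C.
Proof.
move=> Lf fC; apply: le_trans (L2_cauchy_schwarz Lf (L2_half_section x)) _.
rewrite mulrC; apply: ler_pM => //; [exact: L2ip_ge0|exact: L2ip_ge0|].
apply: le_trans (L2_section_le measurable_H H_sqr x).
rewrite -lee_fin !L2ipE;
  [|exact: (L2_section measurable_H H_sqr)..|exact: L2_half_section|exact: L2_half_section].
have mh := (L2_half_section x).1; have mH := (L2_section measurable_H H_sqr x).1.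
apply: le_nint => [|||y].
- exact: measurable_funM.
- exact: measurable_funM.
- by move=> y; rewrite -expr2 sqr_ge0.
have /andP[h1 h2] := half_cut01 y.
by apply: ler_pM; rewrite ?mulr_ge0 ?ler_piMr.
Qed.

Lemma measurable_cut_pot f : admissible f -> measurable_fun setT (cut_pot f).
Proof.
move=> af; have mp := measurable_pot m H_ge0 measurable_H (adm_nn (adm_half_cut af)).
have -> : cut_pot f = fine \o pot m H (hc f).
  by apply/funext => x /=; rewrite cut_potE.
exact: (measurableT_comp (@fine_measurable R setT measurableT) mp).
Qed.

Let bnd := 1 + C2 * C.

Let cut_pot_bnd f x : L2fun m f -> ip f f <= C -> `|cut_pot f x| <= bnd.
Proof.
move=> Lf fC; have := cut_pot_le x Lf fC; rewrite /bnd -(real_normK (num_real (cut_pot f x))).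
by move: `|_| (normr_ge0 (cut_pot f x)) (C2 * C) => y y0 z; have := sqr_ge0 (y - 1); nra.
Qed.

Lemma L2_inn_cut_pot f : admissible f -> ip f f <= C -> L2fun m (inn (cut_pot f)).
Proof.
move=> af fC; apply: (@L2_bounded_patch _ bnd); first exact: measurable_cut_pot.
by move=> x _; apply: cut_pot_bnd => //; exact: (adm_L2 af).
Qed.

Lemma form_inn_cut f : admissible f -> ip f f <= C ->
  frm (inn f) (hc f) = ip f (inn (cut_pot f)).
Proof.
move=> af fC; have ai := adm_inn af; have ah := adm_half_cut af.
apply: EFin_inj; rewrite (formE H_ge0 H_sym measurable_H H_int ai ah).
rewrite L2ipE; [|exact: (adm_L2 af)|exact: L2_inn_cut_pot].
apply: eq_integral => x _; rewrite cut_potE// -EFinM; congr EFin.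
by rewrite /patch1; ring.
Qed.

Let v_bound := weak_limit_bound.

Let LP n : L2fun m (inn (cut_pot (u n))). Proof. exact: L2_inn_cut_pot. Qed.
Let LPv : L2fun m (inn (cut_pot v)). Proof. exact: L2_inn_cut_pot. Qed.

(** Weak convergence gives pointwise convergence of the potentials. They are bounded uniformly by
    [bnd] (from |y| <= 1 + y^2) and [E k] has finite measure, so dominated convergence applies. *)
Lemma cut_pot_strong :
  (fun n => ip (inn (cut_pot (u n)) - inn (cut_pot v)) (inn (cut_pot (u n)) - inn (cut_pot v)))
    @ \oo --> (0 : R).
Proof.
have Ln n : L2fun m (inn (cut_pot (u n)) - inn (cut_pot v)) by exact: (L2B (LP n) LPv).
pose p n x : R := inn (cut_pot (u n)) x - inn (cut_pot v) x.
pose g n x := ((p n x * p n x)%:E : \bar R).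
pose b : T -> R := patch1 (cst (2 * bnd)) (E k).
have Lb : L2fun m b.
  by apply: (@L2_bounded_patch _ `|2 * bnd|) => //; exact: measurable_cst.
pose G x := (b x * b x)%:E.
have mg n : measurable_fun setT (g n).
  by apply/measurable_EFinP; apply: measurable_funM; exact: (Ln n).1.
have p0 x : (fun n => p n x) @ \oo --> (0 : R).
  rewrite -(subrr (inn (cut_pot v) x)); apply: cvgB; last exact: cvg_cst.
  apply: cvgM; last exact: cvg_cst.
  exact: u_weak (L2_half_section x).
have g0 x : setT x -> g ^~ x @ \oo --> (cst 0%E : T -> \bar R) x.
  move=> _; apply: cvg_EFin; first by apply: nearW.
  by rewrite -[X in _ --> X](mulr0 (0 : R)); apply: cvgM; exact: p0.
have iG : m.-integrable setT G := L2_integrableM Lb Lb.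
have gG n x : setT x -> (`|g n x| <= G x)%E.
  move=> _; rewrite gee0_abs; last by rewrite lee_fin -expr2 sqr_ge0.
  rewrite lee_fin /p /b /patch1 indicE; case: (_ \in _); last by rewrite !mulr0 subrr mulr0.
  have := cut_pot_bnd x (uL n) (u_bound n); have := cut_pot_bnd x vL v_bound.
  rewrite !mulr1/= !ler_norml.
  move: (cut_pot _ x) (cut_pot _ x) bnd => s t z /andP[s1 s2] /andP[t1 t2].
  by have : 0 <= (2 * z - (t - s)) * (2 * z + (t - s)); [apply: mulr_ge0; lra|lra].
have := dominated_cvg measurableT mg g0 (fun x _ => isT : G x \is a fin_num) iG gG.
by rewrite integral0 => /fine_cvgP[_].
Qed.

(** A weakly convergent bounded sequence paired with a strongly convergent one. *)
Lemma form_inn_cut_cvg :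
  (fun n => frm (inn (u n)) (hc (u n))) @ \oo --> frm (inn v) (hc v).
Proof.
rewrite form_inn_cut//.
have -> : (fun n => frm (inn (u n)) (hc (u n))) = (fun n =>
    ip (u n) (inn (cut_pot (u n)) - inn (cut_pot v)) + ip (u n) (inn (cut_pot v))).
  by apply/funext => n; rewrite (form_inn_cut (u_adm n) (u_bound n)) (ipBr (LP n) LPv (uL n)) subrK.
rewrite -[X in _ --> X]add0r; apply: cvgD; last exact: u_weak.
apply: (@cvg_sqr0 _ _ _ C _ cut_pot_strong) => n.
have LB := L2B (LP n) LPv.
apply: le_trans (L2_cauchy_schwarz (uL n) LB) _.
by apply: ler_wpM2r; [exact: L2ip_ge0|exact: u_bound].
Qed.

Let mou n : mom (out (u n)) = mom (u n) - mom (inn (u n)).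
Proof. by rewrite (moment_cut (u_adm n)) addrAC subrr add0r. Qed.

Lemma moment_out_cvg : (fun n => mom (out (u n))) @ \oo --> a - mom (inn v).
Proof.
under eq_fun do rewrite mou.
by apply: cvgB; [exact: u_moment|exact: moment_inn_cvg].
Qed.

Lemma moment_out_sqr_cvg (c : R) : (fun n => c * mom (out (u n)) ^+ 2) @ \oo -->
  c * (a - mom (inn v)) ^+ 2.
Proof.
apply: cvgM; first exact: cvg_cst.
by rewrite expr2; under eq_fun do rewrite expr2; apply: cvgM; exact: moment_out_cvg.
Qed.

Lemma cut_energy_le : (fun n => Q (u n)) @ \oo --> K * a ^+ 2 ->
  K * a ^+ 2 <= frm (inn v) (hc v) - ip (inn v) (inn v) / (2 * lam)
    + K * (a - mom (inn v)) ^+ 2.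
Proof.
move=> cQ; have Li : L2fun m (inn v) := adm_L2 (adm_inn v_adm).
(* The squared norm of the inner part is only weakly lower semicontinuous; it is replaced by its
   tangent [2 * ip (u n) (inn v) - ip (inn v) (inn v)], which lies below it and converges. *)
pose r n := frm (inn (u n)) (hc (u n))
  - (2 * ip (u n) (inn v) - ip (inn v) (inn v)) / (2 * lam) + K * mom (out (u n)) ^+ 2.
have cr : r @ \oo --> frm (inn v) (hc v) - (2 * ip v (inn v) - ip (inn v) (inn v)) / (2 * lam)
    + K * (a - mom (inn v)) ^+ 2.
  apply: cvgD; last exact: moment_out_sqr_cvg.
  apply: cvgB; first exact: form_inn_cut_cvg.
  apply: cvgM; last exact: cvg_cst.
  apply: cvgB; last exact: cvg_cst.
  by apply: cvgM; [exact: cvg_cst|exact: u_weak].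
have -> : ip (inn v) (inn v) = 2 * ip v (inn v) - ip (inn v) (inn v).
  by rewrite -(ip_inn v v); ring.
apply: (ler_cvg_to cQ cr); apply: nearW => n; rewrite (energyQ_cut (u_adm n)) /r.
apply: lerD; last by apply: hK; exact: adm_out.
rewrite lerD2l lerN2; apply: ler_wpM2r; first by rewrite invr_ge0 mulr_ge0 ?ltW.
have Liu : L2fun m (inn (u n)) := adm_L2 (adm_inn (u_adm n)).
by have := L2ip_ge0 m (inn (u n) - inn v); rewrite (ip_sqrB Liu Li) (ip_inn (u n) v); lra.
Qed.

(** The energy identity solved for the L^2 norm. On the right everything converges once the outer
    form has been replaced by a small constant and the outer moment. *)
Lemma norm_sqr_cut n (eps Ce : R) : 0 < eps ->
  (forall f, admissible f -> frm f f <= eps * ip f f + Ce * mom f ^+ 2) ->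
  ip (u n) (u n) / (2 * lam) <= frm (inn (u n)) (hc (u n)) + eps * C / 2
     + Ce / 2 * mom (out (u n)) ^+ 2 - Q (u n).
Proof.
move=> e0 hf; have ao := adm_out (u_adm n).
have h1 : frm (out (u n)) (out (u n)) <= eps * C + Ce * mom (out (u n)) ^+ 2.
  apply: le_trans (hf _ ao) _; rewrite lerD2r; apply: ler_wpM2l; first exact: ltW.
  apply: le_trans (u_bound n).
  have Ei := ip_patch measurable_h h_ge0 (measurable_E k) (uL n) (u_adm n).
  by rewrite Ei lerDr L2ip_ge0.
rewrite /energyQ (form_cut (u_adm n)); move: h1.
move: (frm (out _) _) (frm (inn _) _) (mom _ ^+ 2) => p q r.
by lra.
Qed.

End Cut.

Lemma tails (e : R) : 0 < e -> exists k,
  mom (patch1 v (~` E k)) <= e /\ ip (patch1 v (~` E k)) (patch1 v (~` E k)) <= e.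
Proof.
move=> e0; have [mv v0] := vn.
have nhv : nn (fun x => h x * v x) by exact: nnM.
have nv2 : nn (fun x => v x * v x) by exact: nnM.
(* Summing the two integrands gives a single [k] for both tails. *)
have [k hk] : exists k, (nint m (patch1 (fun x => (h x * v x + v x * v x)%R) (~` E k)) <= e%:E)%E.
  apply: (nint_tail measurable_E E_nd E_cover) => //; first exact: nnD.
  have [m1 p1] := nhv; have [m2 p2] := nv2; rewrite nintD//.
  by rewrite -(momentE measurable_h h_ge0 v_adm) -(L2ipE vL vL) -EFinD ltry.
exists k; have mC := measurableC (measurable_E k).
have [m3 p3] := nn_patch mC (nnD nhv nv2).
have ao := adm_patch measurable_h h_ge0 mC v_adm; have Lo := adm_L2 ao.
split; rewrite -lee_fin.
  rewrite (momentE measurable_h h_ge0 ao); apply: le_trans hk; apply: le_nint => //.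
  - by apply: measurable_funM => //; exact: (adm_nn ao).1.
  - by move=> x; rewrite mulr_ge0// (adm_nn ao).2.
  - by move=> x; rewrite /patch1 mulrA ler_wpM2r// lerDl (nv2.2 x).
rewrite L2ipE//; apply: le_trans hk; apply: le_nint => //.
- by apply: measurable_funM; exact: Lo.1.
- by move=> x; rewrite -expr2 sqr_ge0.
- move=> x; rewrite /patch1 indicE; have := nhv.2 x; case: (_ \in _) => /= ?; rewrite ?mulr0//.
  by rewrite !mulr1 lerDr.
Qed.

Lemma limit_maximizer : 0 < mom v -> (fun n => Q (u n)) @ \oo --> K * a ^+ 2 ->
  mom v = a /\ Q v = K * a ^+ 2.
Proof.
move=> m0 cQ; have [_ vD _ _] := v_adm.
have [_ mva] := weak_limit_moment vn vL vD u_weak.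
apply: (split_moment_arith K_gt0 m0 mva); first exact: hK.
apply/ler_addgt0Pr => e e0.
have L0 : 0 < (2 * lam)^-1 by rewrite invr_gt0 mulr_gt0.
have [t [t0 t1 te]] := small_factor ((2 * lam)^-1 + K * (2 * a + 1)) e0.
have [k [h1 h2]] := tails t0.
have ao := adm_out k v_adm.
apply: (cut_arith K_gt0 L0 _ h1 t1 te h2 m0 mva (moment_cut k v_adm) (energyQ_cut k v_adm) _
  (cut_energy_le k cQ)).
  exact: (moment_ge0 _ measurable_h h_ge0 (adm_nn ao)).
rewrite /energyQ lerBrDr addNr divr_ge0//.
exact: (form_ge0 _ H_ge0 measurable_H (adm_nn ao) (adm_nn ao)).
Qed.

(** * Strong convergence when no moment is lost *)

Section Maximizer.
Hypothesis v_moment : mom v = a.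
Hypothesis v_energy : Q v = K * a ^+ 2.
Hypothesis u_energy : (fun n => Q (u n)) @ \oo --> K * a ^+ 2.

Let moE k : a - mom (patch1 v (E k)) = mom (patch1 v (~` E k)).
Proof. by rewrite -v_moment (moment_cut k v_adm) addrAC subrr add0r. Qed.

(** Pass to the limit in [norm_sqr_cut]; since the energies converge to [Q v], the bound returns
    [ip v v / (2 * lam)] up to two errors. The order of choices matters: [eps] fixes [Ce], which
    fixes the tail size [t], which fixes [k]. *)
Lemma norm_sqr_limsup (e : R) : 0 < e -> \forall n \near \oo, ip (u n) (u n) <= ip v v + e.
Proof.
move=> e0; have L0 : 0 < (2 * lam)^-1 by rewrite invr_gt0 mulr_gt0.
have eL : 0 < e * (2 * lam)^-1 / 4 by rewrite divr_gt0// mulr_gt0.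
have [eps [eps0 eps1 epsC]] := small_factor (C / 2) eL.
have [Ce Ce0 hCe] := hF eps0.
have [t [t0 t1 tC]] := small_factor (Ce / 2) eL.
have [k [h1 h2]] := tails t0.
have ao := adm_out k v_adm.
pose r n := frm (patch1 (u n) (E k)) (fun x => u n x * half_cut k x) + eps * C / 2
  + Ce / 2 * mom (patch1 (u n) (~` E k)) ^+ 2 - Q (u n).
pose l := frm (patch1 v (E k)) (fun x => v x * half_cut k x) + eps * C / 2
  + Ce / 2 * mom (patch1 v (~` E k)) ^+ 2 - Q v.
have cr : r @ \oo --> l.
  rewrite /l v_energy; apply: cvgB => //; rewrite -moE; apply: cvgD.
    by apply: cvgD; [exact: form_inn_cut_cvg|exact: cvg_cst].
  exact: moment_out_sqr_cvg.
have hl : l < (ip v v + e) * (2 * lam)^-1.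
  rewrite /l /energyQ (form_cut k v_adm).
  rewrite (mulrDl (ip v v) e); apply: norm_arith eL _ _ _; last by rewrite -mulrA.
    exact: (form_ge0 m H_ge0 measurable_H (adm_nn ao) (adm_nn ao)).
  apply: le_trans tC; rewrite mulrC; apply: ler_wpM2r; first by rewrite divr_ge0 ?ltW.
  have m0 := moment_ge0 m measurable_h h_ge0 (adm_nn ao).
  by rewrite expr2 -[leRHS]mulr1; apply: ler_pM => //; exact: le_trans h1 t1.
have : \forall n \near \oo, r n < (ip v v + e) * (2 * lam)^-1.
  by apply: (cvgr_lt l).
apply: filterS => n hn.
rewrite -(ler_pM2r L0); apply: le_trans (ltW hn).
exact: norm_sqr_cut eps0 hCe.
Qed.

Lemma strong_convergence : (fun n => ip (u n - v) (u n - v)) @ \oo --> (0 : R).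
Proof.
apply/cvgrPdist_lt => e e0.
have e2 : 0 < e / 2 by rewrite divr_gt0.
have e4 : 0 < e / 4 by rewrite divr_gt0.
have h2 : \forall n \near \oo, ip v v - e / 4 < ip (u n) v.
  by apply: (cvgr_gt _ (u_weak vL)); rewrite ltrBlDr ltrDl.
near=> n; rewrite sub0r normrN ger0_norm ?L2ip_ge0// ip_sqrB//.
have h1 : ip (u n) (u n) <= ip v v + e / 4 by near: n; exact: norm_sqr_limsup.
have : ip v v - e / 4 < ip (u n) v by near: n.
by lra.
Unshelve. all: by end_near. Qed.

(** Inside [E k], Cauchy-Schwarz against the bounded weight. Outside, both functions are estimated
    by their moments: the outer moment of [u n] tends to that of [v] because no moment is lost. *)
Lemma weighted_L1_convergence (e : R) : 0 < e ->
  \forall n \near \oo, (nint m (fun x => h x * `|u n x - v x|)%R <= e%:E)%E.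
Proof.
move=> e0; have e4 : 0 < e / 4 by rewrite divr_gt0.
have [k [h1 _]] := tails e4.
have ao := adm_out k v_adm.
have [M hM] := h_bound k.
have LhE : L2fun m (patch1 h (E k)).
  by apply: (@L2_bounded_patch _ M) => // x Ex; rewrite ger0_norm ?hM.
have LB n : L2fun m (u n - v) by exact: (L2B (uL n) vL).
have LN n : L2fun m (fun x => `|(u n - v) x|).
  apply: (L2_le _ (LB n)) => [|x]; last by rewrite real_normK ?num_real.
  exact: (measurableT_comp (@normr_measurable R setT) (LB n).1).
have c1 : (fun n => ip (patch1 h (E k)) (fun x => `|(u n - v) x|)) @ \oo --> (0 : R).
  apply: (@cvg_sqr0 _ _ _ (ip (patch1 h (E k)) (patch1 h (E k))) _ strong_convergence) => n.
  apply: le_trans (L2_cauchy_schwarz LhE (LN n)) _.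
  apply: lexx_eq; congr (_ * _); apply: ip_eq => x.
  by rewrite -normrM ger0_norm// -expr2 sqr_ge0.
have c2 : (fun n => mom (patch1 (u n) (~` E k))) @ \oo --> mom (patch1 v (~` E k)).
  by rewrite -moE; exact: moment_out_cvg.
have h2 : mom (patch1 v (~` E k)) < e / 2 by lra.
near=> n.
have n1 : ip (patch1 h (E k)) (fun x => `|(u n - v) x|) < e / 4.
  by near: n; exact: (cvgr_lt _ c1).
have n2 : mom (patch1 (u n) (~` E k)) < e / 2 by near: n; exact: (cvgr_lt _ c2).
have aun := adm_out k (u_adm n).
have nhu : nn (fun x => h x * patch1 (u n) (~` E k) x) by apply: nnM => //; exact: adm_nn aun.
have nhv : nn (fun x => h x * patch1 v (~` E k) x) by apply: nnM => //; exact: adm_nn ao.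
have nhN : nn (fun x => patch1 h (E k) x * `|(u n - v) x|).
  by apply: nnM; [exact: nn_patch|split => //; exact: (LN n).1].
apply: (@le_trans _ _ (nint m (fun x => patch1 h (E k) x * `|(u n - v) x|
  + (h x * patch1 (u n) (~` E k) x + h x * patch1 v (~` E k) x))%R)).
  have [m1 p1] := nnD nhN (nnD nhu nhv).
  apply: le_nint => //.
  - apply: measurable_funM => //; exact: (measurableT_comp (@normr_measurable R setT) (LB n).1).
  - by move=> x; apply: mulr_ge0.
  move=> x; have u0 := (un n).2 x; have v0 := vn.2 x; have hx := h_ge0 x.
  rewrite /patch1 (_ : (u n - v) x = u n x - v x)// !indicE in_setC; case: (_ \in _) => /=.
    by rewrite !mulr1 !mulr0 !addr0.
  rewrite mulr0 mul0r add0r !mulr1 -mulrDr; apply: ler_wpM2l => //.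
  by rewrite ler_norml; apply/andP; split; lra.
have [m1 p1] := nhN; have [m2 p2] := nnD nhu nhv; have [m3 p3] := nhu; have [m4 p4] := nhv.
rewrite nintD// nintD// -(momentE measurable_h h_ge0 ao) -(momentE measurable_h h_ge0 aun).
by rewrite -L2ipE// -!EFinD lee_fin; lra.
Unshelve. all: by end_near. Qed.

End Maximizer.
End Limit.
End Sequence.
End Compactness.

(** * The variational problem in the half-plane *)

Section HalfPlane.
Variable R : realType.
Local Notation RT := (measurableTypeR R).
Local Notation leb2 := (@lebesgue2 R).
Local Notation Pi := (@Pi R).
Local Notation Hk := (@greenPi R).
Local Notation nn := (@nonneg_mfun _ (RT * RT)%type R).
Local Notation ip := (L2ip leb2).

(** The absolute value makes the weight nonnegative on the whole plane; on [Pi] it is [x.2]. *)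
Definition height (x : R * R) : R := `|x.2|.
(** The window follows [x] only horizontally: within [Pi] it is a bounded rectangle resting on the
    boundary, whatever the height of [x]. *)
Definition strip (x : R * R) (L : R) : set (R * R) := [set y | `|x.1 - y.1| < L /\ y.2 < L].

Let H0 (x y : RT * RT) : 0 <= Hk x y. Proof. exact: greenPi_ge0. Qed.
Let Hs (x y : RT * RT) : Hk x y = Hk y x. Proof. exact: greenPi_sym. Qed.
Let mH := @measurable_greenPi R.
Let Hi (x : RT * RT) : (nint leb2 (Hk x) <= 1)%E. Proof. exact: integral_greenPi. Qed.

Lemma measurable_height : measurable_fun setT (height : RT * RT -> R).
Proof. by rewrite /height; meas. Qed.

Lemma height_ge0 x : 0 <= height x. Proof. exact: normr_ge0. Qed.

Lemma heightE x : Pi x -> height x = x.2. Proof. by move=> /ltW h; exact: ger0_norm. Qed.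

Lemma height_gt0 x : Pi x -> 0 < height x.
Proof. by move=> Px; rewrite heightE. Qed.

Lemma measurable_strip x L : measurable (strip x L : set (RT * RT)).
Proof.
have -> : strip x L = `]x.1 - L, x.1 + L[%classic `*` `]-oo, L[%classic.
  apply/seteqP; split => y; rewrite /strip /= !in_itv/= !ltr_norml.
    by move=> [/andP[h1 h2] h3]; split => //; apply/andP; split; lra.
  by move=> [/andP[h1 h2] h3]; split => //; apply/andP; split; lra.
by apply: measurableX; exact: measurable_itv.
Qed.

Local Notation adm := (@admissible _ (RT * RT)%type R leb2 height Pi).
Local Notation form := (form leb2 Hk).
Local Notation moment := (moment leb2 height).

Lemma measurable_sub2 : measurable_fun setT (fun p : (RT * RT) * (RT * RT) => p.1 - p.2).
Proof.
rewrite (_ : (fun _ => _) = (fun p : (RT * RT) * (RT * RT) => (p.1.1 - p.2.1, p.1.2 - p.2.2))).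
  by meas.
by apply/funext => -[[a b] [c e]].
Qed.

(** Cutting the times at s = eps, that is at [a = ln eps], gives the head an integral of at most
    [eps]. *)
Lemma kernel_head (eps : R) : 0 < eps -> exists (hd : RT * RT -> RT * RT -> \bar R) (C : R),
  [/\ [/\ measurable_fun setT (fun p : (RT * RT) * (RT * RT) => hd p.1 p.2),
      forall x y, (0 <= hd x y)%E, forall x y, hd x y = hd y x &
      forall x, (\int[leb2]_y hd x y <= eps%:E)%E],
      0 < C,
      forall x y, Pi x -> Pi y -> ((Hk x y)%:E <= hd x y + (height x * (height y * C))%:E)%E &
      far_small Hk height Pi strip hd].
Proof.
move=> e0; exists (fun x y => head_kernel (ln eps) (x - y)), (expR (- (2 * ln eps))).
split; [split| | |].
- exact: (measurableT_comp (@measurable_head_kernel R (ln eps)) measurable_sub2).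
- by move=> x y; exact: head_kernel_ge0.
- by move=> x y; rewrite -opprB; exact: head_kernelN.
- move=> x; have e := @leb2_subl R x _ (@measurable_head_kernel R (ln eps)) (head_kernel_ge0 _).
  rewrite e; apply: le_trans (@integral_head_kernel R (ln eps)) _.
  by rewrite lnK.
- exact: expR_gt0.
- move=> x y Px Py; rewrite (heightE Px) (heightE Py).
  have := greenPi_le_head (ln eps) Px Py.
  by have -> : expR (- (2 * ln eps)) * (x.2 * y.2) = x.2 * (y.2 * expR (- (2 * ln eps))) by ring.
- move=> eta eta0; have [L L0 hL] := @greenPi_le_head_small R (ln eps) eta eta0.
  exists L => x y Px Py nB; rewrite (heightE Px) (heightE Py).
  have -> : x.2 * (y.2 * eta) = eta * (x.2 * y.2) by ring.
  by apply: hL => //; have /not_andP[/negP|/negP] := nB; rewrite -leNgt => h; [left|right].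
Qed.

Lemma kernel_test (eta : R) : 0 < eta -> eta <= 1 -> exists f,
  [/\ adm f, 0 < ip f f & (1 - eta) * ip f f <= form f f].
Proof.
move=> eta0 eta1; have [L L0 hL] := greenPi_box eta0 eta1.
pose f : RT * RT -> R := \1_(box L L).
have mf : measurable_fun setT f := @measurable_indic_box R L L.
have f0 x : 0 <= f x by [].
have nf : nn f by [].
have ff x : f x * f x = f x.
  by rewrite /f indicE; case: (_ \in _); rewrite ?mulr1 ?mulr0.
have If : nint leb2 f = (4 * L ^+ 2)%:E := @integral_indic_box R L L L0.
have Lf : L2fun leb2 f.
  split => //; have -> : nint leb2 (fun x => f x ^+ 2) = nint leb2 f.
    by apply: eq_nint => x; rewrite expr2 ff.
  by rewrite If ltry.
have ipf : ip f f = 4 * L ^+ 2.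
  by apply: EFin_inj; rewrite L2ipE// -If; apply: eq_nint => x; exact: ff.
have af : adm f.
  split => //.
    move=> x nP; rewrite /f indicE memNset// => -[_]; rewrite ltr_norml => /andP[h _].
    by apply: nP; rewrite /Defs.Pi /=; lra.
  apply: (@le_lt_trans _ _ (nint leb2 (fun x => 2 * L * f x))).
    apply: le_nint.
    - by apply: measurable_funM => //; exact: measurable_height.
    - exact: measurable_funM.
    - by move=> x; rewrite mulr_ge0// height_ge0.
    - move=> x; rewrite /f indicE; have [Bx|Bx] := pselect (box L L x); last first.
        by rewrite memNset// !mulr0.
      rewrite mem_set// !mulr1; case: Bx => _; rewrite ltr_norml => /andP[h1 h2].
      by rewrite /height ler_norml; apply/andP; split; lra.
  rewrite nintZ//; last by rewrite mulr_ge0// ltW.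
  by rewrite If -EFinM ltry.
exists f; split => //; first by rewrite ipf mulr_gt0// exprn_gt0.
rewrite -lee_fin ipf.
rewrite (formE H0 Hs mH Hi af af).
by rewrite (eformE leb2 H0 mH nf nf).
Qed.

Variable lam : R.
Hypothesis lam1 : 1 < lam.
Local Notation Q := (@energyQ _ (RT * RT)%type R leb2 Hk lam).

Definition sharp_constant : R := @maxQ _ (RT * RT)%type R leb2 Hk height Pi lam.
Local Notation S := sharp_constant.

Lemma energy_le_sharp f : adm f -> Q f <= S * moment f ^+ 2.
Proof.
exact: (energyQ_le_maxQ H0 Hs mH Hi measurable_height height_ge0 lam1 kernel_head kernel_test).
Qed.

Lemma sharp_constant_gt0 : 0 < S.
Proof. exact: (maxQ_gt0 H0 Hs mH Hi measurable_height height_ge0 lam1 kernel_head kernel_test). Qed.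

Lemma sharp_approx (a e : R) : 0 < a -> 0 < e ->
  exists f, [/\ adm f, moment f = a & S * a ^+ 2 - e < Q f].
Proof.
move=> a0 e0.
exact: (maxQ_approx H0 Hs mH Hi measurable_height height_ge0 lam1 kernel_head kernel_test a0 e0).
Qed.

Lemma sharp_competitor : exists2 M : R, 0 < M & forall (a : R) f, 0 < a ->
  adm f -> moment f = a -> S * a ^+ 2 / 2 <= Q f ->
  exists g, [/\ adm g, moment g = a, Q f <= Q g & (nint leb2 g <= (M * a)%:E)%E].
Proof.
have mB := measurableT_comp (@measurable_boundary_kernel R) measurable_sub2.
have C0 : 0 <= 12 * expR 1 :> R by rewrite mulr_ge0// expR_ge0.
have bi (x : RT * RT) : (\int[leb2]_y boundary_kernel (x - y)%R <= (12 * expR 1)%:E)%E.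
  have e := @leb2_subl R x _ (@measurable_boundary_kernel R) (@boundary_kernel_ge0 R).
  by rewrite e; exact: integral_boundary_kernel.
have bs (x y : RT * RT) : boundary_kernel (x - y) = boundary_kernel (y - x).
  by rewrite -opprB; exact: boundary_kernelN.
have bH (x y : RT * RT) : Pi x ->
    ((Hk x y)%:E <= (height x)%:E * boundary_kernel (x - y)%R)%E.
  by move=> Px; rewrite (heightE Px); exact: greenPi_le_boundary.
exact: (@bounded_mass_competitor _ _ _ leb2 Hk H0 Hs mH Hi height Pi measurable_height
  height_ge0 lam lam1 strip
  kernel_head kernel_test height_gt0 (fun x y => boundary_kernel (x - y)) _ C0
  mB (fun x y => boundary_kernel_ge0 (x - y)) bs bi bH).
Qed.

Lemma sharp_nonvanishing (q0 a : R) : 0 < q0 -> 0 < a -> exists (L beta : R), 0 < beta /\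
  forall f, adm f -> moment f <= a -> q0 <= Q f ->
  exists x, Pi x /\ (beta%:E <= nint leb2 (fun y => height y * f y * \1_(strip x L) y)%R)%E.
Proof.
exact: (@nonvanishing _ _ _ leb2 Hk H0 Hs mH Hi height Pi measurable_height
  height_ge0 lam lam1 strip
  measurable_strip kernel_head q0 a).
Qed.

(** * Functionals on the half-plane in terms of extensions by zero *)

Local Notation zext w := (patch1 w Pi : RT * RT -> R).

Lemma measurable_zext w : measurable_fun (Pi : set (RT * RT)) w -> measurable_fun setT (zext w).
Proof.
move=> mw; have := (measurable_restrictT w (@measurable_Pi R)).1 mw.
rewrite (_ : patch _ _ _ = zext w)//; apply/funext => x; rewrite /patch /patch1 indicE.
by case: (x \in _); rewrite ?mulr1 ?mulr0.
Qed.

Lemma zextE w x : Pi x -> zext w x = w x.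
Proof. by move=> Px; rewrite /patch1 indicE (mem_set Px) mulr1. Qed.

Lemma zext_off w x : ~ Pi x -> zext w x = 0.
Proof. by move=> Px; rewrite /patch1 indicE (memNset Px) mulr0. Qed.

Lemma zext_id f : (forall x, ~ Pi x -> f x = 0) -> zext f = f.
Proof.
by move=> f0; apply/funext => x; have [/zextE//|h] := pselect (Pi x); rewrite zext_off// f0.
Qed.

Lemma intPiE (F g : R * R -> \bar R) : (forall x, Pi x -> F x = g x) ->
  (forall x, ~ Pi x -> g x = 0%E) -> intPi F = (\int[leb2]_x g x)%E.
Proof.
move=> hF h; rewrite /intPi lebesgue2E integral_mkcond; apply: eq_integral => x _.
rewrite /patch; case: ifPn => [/set_mem/hF//|/negP nP].
by rewrite h// => Px; apply: nP; exact: mem_set.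
Qed.

Lemma intPi_nint (F : R * R -> \bar R) (g : R * R -> R) : (forall x, Pi x -> F x = (g x)%:E) ->
  (forall x, ~ Pi x -> g x = 0) -> intPi F = nint leb2 g.
Proof. by move=> hF h; apply: intPiE => // x /h ->. Qed.

Lemma massE w : mass w = nint leb2 (zext w).
Proof.
by apply: intPi_nint => x Px; [rewrite (zextE _ Px)|exact: zext_off].
Qed.

Lemma impulseE w : impulse w = nint leb2 (fun x => height x * zext w x).
Proof.
apply: intPi_nint => x Px; first by rewrite (zextE _ Px) (heightE Px).
by rewrite (zext_off _ Px) mulr0.
Qed.

Lemma sqL2E w : sqL2 w = nint leb2 (fun x => zext w x ^+ 2).
Proof.
apply: intPi_nint => x Px; first by rewrite (zextE _ Px).
by rewrite (zext_off _ Px) expr0n.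
Qed.

(** The kernels [GPi x] and [greenPi x] differ on [Pi] only at [y = x]. The term with coefficient
    [c] records this discrepancy so that it can be discarded as supported on a null set. *)
Lemma GopE w x : nn (zext w) -> Pi x -> Gop w x = pot leb2 Hk (zext w) x.
Proof.
move=> nw Px; pose c := GPi x x * zext w x.
pose g (y : RT * RT) := Hk x y * zext w y + c * \1_[set x] y.
have -> : Gop w x = nint leb2 g.
  apply: intPi_nint => y Py; rewrite /g.
    rewrite indicE; have [yx|yx] := eqVneq y x.
      by rewrite mem_set// yx greenPi_diag mul0r add0r mulr1 /c (zextE _ Px).
    rewrite memNset; last by move=> h; rewrite h eqxx in yx.
    by rewrite mulr0 addr0 (zextE _ Py) greenPi_GPi// eq_sym.
  rewrite (zext_off _ Py) mulr0 add0r indicE memNset ?mulr0//.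
  by move=> h; rewrite h in Py.
have mk : measurable_fun setT (fun y : RT * RT => Hk x y * zext w y).
  by apply: measurable_funM; [exact: measurable_greenPi2|exact: nw.1].
apply: ae_eq_integral => //.
- apply/measurable_EFinP; apply: measurable_funD => //; apply: measurable_funM => //.
  by apply: measurable_indic; exact: measurable_set1x.
- exact/measurable_EFinP.
exists [set x]; split; [exact: measurable_set1x|exact: lebesgue2_set1|].
move=> y /=; apply: contra_notP => yx _.
by rewrite /g indicE memNset// mulr0 addr0.
Qed.

Lemma adm_zext w : inL2 w -> nonneg_on_Pi w -> (impulse w < +oo)%E -> adm (zext w).
Proof.
move=> [mw fin] w0 im; have mz := measurable_zext mw.
split.
- split => // x; have [Px|Px] := pselect (Pi x); last by rewrite zext_off.
  by rewrite (zextE _ Px); exact: w0.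
- by move=> x; exact: zext_off.
- by split => //; rewrite -sqL2E.
- by rewrite -impulseE.
Qed.

Lemma energyE w : adm (zext w) -> energy w = (form (zext w) (zext w) / 2)%:E.
Proof.
move=> aw; rewrite /energy; have nw := adm_nn aw.
have -> : intPi (fun x => (w x)%:E * Gop w x)%E = eform leb2 Hk (zext w) (zext w).
  apply: intPiE => x Px; first by rewrite (GopE nw Px) (zextE _ Px).
  by rewrite (zext_off _ Px) mul0e.
by rewrite -(formE H0 Hs mH Hi aw aw) -EFinM mulrC.
Qed.

Lemma ElamE w : adm (zext w) -> Elam lam w = (Q (zext w))%:E.
Proof.
move=> aw; rewrite /Elam (energyE aw) sqL2E (nint_sqr (adm_L2 aw)) -EFinM -EFinB.
by rewrite /energyQ [_^-1 * _]mulrC.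
Qed.

Lemma adm_inL2 f : adm f -> inL2 f.
Proof.
move=> af; have [[mf f0] fD [_ Lf] _] := af; split; first exact: measurable_funTS.
by rewrite sqL2E zext_id.
Qed.

Lemma adm_impulse f : adm f -> impulse f = (moment f)%:E.
Proof.
by move=> af; have [_ fD _ _] := af;
rewrite impulseE (zext_id fD) (momentE measurable_height height_ge0 af).
Qed.

Lemma adm_mass f : adm f -> mass f = nint leb2 f.
Proof. by move=> [_ fD _ _]; rewrite massE zext_id. Qed.

Lemma adm_Elam f : adm f -> Elam lam f = (Q f)%:E.
Proof. by move=> af; have [_ fD _ _] := af; rewrite ElamE zext_id. Qed.

Lemma adm_Aclass f (a nu : R) : adm f -> moment f = a -> (nint leb2 f <= nu%:E)%E ->
  Aclass a nu f.
Proof.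
move=> af mf hm; split; [exact: adm_inL2|split; [|split]].
- by move=> x _; exact: (adm_nn af).2.
- by rewrite adm_impulse// mf.
- by rewrite adm_mass.
Qed.

Lemma SvalE : exists2 M : R, 0 < M & forall a nu, 0 < a -> M * a <= nu ->
  Sval a nu lam = (S * a ^+ 2)%:E.
Proof.
have [M M0 hM] := sharp_competitor; exists M => // a nu a0 anu.
apply/eqP; rewrite eq_le; apply/andP; split.
  apply: ge_ereal_sup => _ [w [iw [w0 [im _]]] <-].
  have aw : adm (zext w) by apply: adm_zext => //; rewrite im ltry.
  rewrite ElamE// lee_fin; apply: le_trans (energy_le_sharp aw) _.
  suff -> : moment (zext w) = a by [].
  by apply: EFin_inj; rewrite (momentE measurable_height height_ge0 aw) -impulseE.
have P0 : 0 < S * a ^+ 2 by rewrite mulr_gt0 ?sharp_constant_gt0 ?exprn_gt0.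
apply/lee_addgt0Pr => e e0.
(* The second bound keeps the energy above half of the maximum, as the replacement by a competitor
   of bounded mass requires. *)
have d0 : 0 < Num.min e (S * a ^+ 2 / 2) by rewrite lt_min e0 divr_gt0.
have [f [af mf hf]] := sharp_approx a0 d0.
have h1 : Num.min e (S * a ^+ 2 / 2) <= e by rewrite ge_min lexx.
have h2 : Num.min e (S * a ^+ 2 / 2) <= S * a ^+ 2 / 2 by rewrite ge_min lexx orbT.
have [g [ag mg fg hg]] : exists g, [/\ adm g, moment g = a, Q f <= Q g &
    (nint leb2 g <= (M * a)%:E)%E].
  by apply: hM => //; lra.
apply: (@le_trans _ _ (Elam lam g + e%:E)%E).
  by rewrite adm_Elam// -EFinD lee_fin; lra.
apply: leeD => //; apply: ereal_sup_ubound; exists g => //.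
by apply: adm_Aclass => //; apply: le_trans hg _; rewrite lee_fin.
Qed.

(** * Invariance under translations along the boundary *)

Section Shift.
Variable c : R.
Let tr (f : RT * RT -> R) (x : RT * RT) : R := f (x + (c, 0)).

Lemma Pi_shift x : Pi (x + (c, 0)) <-> Pi x.
Proof. by rewrite /Defs.Pi /= addr0. Qed.

Lemma height_shift x : height (x + (c, 0)) = height x.
Proof. by rewrite /height /= addr0. Qed.

Lemma measurable_shift (f : RT * RT -> R) : measurable_fun setT f -> measurable_fun setT (tr f).
Proof.
move=> mf; rewrite (_ : tr f = f \o (fun x : RT * RT => (x.1 + c, x.2))).
  by apply: (measurableT_comp mf); meas.
by apply/funext => -[a b]; rewrite /tr /=; congr (f (_, _)); exact: addr0.
Qed.

Lemma nint_shift f : nn f -> nint leb2 (tr f) = nint leb2 f.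
Proof.
move=> [mf f0]; apply: (@leb2_translate R (c, 0) (fun x => (f x)%:E)).
  exact/measurable_EFinP.
by move=> x; rewrite lee_fin.
Qed.

Lemma nn_shift f : nn f -> nn (tr f).
Proof. by move=> [mf f0]; split => [|x]; [exact: measurable_shift|exact: f0]. Qed.

Lemma nint_weighted_shift f : nn f ->
  nint leb2 (fun x => height x * tr f x) = nint leb2 (fun x => height x * f x).
Proof.
move=> nf; rewrite -(nint_shift (f := fun x => height x * f x)).
  by apply: eq_nint => x; rewrite /tr height_shift.
by apply: nnM => //; split; [exact: measurable_height|exact: height_ge0].
Qed.

Lemma nint_sqr_shift f : nn f -> nint leb2 (fun x => tr f x ^+ 2) = nint leb2 (fun x => f x ^+ 2).
Proof.
move=> [mf f0]; rewrite -(nint_shift (f := fun x => f x ^+ 2))//; split.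
  exact: measurable_funX.
by move=> x; exact: sqr_ge0.
Qed.

Lemma adm_shift f : adm f -> adm (tr f).
Proof.
move=> [nf fD Lf fin]; split.
- exact: nn_shift.
- by move=> x nP; apply: fD => /Pi_shift.
- by split; [exact: (nn_shift nf).1|rewrite nint_sqr_shift//; exact: Lf.2].
- by rewrite nint_weighted_shift.
Qed.

Lemma moment_shift f : adm f -> moment (tr f) = moment f.
Proof.
by move=> af; congr fine; apply: nint_weighted_shift; exact: (adm_nn af).
Qed.

Lemma ip_shift f : adm f -> ip (tr f) (tr f) = ip f f.
Proof.
move=> af; have Ls := adm_L2 (adm_shift af); have Lf := adm_L2 af.
by apply: EFin_inj; rewrite -(nint_sqr Ls) -(nint_sqr Lf) nint_sqr_shift//; exact: (adm_nn af).
Qed.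

Lemma form_shift f : adm f -> form (tr f) (tr f) = form f f.
Proof.
move=> af; have nf := adm_nn af; congr fine.
have P x : pot leb2 Hk (tr f) x = pot leb2 Hk f (x + (c, 0)).
  rewrite /pot -(nint_shift (f := fun y => Hk (x + (c, 0)) y * f y)).
    by apply: eq_nint => y; rewrite /tr greenPi_translate.
  exact: (pot_integrand H0 mH).
rewrite /eform; under eq_integral do rewrite P.
apply: (@leb2_translate R (c, 0) (fun x => (f x)%:E * pot leb2 Hk f x)%E).
  apply: emeasurable_funM; first by apply/measurable_EFinP; exact: nf.1.
  exact: (measurable_pot leb2 H0 mH nf).
move=> x; apply: mule_ge0; first by rewrite lee_fin nf.2.
exact: (pot_ge0 leb2 H0 mH).
Qed.

Lemma energyQ_shift f : adm f -> Q (tr f) = Q f.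
Proof. by move=> af; rewrite /energyQ (form_shift af) (ip_shift af). Qed.

End Shift.

(** * Compactness of concentrated maximizing sequences *)

Let E k : set (RT * RT) := box 0 k.+1%:R.

Let mE k : measurable (E k). Proof. exact: measurable_box. Qed.

Let E_nd k l : (k <= l)%N -> E k `<=` E l. Proof. exact: box_nd. Qed.

Let E_cover : \bigcup_k E k = setT. Proof. exact: box_cover. Qed.

Let E_fin k : (leb2 (E k) < +oo)%E.
Proof. by rewrite lebesgue2_box// ltry. Qed.

Let h_bound k : exists M, forall x, E k x -> height x <= M.
Proof. by exists k.+1%:R => x [_]; rewrite subr0 => /ltW. Qed.

Lemma concentrated_compactness (u : nat -> RT * RT -> R) (C a nu L beta : R) :
  0 < L -> 0 < beta -> (forall n, adm (u n)) -> (forall n, ip (u n) (u n) <= C) ->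
  (fun n => moment (u n)) @ \oo --> a -> (fun n => Q (u n)) @ \oo --> S * a ^+ 2 ->
  (forall n, (beta%:E <= nint leb2 (fun x => height x * u n x * \1_(box 0 L) x)%R)%E) ->
  (forall n, (nint leb2 (u n) <= nu%:E)%E) ->
  exists (nk : nat -> nat) v, [/\ forall k, (nk k < nk k.+1)%N,
    [/\ adm v, moment v = a, Q v = S * a ^+ 2 & (nint leb2 v <= nu%:E)%E],
    (fun k => ip (u (nk k) - v) (u (nk k) - v)) @ \oo --> (0 : R) &
    forall e : R, 0 < e -> \forall k \near \oo,
      (nint leb2 (fun x => height x * `|u (nk k) x - v x|)%R <= e%:E)%E].
Proof.
move=> L0 beta0 uA uC uM uQ uL uN.
have [nk [v0 [nkS Lv0 wv0]]] := L2_weak_compactness (fun n => adm_L2 (uA n)) uC.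
have nk_ge k : (k <= nk k)%N by elim: k => // k ih; exact: leq_ltn_trans ih (nkS k).
have nky : nk @ \oo --> \oo.
  by apply/cvgnyPge => A; near=> n; apply: leq_trans (nk_ge n); near: n; exact: nbhs_infty_ge.
pose us k := u (nk k).
have usA k : adm (us k) by exact: uA.
have usC k : ip (us k) (us k) <= C by exact: uC.
have usM : (fun k => moment (us k)) @ \oo --> a by exact: (cvg_comp _ _ nky uM).
have usQ : (fun k => Q (us k)) @ \oo --> S * a ^+ 2 by exact: (cvg_comp _ _ nky uQ).
have [v [nv vD Lv wv]] := weak_limit_nonneg (@measurable_Pi R) usA Lv0 wv0.
have [av mva] := weak_limit_moment measurable_height height_ge0 mE E_nd E_cover E_fin
  h_bound usA usM nv Lv vD wv.
(* The weight restricted to the fixed box is an L^2 test function, so the moment [beta] in that box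
   survives in the weak limit. *)
have vm : 0 < moment v.
  have LhE : L2fun leb2 (patch1 height (box 0 L)).
    apply: (@L2_bounded_patch _ _ _ leb2 (fun _ => box 0 L) _ _ height L 0%N) => //.
    - by move=> _; exact: measurable_box.
    - by move=> _; rewrite lebesgue2_box// ltry.
    - exact: measurable_height.
    - by move=> x [_]; rewrite subr0 /height normr_id => /ltW.
  have b1 : beta <= ip v (patch1 height (box 0 L)).
    apply: (cvgr_to_ge (wv _ LhE)); apply: nearW => k; rewrite -lee_fin L2ipE//; last first.
      exact: adm_L2.
    apply: le_trans (uL (nk k)) _; apply: lexx_eq.
    by apply: eq_nint => x; rewrite /patch1 /us; ring.
  apply: lt_le_trans beta0 (le_trans b1 _).
  rewrite -lee_fin L2ipE// (momentE measurable_height height_ge0 av); apply: le_nint.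
  - by apply: measurable_funM; [exact: nv.1|exact: LhE.1].
  - by apply: measurable_funM; [exact: measurable_height|exact: nv.1].
  - by move=> x; rewrite !mulr_ge0 ?nv.2 ?height_ge0.
  - move=> x; rewrite mulrC /patch1; apply: ler_wpM2r; first exact: nv.2.
    by apply: ler_piMr; [exact: height_ge0|have /andP[] := indic01 R (box 0 L) x].
have lam0 : 0 < lam := lt_trans ltr01 lam1.
have hS := @integral_greenPi_sqr R.
have S0 := sharp_constant_gt0.
have SQ f : adm f -> Q f <= S * moment f ^+ 2 by exact: energy_le_sharp.
have hF (eps : R) : 0 < eps -> exists2 C : R, 0 < C &
    forall f, adm f -> form f f <= eps * ip f f + C * moment f ^+ 2.
  by move=> e0; exact: (form_le_moment H0 Hs mH Hi measurable_height height_ge0 kernel_head e0).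
have [vM vQ] := limit_maximizer H0 Hs mH Hi hS measurable_height height_ge0 lam0 S0 SQ mE E_nd
  E_cover E_fin h_bound usA usC usM av wv vm usQ.
exists nk, v; split => //.
- split => //; rewrite (_ : nint leb2 v = nint leb2 (fun x => 1 * v x)); last first.
    by apply: eq_nint => x; rewrite mul1r.
  apply: (weak_limit_integral mE E_nd E_cover E_fin usA nv Lv wv).
  + by split => //; exact: measurable_cst.
  + by move=> k; exists 1.
  + move=> b nub; apply: nearW => k; under eq_nint do rewrite mul1r.
    by apply: le_trans (uN (nk k)) _; rewrite lee_fin ltW.
- exact: (strong_convergence H0 Hs mH Hi hS measurable_height height_ge0 lam0 hF mE E_nd
    E_cover E_fin h_bound usA usC usM av wv vM vQ usQ).
- exact: (weighted_L1_convergence H0 Hs mH Hi hS measurable_height height_ge0 lam0 hF mE E_nd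
    E_cover E_fin h_bound usA usC usM av wv vM vQ usQ).
Unshelve. all: by end_near. Qed.

End HalfPlane.

Lemma cvge0_ge0 (R : realType) (f : nat -> \bar R) : (forall n, (0 <= f n)%E) ->
  (forall e : R, 0 < e -> \forall n \near \oo, (f n <= e%:E)%E) -> f @ \oo --> (0 : R)%:E.
Proof.
move=> f0 fe; have fin n (e : R) : (f n <= e%:E)%E -> f n \is a fin_num.
  by move=> h; rewrite ge0_fin_numE//; apply: le_lt_trans h _; rewrite ltry.
apply/fine_cvgP; split; first by apply: filterS (fe 1 ltr01) => n; exact: fin.
apply/cvgrPdist_le => e e0; apply: filterS (fe e e0) => n h.
rewrite sub0r normrN /= ger0_norm ?fine_ge0//.
by rewrite -lee_fin fineK//; exact: fin h.
Qed.

Theorem theorem5p1 (R : realType) (lam mu : R) :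
  1 < lam -> 0 < mu ->
  exists nu0 : R, mu * rho lam < nu0 /\
  forall nu : R, nu0 <= nu ->
  forall w : nat -> R * R -> R,
    (forall n, nonneg_on_Pi (w n)) ->
    (forall n, inL1 (w n) /\ inL2 (w n)) ->
    (forall n, (mass (w n) <= nu%:E)%E) ->
    (exists C : R, forall n, (sqL2 (w n) <= (C ^+ 2)%:E)%E) ->
    (fun n => impulse (w n)) @ \oo --> mu%:E ->
    (fun n => Elam lam (w n)) @ \oo --> Sval mu nu lam ->
    exists om : R * R -> R, Sigma mu nu lam om /\
    exists (nk : nat -> nat) (c : nat -> R),
      (forall k, (nk k < nk k.+1)%N) /\
      (fun k => intPi (fun x => ((shift1 (w (nk k)) (c k) x - om x) ^+ 2)%:E))
        @ \oo --> (0 : R)%:E /\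
      (fun k => intPi (fun x => (`|x.2 * shift1 (w (nk k)) (c k) x - x.2 * om x|)%:E))
        @ \oo --> (0 : R)%:E.
Proof.
(* Above M * mu the mass constraint is inactive; the second term is only there for nu0 > mu rho. *)
move=> lam1 mu0; have [M M0 hM] := SvalE lam1.
exists (Num.max (M * mu) (mu * rho lam + 1)); split; first by rewrite lt_max ltrDl ltr01 orbT.
move=> nu; rewrite ge_max => /andP[Mnu _] w w0 wL wm [C wC] wI.
rewrite (hM mu nu mu0 Mnu); set S := sharp_constant lam => wE.
have P0 : 0 < S * mu ^+ 2 / 2 by rewrite divr_gt0// mulr_gt0 ?sharp_constant_gt0 ?exprn_gt0.
move/fine_cvgP : wI => [I1 I2]; move/fine_cvgP : wE => [_ E2].
(* The first terms may have infinite impulse or low energy; they are dropped, so that each remaining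
   term is admissible and subject to nonvanishing with moment bound [2 * mu] and energy threshold
   [S * mu ^+ 2 / 2]. *)
have [N _ hN] : \forall n \near \oo, [/\ impulse (w n) \is a fin_num,
    fine (impulse (w n)) < 2 * mu & S * mu ^+ 2 / 2 < fine (Elam lam (w n))].
  near=> n; split; first by near: n.
    by near: n; apply: (cvgr_lt _ I2); lra.
  by near: n; apply: (cvgr_gt _ E2); lra.
pose wN n := w (n + N)%N; pose u0 n := patch1 (wN n) (@Pi R).
have hNn n : [/\ impulse (wN n) \is a fin_num, fine (impulse (wN n)) < 2 * mu
    & S * mu ^+ 2 / 2 < fine (Elam lam (wN n))] by apply: hN; rewrite /= leq_addl.
have u0A n : admissible (@lebesgue2 R) (@height R) (@Pi R) (u0 n).
  apply: (adm_zext (wL _).2 (w0 _)).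
  by have [fin _ _] := hNn n; rewrite -(fineK fin) ltry.
have u0M n : moment (@lebesgue2 R) (@height R) (u0 n) = fine (impulse (wN n)).
  by rewrite impulseE.
have u0Q n : energyQ (@lebesgue2 R) (@greenPi R) lam (u0 n) = fine (Elam lam (wN n)).
  by rewrite (ElamE lam (u0A n)).
have [L [beta [beta0 hL]]] := sharp_nonvanishing lam1 P0 (mulr_gt0 (ltr0Sn R 1) mu0).
have /choice[x0 hx0] n : exists x, Pi x /\ (beta%:E <= nint (@lebesgue2 R)
    (fun y => height y * u0 n y * \1_(strip x L) y)%R)%E.
  by apply: hL => //; have [_ h1 h2] := hNn n; rewrite ?u0M ?u0Q ltW.
(* The shift brings the window carrying moment [beta] over the origin. *)
pose c n := (x0 n).1; pose u n (y : R * R) := u0 n (y + (c n, 0)).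
have uA n : admissible (@lebesgue2 R) (@height R) (@Pi R) (u n) by exact: adm_shift.
have uM : (fun n => moment (@lebesgue2 R) (@height R) (u n)) @ \oo --> mu.
  have -> : (fun n => moment (@lebesgue2 R) (@height R) (u n)) =
      (fun n => (fine \o (fun n => impulse (w n))) (n + N)%N).
    by apply/funext => n; rewrite /u moment_shift// u0M.
  by rewrite (cvg_shiftn N (fine \o (fun n => impulse (w n)))).
have uQ : (fun n => energyQ (@lebesgue2 R) (@greenPi R) lam (u n)) @ \oo --> S * mu ^+ 2.
  have -> : (fun n => energyQ (@lebesgue2 R) (@greenPi R) lam (u n)) =
      (fun n => (fine \o (fun n => Elam lam (w n))) (n + N)%N).
    by apply/funext => n; rewrite /u energyQ_shift// u0Q.
  by rewrite (cvg_shiftn N (fine \o (fun n => Elam lam (w n)))).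
have uC n : L2ip (@lebesgue2 R) (u n) (u n) <= C ^+ 2.
  rewrite /u ip_shift// -lee_fin -(nint_sqr (adm_L2 (u0A n))) -sqL2E.
  exact: wC.
have uN n : (nint (@lebesgue2 R) (u n) <= nu%:E)%E.
  by rewrite /u nint_shift; [rewrite -massE; exact: wm|exact: (adm_nn (u0A n))].
(* Nothing is known about the sign of [L]; a box of half-side [|L| + 1] contains the part in [Pi] of
   every shifted strip. *)
have L'0 : 0 < `|L| + 1 by apply: ltr_wpDl.
have uL n : (beta%:E <= nint (@lebesgue2 R)
    (fun y => height y * u n y * \1_(box 0 (`|L| + 1)) y)%R)%E.
  have [Px hx] := hx0 n; apply: le_trans hx _.
  have n0 := adm_nn (u0A n); have nh : nonneg_mfun (@height R).
    by split; [exact: measurable_height|exact: height_ge0].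
  have ns := nn_patch (measurable_strip (x0 n) L) (nnM nh n0).
  have nb := nn_patch (@measurable_box R 0 (`|L| + 1)) (nnM nh (adm_nn (uA n))).
  rewrite -(nint_shift (c n) ns); apply: le_nint.
  - exact: (nn_shift (c n) ns).1.
  - exact: nb.1.
  - exact: (nn_shift (c n) ns).2.
  move=> y; rewrite height_shift -/(u n y).
  have [Py|Py] := pselect (Pi y); last first.
    by have [_ -> // _ _] := uA n; rewrite !mulr0 !mul0r.
  apply: ler_wpM2l; first by rewrite mulr_ge0 ?height_ge0 ?(adm_nn (uA n)).2.
  rewrite !indicE; case: (y \in box _ _) / asboolP => [_|nB]; first by case: (_ \in _).
  rewrite memNset// => -[h1 h2]; apply: nB.
  have lL := ler_norm L; have Py2 : 0 < y.2 := Py.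
  have e1 : (x0 n).1 - (y + (c n, 0)).1 = - y.1 by rewrite /c /=; ring.
  have e2 : (y + (c n, 0)).2 = y.2 := addr0 y.2.
  rewrite e1 normrN in h1; rewrite e2 in h2.
  by split; [lra|rewrite subr0 gtr0_norm//; lra].
have [nk [v [nkS [vA vM vQ vN] v2 v1]]] :=
  concentrated_compactness lam1 L'0 beta0 uA uC uM uQ uL uN.
have uE k x : Pi x -> u k x = shift1 (wN k) (c k) x.
  by move=> Px; rewrite /u /u0 zextE; [congr (wN k (_, _)); exact: addr0|exact/Pi_shift].
have u_off k x : ~ Pi x -> u k x = 0 by have [_ + _ _] := uA k; apply.
have v_off x : ~ Pi x -> v x = 0 by have [_ + _ _] := vA; apply.
exists v; split.
  by split; [exact: adm_Aclass|rewrite adm_Elam// vQ hM].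
(* Adding [N] returns to the indices of the original sequence. *)
exists (fun k => nk k + N)%N, (fun k => c (nk k)); split; first by move=> k; rewrite ltn_add2r.
split.
  have -> : (fun k => intPi (fun x => ((shift1 (w (nk k + N)%N) (c (nk k)) x - v x) ^+ 2)%:E)) =
      (fun k => (L2ip (@lebesgue2 R) (u (nk k) - v) (u (nk k) - v))%:E).
    apply/funext => k; rewrite L2ipE; [|exact: (L2B (adm_L2 (uA _)) (adm_L2 vA))..].
    apply: intPi_nint => x Px; first by rewrite -(uE _ _ Px) expr2.
    by rewrite [(_ - _) x](_ : _ = u (nk k) x - v x)// u_off// v_off// subrr mulr0.
  by apply: cvg_EFin => //; apply: nearW.
apply: cvge0_ge0 => [k|e e0].
  by apply: integral_ge0 => x _; rewrite lee_fin.
apply: filterS (v1 e e0) => k; apply: le_trans.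
apply: lexx_eq; apply: intPi_nint => x Px.
  by rewrite -(uE _ _ Px) -mulrBr normrM.
by rewrite u_off// v_off// subrr normr0 mulr0.
Unshelve. all: by end_near. Qed.
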